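(* Let $u_0\in\mathcal U$ and let $u$ be the entropy solution of the problem in the context. For every $K\in\mathbb N$ there exist a LRNR $H_r$ with rank $r=2$, degrees of freedom $K$, width $\sim K^2$ and depth $L=5$, and coefficient functions $\gamma(t),\theta(t)$, each linear or constant in $t$, such that $h(t):=h(\gamma(t),\theta(t))\in H_r$ satisfies, for all $t\in\Omega_t$, $$\|u(\cdot,t)-h(t)\|_{L^1(\Omega_x)}\lesssim\frac1K|u_0|_{TV(\Omega_x)}\big(1+|u_0|_{TV(\Omega_x)}\big)\big(1+T\|F''\|_{L^\infty(u_0(\Omega_x))}\big),$$ with an implicit constant independent of $K$, $u_0$, $F$ and $T$.
   Context: $\Omega_x=(0,1)$, $\Omega_t=(0,T)$, $F\in C^\infty(\mathbb{R})$ strictly convex; $\mathcal U$ is the set of functions of bounded variation on $\Omega_x$ with compact support in $\Omega_x$. $u$ is the entropy solution of $\partial_t u+\partial_x(F(u))=0$ on $\Omega_x\times\Omega_t$, $u(\cdot,0)=u_0$, $u(0,t)=u(1,t)=0$, with $T$ small enough that the zero boundary conditions hold for all $t\in\Omega_t$. LRNR (low rank neural representation): fix depth $L$ and widths $M_0=1,M_1,\dots,M_{L-1},M_L=1$, width $M=\max_\ell M_\ell$. A feedforward network is $h(x;W,B)=A^L\circ\sigma\odot A^{L-1}\circ\cdots\circ\sigma\odot A^1(x)$ with $A^\ell(z)=W^\ell z+B^\ell$, $W^\ell\in\mathbb{R}^{M_\ell\times M_{\ell-1}}$, $B^\ell\in\mathbb{R}^{M_\ell}$, and $\sigma(x)=\max\{0,x\}$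 applied entrywise. A LRNR of rank $r$ is given by fixed $U_1^\ell,\dots,U_r^\ell$ (weight-shaped) and $V_1^\ell,\dots,V_r^\ell$ (bias-shaped) for each layer $\ell$, each a product $a\bullet b$ of two vectors with $\bullet\in\{\otimes,\otimes_d,{}_d\otimes\}$, where $\otimes$ is the Kronecker product, $a\otimes_d b:=a\otimes\mathrm{diag}(b)$, $a\,{}_d\!\otimes b:=\mathrm{diag}(a)\otimes b$; and coefficient sets $C^\ell,D^\ell\subset\mathbb{R}^r$. Its members are $h(\gamma,\theta):=h(\cdot;W,B)$ with $W^\ell=\sum_{i=1}^r\gamma_i^\ell U_i^\ell$, $B^\ell=\sum_{i=1}^r\theta_i^\ell V_i^\ell$. The spatial variable $x$ is the only network input; time $t$ enters only through the coefficients. The degrees of freedom $K$ is the number of stored (unconstrained) real parameters defining the $U_i^\ell,V_i^\ell$. *)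

(* Defs.v *)
From HB Require Import structures.
From mathcomp Require Import all_boot all_order all_algebra.
From mathcomp Require Import all_classical all_reals all_analysis.
Set Implicit Arguments. Unset Strict Implicit. Unset Printing Implicit Defensive.
Import Order.TTheory GRing.Theory Num.Theory.
Import numFieldNormedType.Exports.
Local Open Scope classical_set_scope.
Local Open Scope ring_scope.

Section Defs.
Variable R : realType.

Definition smooth (F : R -> R) : Prop :=
  forall (n : nat) (x : R), derivable (derive1n n F) x 1.

Definition strictly_convex (F : R -> R) : Prop :=
  forall x y l : R, x != y -> 0 < l < 1 ->
    F (l * x + (1 - l) * y) < l * F x + (1 - l) * F y.

Definition F2 (F : R -> R) : R -> R := derive1n 2 F.

Definition TV01 (u0 : R -> R) : R := fine (total_variation 0 1 u0).

(* the class U: functions of bounded variation on (0,1) with compact support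
   in (0,1) (u0 is extended by zero outside (0,1)). *)
Definition in_U (u0 : R -> R) : Prop :=
  (exists a b : R, 0 < a /\ a <= b /\ b < 1 /\
     forall x, (x < a \/ b < x) -> u0 x = 0) /\
  bounded_variation 0 1 u0.

Definition supF2 (F u0 : R -> R) : R :=
  sup [set `|F2 F (u0 x)| | x in `]0, 1[].

Definition dx (phi : R -> R -> R) (x t : R) : R := derive1 (fun y => phi y t) x.
Definition dt (phi : R -> R -> R) (x t : R) : R := derive1 (fun s => phi x s) t.

Definition test_fun (T : R) (phi : R -> R -> R) : Prop :=
  (exists a b c d : R, 0 < c /\ d < T /\
     forall x t, ~ (a <= x <= b /\ c <= t <= d) -> phi x t = 0) /\
  (forall x t, derivable (fun y => phi y t) x 1 /\ derivable (fun s => phi x s) t 1) /\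
  continuous (fun p : R * R => phi p.1 p.2) /\
  continuous (fun p : R * R => dx phi p.1 p.2) /\
  continuous (fun p : R * R => dt phi p.1 p.2) /\
  (forall x t, 0 <= phi x t).

(* Kruzhkov entropy solution on R x (0,T) of u_t + F(u)_x = 0, u(.,0) = u0,
   taken in its representative continuous in time with values in L^1. *)
Definition entropy_solution (T : R) (F u0 : R -> R) (u : R -> R -> R) : Prop :=
  measurable_fun setT (fun p : R * R => u p.1 p.2) /\
  (exists M : R, forall x t, 0 <= t < T -> `|u x t| <= M) /\
  (forall (k : R) (phi : R -> R -> R), test_fun T phi ->
     (0 <= \int[(@lebesgue_measure R) \x (@lebesgue_measure R)]_(p in setT)
        ((`|u p.1 p.2 - k| * dt phi p.1 p.2
          + Num.sg (u p.1 p.2 - k) * (F (u p.1 p.2) - F k) * dx phi p.1 p.2)%:E))%E) /\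
  (forall x, u x 0 = u0 x) /\
  (forall t0, 0 <= t0 < T ->
     (fun t => (\int[@lebesgue_measure R]_(x in setT) (`|u x t - u x t0|)%:E)%E)
       @ within [set t | 0 <= t < T] (nbhs t0) --> 0%E).

Record nmat := NMat { nr : nat; nc : nat; ne : nat -> nat -> R }.

Record vfac := VFac { vrows : nat; vcols : nat; vent : nat -> R }.
Definition vlen (v : vfac) : nat := (vrows v * vcols v)%N.
Definition is_vector (v : vfac) : Prop := vrows v = 1%N \/ vcols v = 1%N.
Definition vmat (v : vfac) : nmat :=
  NMat (vrows v) (vcols v) (fun i j => vent v (i + j)%N).
Definition diagv (v : vfac) : nmat :=
  NMat (vlen v) (vlen v) (fun i j => if i == j then vent v i else 0).

Definition kron (A B : nmat) : nmat :=
  NMat (nr A * nr B)%N (nc A * nc B)%N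
    (fun i j => ne A (i %/ nr B)%N (j %/ nc B)%N * ne B (i %% nr B)%N (j %% nc B)%N).

Inductive prodkind := PKron (* a (x) b *) | PKronD (* a (x)_d b *) | PDKron (* a _d(x) b *).

Record factor := Factor { fkind : prodkind; fa : vfac; fb : vfac }.

Definition factor_mat (f : factor) : nmat :=
  match fkind f with
  | PKron => kron (vmat (fa f)) (vmat (fb f))
  | PKronD => kron (vmat (fa f)) (diagv (fb f))
  | PDKron => kron (diagv (fa f)) (vmat (fb f))
  end.

(* A LRNR architecture: depth, widths M_0..M_L, rank r, and the fixed
   U_i^l (weight-shaped) and V_i^l (bias-shaped), l = 1..L, i = 0..r-1. *)
Record lrnr := LRNR {
  depth : nat;
  wid : nat -> nat;
  rank : nat;
  Uf : nat -> nat -> factor;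
  Vf : nat -> nat -> factor }.

Definition lrnr_wf (N : lrnr) : Prop :=
  wid N 0 = 1%N /\ wid N (depth N) = 1%N /\
  forall l i, (1 <= l <= depth N)%N -> (i < rank N)%N ->
    is_vector (fa (Uf N l i)) /\ is_vector (fb (Uf N l i)) /\
    is_vector (fa (Vf N l i)) /\ is_vector (fb (Vf N l i)) /\
    nr (factor_mat (Uf N l i)) = wid N l /\ nc (factor_mat (Uf N l i)) = wid N l.-1 /\
    nr (factor_mat (Vf N l i)) = wid N l /\ nc (factor_mat (Vf N l i)) = 1%N.

Definition width (N : lrnr) : nat := \max_(l < (depth N).+1) wid N l.

Definition dof (N : lrnr) : nat :=
  \sum_(1 <= l < (depth N).+1) \sum_(i < rank N)
    (vlen (fa (Uf N l i)) + vlen (fb (Uf N l i))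
     + vlen (fa (Vf N l i)) + vlen (fb (Vf N l i)))%N.

Definition relu (z : nat -> R) : nat -> R := fun j => Num.max (z j) 0.

Definition affine (N : lrnr) (gam th : nat -> nat -> R) (l : nat) (z : nat -> R)
  : nat -> R :=
  fun j => \sum_(k < wid N l.-1)
             (\sum_(i < rank N) gam l i * ne (factor_mat (Uf N l i)) j k) * z k
           + \sum_(i < rank N) th l i * ne (factor_mat (Vf N l i)) j 0%N.

(* output of layer n (before activation); layer 0 is the input x *)
Fixpoint layer (N : lrnr) (gam th : nat -> nat -> R) (x : R) (n : nat) : nat -> R :=
  match n with
  | 0 => fun _ => x
  | m.+1 => affine N gam th m.+1
              (if m == 0%N then layer N gam th x m else relu (layer N gam th x m))
  end.

Definition lrnr_eval (N : lrnr) (gam th : nat -> nat -> R) (x : R) : R :=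
  layer N gam th x (depth N) 0%N.

End Defs.

(* Main.v *)
Require Import Defs.
From HB Require Import structures.
From mathcomp Require Import all_boot all_order all_algebra.
From mathcomp Require Import all_classical all_reals all_analysis.
From mathcomp Require Import measurable_realfun ring lra zify.
Set Implicit Arguments. Unset Strict Implicit. Unset Printing Implicit Defensive.
Import Order.TTheory GRing.Theory Num.Theory.
Import numFieldNormedType.Exports.
Local Open Scope classical_set_scope.
Local Open Scope ring_scope.

(* With h = TV(u0) / K, sample u0 at the points i / K and round down to multiples of h; the
   resulting step function w0 is within 2h of u0 in L^1. Evolve w0 by front tracking on a grid of
   values: a decreasing jump is a shock, an increasing jump is split at the grid values, and colliding
   fronts merge.
   On a sufficiently fine grid, Kruzhkov's inequality, tested against the strips between consecutive
   fronts, shows that this evolution stays within O(h) of u. On the coarse grid of the multiples of h,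
   which gives only O(K) fronts, the same estimate would bring in F''. Instead the coarse and the fine
   evolutions are compared through their potentials, which by a Hopf-Lax formula are infimal
   convolutions of the same function with the Legendre transforms A0, A1 of F restricted to the two
   grids. Here A1 - A0 is h-Lipschitz and vanishes at 0 (the minimum point of F is put in both grids) and
   on the characteristic of the value 0. Interpolating between A0 and A1, and using that minimizers
   depend monotonically on x, the difference of the potentials has variation at most 4h on [0, 1], and
   this variation is the L^1 distance of the two evolutions.
   In the coarse evolution every front moves along a line until it merges, so the solution is a sum of
   O(K) jumps J 1[x >= p + s t] 1[t >= tau], each approximated by
   J relu(ramp((x - p - s t) / e) + ramp((t - tau) / e) - 1), where ramp z = relu z - relu (z - 1). *)

(** * Slopes of the flux *)

(** The mesh of the fine grid depends on [F''] and on [T]. This is harmless because the fine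
    evolution is only a tool of the proof: the network stores the fronts of the coarse one, whose
    number is bounded in terms of [K] alone. So only the distance between two evolutions with the
    same initial value has to be free of [F'']. The maximizers in a Legendre transform are its
    slopes, and by strict convexity a maximizer over one grid and one over the other are at most a
    coarse gap apart; hence the Lipschitz constant h, at every time. A jump cannot be switched on
    alone: half switched, it would be wrong on a whole half-line. At a collision each old jump
    therefore leaves its line for the new one by a pair of opposite jumps, which is small while the
    switch is moving because the two lines have only just separated. The error is 2h (quantization)
    + h (rarefactions on the fine grid) + 4h (comparison) + h (ramps). There are at most 4K coarse
    fronts; each collision removes one and adds two pairs of jumps, so 4K + 16K = 20K units
    suffice. *)

Section Slopes.
Variables (R : realType) (F dF : R -> R).

(** The value [dF a] on the diagonal keeps [slope] monotone in each argument for all pairs,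
    degenerate jumps included. *)
Definition slope (a b : R) : R := if a == b then dF a else (F b - F a) / (b - a).

Lemma slopeE a b : slope a b * (b - a) = F b - F a.
Proof.
rewrite /slope; case: eqP => [->|/eqP ab]; first by rewrite !subrr mulr0.
by rewrite divfK // subr_eq0 eq_sym.
Qed.

Lemma slopeC a b : slope a b = slope b a.
Proof.
rewrite /slope eq_sym; case: eqP => [->//|/eqP ab].
by rewrite -[F b - F a]opprB -[b - a]opprB invrN mulrNN.
Qed.

Hypothesis tang : forall a b, F a + dF a * (b - a) <= F b.

Lemma tangent_slope a b : a <= b -> dF a <= slope a b <= dF b.
Proof.
move=> ab; rewrite /slope; case: eqP => [->|/eqP nab]; first by rewrite lexx.
have ba : 0 < b - a by rewrite subr_gt0 lt_neqAle nab.
rewrite ler_pdivlMr // ler_pdivrMr //.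
by have := tang a b; have := tang b a; lra.
Qed.

(** Chord slopes over adjacent intervals average, weighted by length, to the slope over their union,
    and [tangent_slope] orders the two parts. The cases are the positions of [a] relative to [b] and
    [b']. *)
Lemma slope_monor a b b' : b <= b' -> slope a b <= slope a b'.
Proof.
move=> bb'; have [e|nb] := eqVneq b b'; first by rewrite e.
have {nb}bb' : b < b' by rewrite lt_neqAle nb.
have Eb := slopeE a b; have Eb' := slopeE a b'; have Ebb := slopeE b b'.
have /andP[l1 l2] := tangent_slope (ltW bb').
case: (leP a b) => ab.
  have /andP[m1 m2] := tangent_slope ab.
  have /andP[n1 n2] := tangent_slope (le_trans ab (ltW bb')).
  have : (slope a b' - slope a b) * (b' - a) >= 0.
    have : 0 <= (slope b b' - slope a b) * (b' - b) by apply: mulr_ge0; lra.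
    move: Eb Eb' Ebb; set u := slope a b; set v := slope a b'; set w := slope b b'.
    by nra.
  by rewrite pmulr_lge0 ?subr_ge0 // subr_gt0; lra.
have /andP[] := tangent_slope (ltW ab); rewrite slopeC => m1 m2.
case: (leP a b') => ab'.
  by have /andP[n1 n2] := tangent_slope ab'; lra.
have /andP[n1 n2] := tangent_slope (ltW ab').
have : (slope a b' - slope a b) * (a - b) >= 0.
  have : 0 <= (slope a b' - slope b b') * (b' - b).
    by apply: mulr_ge0; rewrite ?(slopeC a b'); lra.
  move: Eb Eb' Ebb; set u := slope a b; set v := slope a b'; set w := slope b b'.
  by nra.
by rewrite pmulr_lge0 ?subr_ge0 // subr_gt0.
Qed.

Lemma slope_monol a a' b : a <= a' -> slope a b <= slope a' b.
Proof. by move=> aa'; rewrite (slopeC a) (slopeC a'); exact: slope_monor. Qed.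

(* the entropy flux of Kruzhkov's entropy |u - k| *)
Definition kflux (k v : R) : R := Num.sg (v - k) * (F v - F k).

Lemma kflux_ge k v : k <= v -> kflux k v = F v - F k.
Proof.
rewrite /kflux le_eqVlt => /orP[/eqP->|kv]; first by rewrite !subrr mulr0.
by rewrite gtr0_sg ?subr_gt0 // mul1r.
Qed.

Lemma kflux_le k v : v <= k -> kflux k v = F k - F v.
Proof.
rewrite /kflux le_eqVlt => /orP[/eqP->|kv]; first by rewrite !subrr mulr0.
by rewrite ltr0_sg ?subr_lt0 // mulN1r opprB.
Qed.

(** The rate at which a front of the approximation, jumping from [a] to [b] with the
    Rankine-Hugoniot speed, can increase the L^1 distance to a solution that takes the value [v]
    there. *)
Definition front_prod (a b v : R) : R :=
  kflux b v - kflux a v - slope a b * (`|v - b| - `|v - a|).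

(** For [v] outside the jump the speed makes the production vanish; inside, it is twice [F v] minus
    the chord at [v], which convexity makes nonpositive. Shocks therefore cost nothing. *)
Lemma front_prod_down a b v : b <= a -> front_prod a b v <= 0.
Proof.
move=> ba; rewrite /front_prod; have E := slopeE a b.
case: (leP a v) => av.
  by rewrite !kflux_ge ?ger0_norm; lra.
case: (leP b v) => bv; last first.
  by rewrite !kflux_le ?ler0_norm; lra.
rewrite (kflux_le (ltW av)) (kflux_ge bv) (ger0_norm (x := v - b)) ?(ler0_norm (x := v - a)); try lra.
have /andP[h1 h2] := tangent_slope bv; have /andP[h3 h4] := tangent_slope (ltW av).
have h5 := slope_monor b (ltW av); rewrite (slopeC b a) in h5.
have E1 := slopeE b v.
have : 0 <= (slope a b - slope b v) * (v - b) by apply: mulr_ge0; lra.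
by lra.
Qed.

(** Inside an upward jump the production is twice the chord at [v] minus [F v], which is positive;
    the tangent at [a] bounds this gap. It is the whole price of replacing a rarefaction by
    jumps. *)
Lemma front_prod_up a b v : a <= b -> front_prod a b v <= 2 * (dF b - dF a) * (b - a).
Proof.
move=> ab; have E := slopeE a b.
have /andP[s1 s2] := tangent_slope ab.
have pos : 0 <= 2 * (dF b - dF a) * (b - a) by apply: mulr_ge0; lra.
case: (leP b v) => bv.
  by rewrite /front_prod !kflux_ge ?ger0_norm; lra.
case: (leP a v) => av; last first.
  by rewrite /front_prod !kflux_le ?ler0_norm; lra.
rewrite /front_prod (kflux_le (ltW bv)) (kflux_ge av) (ler0_norm (x := v - b)) ?(ger0_norm (x := v - a)); try lra.
have t := tang a v.
have h : (slope a b - dF a) * (v - a) <= (dF b - dF a) * (b - a) by apply: ler_pM; lra.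
by lra.
Qed.

End Slopes.

(** * A continuously differentiable step, the building block of the test functions *)

Section Smoothstep.
Variable R : realType.
Implicit Types x t z : R.

(** For a quadratic spline this reduces differentiability, at the knots as well, to polynomial
    inequalities between the pieces. *)
Lemma is_derive_quadratic (f : R -> R) (x d C : R) :
  (forall h, `|f (x + h) - f x - h * d| <= C * h ^+ 2) -> is_derive x 1 f d.
Proof.
move=> H.
have C0 : 0 <= C by have := H 1; rewrite expr1n mulr1; apply: le_trans.
suff cv : h^-1 *: (f (h *: 1 + x) - f x) @[h --> 0^'] --> d.
  by split; [apply/cvg_ex; exists d | apply/cvg_lim].
apply/cvgrPdist_le => e e0; near=> h.
have h0 : h != 0 by near: h; exact: nbhs_dnbhs_neq.
have hs : `|h| <= e / (C + 1).
  near: h; apply: dnbhs0_le; apply: divr_gt0 => //; lra.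
rewrite [h *: 1]mulr1 (addrC h) [_ *: _]mulrC.
have -> : d - (f (x + h) - f x) / h = - (f (x + h) - f x - h * d) / h by field.
rewrite normrM normrN normfV ler_pdivrMr ?normr_gt0 //.
apply: le_trans (H h) _.
have -> : h ^+ 2 = `|h| * `|h| by rewrite -normrM ger0_norm ?sqr_ge0.
rewrite mulrA ler_wpM2r ?normr_ge0 //.
apply: le_trans (_ : C * (e / (C + 1)) <= _); first by rewrite ler_wpM2l.
by rewrite mulrA ler_pdivrMr; [nra | lra].
Unshelve. all: by end_near. Qed.

Definition pos_part z : R := Num.max z 0.

Lemma pos_partE z : pos_part z = if 0 <= z then z else 0.
Proof. by rewrite /pos_part maxEle; case: (leP z 0); case: (leP 0 z) => ? ? //; lra. Qed.

Lemma continuous_pos_part : continuous pos_part.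
Proof.
move=> x; apply: (@continuous_max _ _ (id : R -> R) (cst 0)) => //; exact: cvg_cst.
Qed.

(* quadratic spline rising from 0 to 1 on [0, 1] *)
Definition sstep z : R :=
  2 * (pos_part z ^+ 2 - 2 * pos_part (z - 1 / 2) ^+ 2 + pos_part (z - 1) ^+ 2).
Definition dsstep z : R :=
  4 * (pos_part z - 2 * pos_part (z - 1 / 2) + pos_part (z - 1)).

Lemma is_derive_sstep z : is_derive z 1 sstep (dsstep z).
Proof.
apply: (@is_derive_quadratic _ _ _ 10) => h.
rewrite /sstep /dsstep !pos_partE ler_norml.
by case: (leP 0 z) => ?; case: (leP 0 (z + h)) => ?; case: (leP 0 (z - 1 / 2)) => ?;
  case: (leP 0 (z + h - 1 / 2)) => ?; case: (leP 0 (z - 1)) => ?;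
  case: (leP 0 (z + h - 1)) => ?; apply/andP; split; nra.
Qed.

Lemma sstep0 z : z <= 0 -> sstep z = 0.
Proof.
by move=> h; rewrite /sstep !pos_partE; case: (leP 0 z) => ?; case: (leP 0 (z - 1 / 2)) => ?;
  case: (leP 0 (z - 1)) => ?; nra.
Qed.

Lemma sstep1 z : 1 <= z -> sstep z = 1.
Proof.
by move=> h; rewrite /sstep !pos_partE; case: (leP 0 z) => ?; case: (leP 0 (z - 1 / 2)) => ?;
  case: (leP 0 (z - 1)) => ?; nra.
Qed.

Lemma sstep_homo : {homo sstep : a b / a <= b}.
Proof.
move=> a b ab; rewrite /sstep !pos_partE.
by case: (leP 0 a) => ?; case: (leP 0 (a - 1 / 2)) => ?;
  case: (leP 0 (a - 1)) => ?; case: (leP 0 b) => ?; case: (leP 0 (b - 1 / 2)) => ?;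
  case: (leP 0 (b - 1)) => ?; nra.
Qed.

Lemma sstep_ge0 z : 0 <= sstep z.
Proof.
by rewrite -(@sstep0 (Num.min z 0)) ?ge_min ?lexx ?orbT //; apply: sstep_homo; rewrite ge_min lexx.
Qed.

Lemma sstep_le1 z : sstep z <= 1.
Proof.
by rewrite -[leRHS](@sstep1 (Num.max z 1)) ?le_max ?lexx ?orbT //; apply: sstep_homo; rewrite le_max lexx.
Qed.

Lemma dsstep_ge0 z : 0 <= dsstep z.
Proof.
by rewrite /dsstep !pos_partE; case: (leP 0 z) => ?; case: (leP 0 (z - 1 / 2)) => ?;
  case: (leP 0 (z - 1)) => ?; nra.
Qed.

Lemma dsstep_le2 z : dsstep z <= 2.
Proof.
by rewrite /dsstep !pos_partE; case: (leP 0 z) => ?; case: (leP 0 (z - 1 / 2)) => ?;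
  case: (leP 0 (z - 1)) => ?; nra.
Qed.

Lemma dsstep0 z : z <= 0 -> dsstep z = 0.
Proof.
by move=> h; rewrite /dsstep !pos_partE; case: (leP 0 z) => ?; case: (leP 0 (z - 1 / 2)) => ?;
  case: (leP 0 (z - 1)) => ?; nra.
Qed.

Lemma dsstep1 z : 1 <= z -> dsstep z = 0.
Proof.
by move=> h; rewrite /dsstep !pos_partE; case: (leP 0 z) => ?; case: (leP 0 (z - 1 / 2)) => ?;
  case: (leP 0 (z - 1)) => ?; nra.
Qed.

Lemma continuous_sstep : continuous sstep.
Proof.
by move=> z; apply/differentiable_continuous/derivable1_diffP; have [] := is_derive_sstep z.
Qed.

Lemma continuous_dsstep : continuous dsstep.
Proof.
move=> z; rewrite /dsstep.
have sh (c : R) : pos_part (y - c) @[y --> z] --> pos_part (z - c).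
  apply: (@continuous_comp _ _ _ (fun y : R => y - c) pos_part).
    by apply: cvgB => //; exact: cvg_cst.
  exact: continuous_pos_part.
apply: cvgM; first exact: cvg_cst.
apply: cvgD => //; apply: cvgB; first exact: continuous_pos_part.
by apply: cvgM => //; exact: cvg_cst.
Qed.

Lemma is_derive_sstep_affine (a b x : R) :
  is_derive x 1 (fun x => sstep (a * x + b)) (a * dsstep (a * x + b)).
Proof.
have d1 : is_derive x 1 (fun x : R => a * x + b) a.
  have -> : (fun x : R => a * x + b) = (a \*: (id : R -> R)) + cst b by apply/funext.
  apply: is_derive_eq; rewrite addr0; exact: mulr1.
rewrite [a * dsstep _]mulrC; exact: (@is_derive1_comp R sstep (fun x => a * x + b) x _ _ (is_derive_sstep (a * x + b)) d1).
Qed.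
End Smoothstep.

(** * Strips between two lines *)

Section Strip.
Variable R : realType.
Implicit Types x t z : R.

(** Written in the form [a * t + b] inside [sstep], so that [is_derive_sstep_affine] applies as it
    stands. *)
Definition rise (c w t : R) : R := sstep (w^-1 * t + - (c / w)).
Definition drise (c w t : R) : R := w^-1 * dsstep (w^-1 * t + - (c / w)).

Lemma riseE c w t : rise c w t = sstep ((t - c) / w).
Proof. by rewrite /rise; congr sstep; rewrite mulrBl mulrC. Qed.
Lemma driseE c w t : drise c w t = dsstep ((t - c) / w) / w.
Proof. by rewrite /drise mulrC; congr (dsstep _ / _); rewrite mulrBl mulrC. Qed.

Lemma is_derive_rise c w t : is_derive t 1 (rise c w) (drise c w t).
Proof. exact: is_derive_sstep_affine. Qed.

Lemma rise0 c w t : 0 < w -> t <= c -> rise c w t = 0.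
Proof. by move=> w0 tc; rewrite riseE sstep0 // pmulr_lle0 ?invr_gt0 // subr_le0. Qed.
Lemma rise1 c w t : 0 < w -> c + w <= t -> rise c w t = 1.
Proof. by move=> w0 tc; rewrite riseE sstep1 // ler_pdivlMr //; lra. Qed.
Lemma drise0 c w t : 0 < w -> t <= c -> drise c w t = 0.
Proof. by move=> w0 tc; rewrite driseE dsstep0 ?mul0r // pmulr_lle0 ?invr_gt0 // subr_le0. Qed.
Lemma drise1 c w t : 0 < w -> c + w <= t -> drise c w t = 0.
Proof. by move=> w0 tc; rewrite driseE dsstep1 ?mul0r // ler_pdivlMr //; lra. Qed.
Lemma drise_ge0 c w t : 0 < w -> 0 <= drise c w t.
Proof. by move=> w0; rewrite driseE divr_ge0 ?dsstep_ge0 // ltW. Qed.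
Lemma drise_le c w t : 0 < w -> drise c w t <= 2 / w.
Proof. by move=> w0; rewrite driseE ler_pM2r ?invr_gt0 // dsstep_le2. Qed.
Lemma rise_ge0 c w t : 0 <= rise c w t. Proof. exact: sstep_ge0. Qed.
Lemma rise_le1 c w t : rise c w t <= 1. Proof. exact: sstep_le1. Qed.
Lemma rise_antimono c c' w t : 0 < w -> c <= c' -> rise c' w t <= rise c w t.
Proof. by move=> w0 cc; rewrite !riseE; apply: sstep_homo; rewrite ler_pM2r ?invr_gt0 //; lra. Qed.

Lemma is_derive_rise_moving (p s w x t : R) :
  is_derive t 1 (fun t => rise (p + s * t) w x) (- s * drise (p + s * t) w x).
Proof.
have -> : (fun t => rise (p + s * t) w x) =
    fun t => sstep ((- s / w) * t + (x - p) / w).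
  by apply/funext => t'; rewrite riseE; congr sstep; ring.
apply: is_derive_eq (is_derive_sstep_affine _ _ _) _.
rewrite driseE (_ : - s / w * t + (x - p) / w = (x - (p + s * t)) / w); last by ring.
by ring.
Qed.

(* tent over the strip between the lines p1 + s1 t and p2 + s2 t, during [c, d + w] *)
Definition window (c d w t : R) : R := rise c w t - rise d w t.
Definition dwindow (c d w t : R) : R := drise c w t - drise d w t.
Definition strip (p1 s1 p2 s2 e x t : R) : R :=
  rise (p1 + s1 * t) e x - rise (p2 + s2 * t) e x.
Definition dxstrip (p1 s1 p2 s2 e x t : R) : R :=
  drise (p1 + s1 * t) e x - drise (p2 + s2 * t) e x.
Definition dtstrip (p1 s1 p2 s2 e x t : R) : R :=
  - s1 * drise (p1 + s1 * t) e x + s2 * drise (p2 + s2 * t) e x.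

Lemma window0 c d w t : 0 < w -> c <= d -> ~ (c <= t <= d + w) -> window c d w t = 0.
Proof.
move=> w0 cd H; rewrite /window; have [tc|tc] := ltrP t c;
  last (have [td|td] := ltrP (d + w) t; last by case: H; rewrite tc td).
  by rewrite !rise0 ?subrr; lra.
by rewrite !rise1 ?subrr; lra.
Qed.
Lemma window_ge0 c d w t : 0 < w -> c <= d -> 0 <= window c d w t.
Proof. move=> w0 cd. by rewrite /window subr_ge0 rise_antimono. Qed.
Lemma window_le1 c d w t : window c d w t <= 1.
Proof. by rewrite /window; have := rise_le1 c w t; have := rise_ge0 d w t; lra. Qed.
Lemma dwindow0 c d w t : 0 < w -> c <= d -> ~ (c <= t <= d + w) -> dwindow c d w t = 0.
Proof.
move=> w0 cd H; rewrite /dwindow; have [tc|tc] := ltrP t c;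
  last (have [td|td] := ltrP (d + w) t; last by case: H; rewrite tc td).
  by rewrite !drise0 ?subrr; lra.
by rewrite !drise1 ?subrr; lra.
Qed.

Lemma strip0 p1 s1 p2 s2 e x t : 0 < e -> p1 + s1 * t <= p2 + s2 * t ->
  ~ (p1 + s1 * t <= x <= p2 + s2 * t + e) -> strip p1 s1 p2 s2 e x t = 0.
Proof.
move=> e0 l12 H; rewrite /strip; have [tc|tc] := ltrP x (p1 + s1 * t);
  last (have [td|td] := ltrP (p2 + s2 * t + e) x; last by case: H; rewrite tc td).
  by rewrite !rise0 ?subrr; lra.
by rewrite !rise1 ?subrr; lra.
Qed.

Section StripTest.
Variables (c d w p1 s1 p2 s2 e : R).
Let phi x t : R := window c d w t * strip p1 s1 p2 s2 e x t.

Let dphi_x x t : is_derive x 1 (fun x => phi x t) (window c d w t * dxstrip p1 s1 p2 s2 e x t).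
Proof.
have h1 := is_derive_rise (p1 + s1 * t) e x; have h2 := is_derive_rise (p2 + s2 * t) e x.
exact: (is_deriveZ (window c d w t) (is_deriveB h1 h2)).
Qed.

Let dphi_t x t : is_derive t 1 (fun t => phi x t)
  (dwindow c d w t * strip p1 s1 p2 s2 e x t + window c d w t * dtstrip p1 s1 p2 s2 e x t).
Proof.
have h1 := is_derive_rise c w t; have h2 := is_derive_rise d w t.
have h3 := is_derive_rise_moving p1 s1 e x t; have h4 := is_derive_rise_moving p2 s2 e x t.
have h := is_deriveM (is_deriveB h1 h2) (is_deriveB h3 h4).
apply: is_derive_eq h _.
rewrite /dtstrip /dwindow /strip /window /GRing.scale /=.
by rewrite !fctE; ring.
Qed.

Lemma dx_strip x t : dx phi x t = window c d w t * dxstrip p1 s1 p2 s2 e x t.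
Proof. by rewrite /dx derive1E; case: (dphi_x x t). Qed.
Lemma dt_strip x t : dt phi x t =
  dwindow c d w t * strip p1 s1 p2 s2 e x t + window c d w t * dtstrip p1 s1 p2 s2 e x t.
Proof. by rewrite /dt derive1E; case: (dphi_t x t). Qed.

Let cont_lin (a b g : R) (f : R -> R) : continuous f ->
  continuous (fun p : R * R => f (a * p.1 + b * p.2 + g)).
Proof.
move=> cf p; apply: (@continuous_comp _ _ _ (fun p : R * R => a * p.1 + b * p.2 + g) f).
  apply: cvgD; last exact: cvg_cst.
  by apply: cvgD; apply: cvgM; first [exact: cvg_cst | exact: cvg_fst | exact: cvg_snd].
exact: cf.
Qed.

Let cont_rise (f : R -> R) p s : continuous f ->
  continuous (fun q : R * R => f (e^-1 * q.1 + - ((p + s * q.2) / e))).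
Proof.
move=> cf; rewrite (_ : (fun _ => _) =
   fun q : R * R => f (e^-1 * q.1 + (- (s / e)) * q.2 + - (p / e))); first exact: cont_lin.
by apply/funext => q; congr f; ring.
Qed.

Let cont_time (f : R -> R) r : continuous f ->
  continuous (fun q : R * R => f (w^-1 * q.2 + - (r / w))).
Proof.
move=> cf; rewrite (_ : (fun _ => _) =
   fun q : R * R => f (0 * q.1 + w^-1 * q.2 + - (r / w))); first exact: cont_lin.
by apply/funext => q; congr f; ring.
Qed.

Lemma test_fun_strip (T : R) : 0 < w -> 0 < e -> c <= d -> 0 < c -> d + w < T ->
  (forall t, c <= t <= d + w -> p1 + s1 * t <= p2 + s2 * t) -> test_fun T phi.
Proof.
move=> w0 e0 cd c0 dT l12.
split; [|split; [|split; [|split; [|split]]]].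
- exists (- (`|p1| + `|s1| * T)), (`|p2| + `|s2| * T + e), c, (d + w); split=> //; split=> // x t xt.
  rewrite /phi; have [tcd|tcd] := boolP (c <= t <= d + w); last first.
    by rewrite window0 ?mul0r //; exact/negP.
  rewrite strip0 ?mulr0 ?l12 // => /andP[x1 x2]; apply: xt; split=> //.
  have T0 : 0 <= t by case/andP: tcd; lra.
  have tT : t <= T by case/andP: tcd; lra.
  have b (s : R) : `|s * t| <= `|s| * T by rewrite normrM (ger0_norm T0) ler_wpM2l.
  have := b s1; have := b s2; rewrite !ler_norml => /andP[? ?] /andP[? ?].
  have := ler_norm p2; have := ler_norm (- p1); rewrite normrN => ? ?.
  by apply/andP; split; lra.
- by move=> x t; split; [case: (dphi_x x t) | case: (dphi_t x t)].
- move=> q; rewrite /phi; apply: cvgM.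
    by apply: cvgB; apply: cont_time; exact: continuous_sstep.
  by apply: cvgB; apply: cont_rise; exact: continuous_sstep.
- rewrite (_ : (fun _ => _) = fun q : R * R => window c d w q.2 * dxstrip p1 s1 p2 s2 e q.1 q.2); last first.
    by apply/funext => q; rewrite dx_strip.
  move=> q; apply: cvgM.
    by apply: cvgB; apply: cont_time; exact: continuous_sstep.
  by apply: cvgB; apply: cvgM; try exact: cvg_cst; apply: cont_rise; exact: continuous_dsstep.
- rewrite (_ : (fun _ => _) = fun q : R * R =>
    dwindow c d w q.2 * strip p1 s1 p2 s2 e q.1 q.2 + window c d w q.2 * dtstrip p1 s1 p2 s2 e q.1 q.2); last first.
    by apply/funext => q; rewrite dt_strip.
  move=> q; apply: cvgD; apply: cvgM.
  + by apply: cvgB; apply: cvgM; try exact: cvg_cst; apply: cont_time; exact: continuous_dsstep.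
  + by apply: cvgB; apply: cont_rise; exact: continuous_sstep.
  + by apply: cvgB; apply: cont_time; exact: continuous_sstep.
  + by apply: cvgD; apply: cvgM; try exact: cvg_cst; apply: cvgM; try exact: cvg_cst;
      apply: cont_rise; exact: continuous_dsstep.
- move=> x t; rewrite /phi; have [tcd|tcd] := boolP (c <= t <= d + w); last first.
    by rewrite window0 ?mul0r //; exact/negP.
  by apply: mulr_ge0; [exact: window_ge0 | rewrite /strip subr_ge0; apply: rise_antimono => //; exact: l12].
Qed.
End StripTest.
End Strip.

(** * Measurability, L^1 norms and summation by parts *)

Section MeasureTools.
Variable R : realType.
Local Notation mu := (@lebesgue_measure R).
Implicit Types f g h : R -> R.

Lemma measurable_affine_comp (g : R -> R) (a b c : R) : measurable_fun setT g ->
  measurable_fun setT (fun p : R * R => g (a * p.1 + b * p.2 + c)).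
Proof.
move=> mg; apply: (measurableT_comp mg).
apply: measurable_funD; last exact: measurable_cst.
by apply: measurable_funD; apply: measurable_funM; try exact: measurable_cst;
  [exact: measurable_fst | exact: measurable_snd].
Qed.

Lemma continuous_measurableT (g : R -> R) : continuous g -> measurable_fun setT g.
Proof. exact: measurable_realfun.continuous_measurable_fun. Qed.

Definition L1 f : \bar R := (\int[mu]_x `|f x|%:E)%E.

Lemma L1_ge0 f : (0 <= L1 f)%E.
Proof. by apply: integral_ge0 => x _; rewrite lee_fin. Qed.

Let mEabs f : measurable_fun setT f -> measurable_fun setT (fun x => `|f x|%:E).
Proof. by move=> mf; apply/measurable_EFinP; apply: measurableT_comp. Qed.

Lemma le_L1 f g : measurable_fun setT f -> measurable_fun setT g ->
  (forall x, `|f x| <= `|g x|) -> (L1 f <= L1 g)%E.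
Proof.
move=> mf mg fg; apply: ge0_le_integral => //; try exact: mEabs.
by move=> x _; rewrite lee_fin.
Qed.

Lemma le_L1D f g h : measurable_fun setT f -> measurable_fun setT g -> measurable_fun setT h ->
  (forall x, `|f x| <= `|g x| + `|h x|) -> (L1 f <= L1 g + L1 h)%E.
Proof.
move=> mf mg mh fgh; rewrite /L1 -ge0_integralD //; try exact: mEabs.
apply: ge0_le_integral => //; first exact: mEabs.
  by apply: emeasurable_funD; exact: mEabs.
by move=> x _; rewrite -EFinD lee_fin.
Qed.

Lemma le_L1_sum n (f : R -> R) (g : nat -> R -> R) (c : nat -> R) : measurable_fun setT f ->
  (forall i, measurable_fun setT (g i)) ->
  (forall x, `|f x| <= \sum_(i < n) `|g i x|) ->
  (forall i, (i < n)%N -> (L1 (g i) <= (c i)%:E)%E) ->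
  (L1 f <= (\sum_(i < n) c i)%:E)%E.
Proof.
move=> mf mg fg gc.
apply: (@le_trans _ _ (\int[mu]_x (\sum_(i < n) `|g i x|%:E)%E)%E).
  apply: ge0_le_integral => //; first exact: mEabs.
    by apply: emeasurable_sum => i; exact: mEabs.
  by move=> x _; rewrite sumEFin lee_fin.
rewrite ge0_integral_sum //; last by move=> i; exact: mEabs.
by rewrite -sumEFin; apply: lee_sum => i _; exact: gc.
Qed.

Lemma L1Z (k : R) f : measurable_fun setT f -> L1 (fun x => k * f x) = (`|k|%:E * L1 f)%E.
Proof.
move=> mf; rewrite /L1 -ge0_integralZl //.
  by apply: eq_integral => x _; rewrite normrM EFinM.
exact: mEabs.
Qed.

Lemma L1_indic (A : set R) : measurable A -> L1 (\1_A) = mu A.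
Proof.
move=> mA; rewrite /L1 -[in RHS](setIT A) -integral_indic //; apply: eq_integral => x _.
by rewrite ger0_norm // indicE ler0n.
Qed.

Lemma L1_indic_itv (a b : R) : a <= b -> L1 (\1_(`[a, b]%classic)) = (b - a)%:E.
Proof.
move=> ab; rewrite L1_indic // lebesgue_measure_itv /= lte_fin.
case: ifPn => // /negPf; rewrite lt_neqAle ab andbT => /negbFE/eqP ->.
by rewrite subrr.
Qed.

Definition heav (l x : R) : R := (l <= x)%R%:R.

Lemma measurable_heav l : measurable_fun setT (heav l).
Proof.
rewrite (_ : heav l = \1_(`[l, +oo[%classic)); first exact: measurable_indic.
by apply/funext => x; rewrite indicE /heav mem_setE in_itv /= andbT.
Qed.

Lemma L1_heavB (a b : R) : (L1 (fun x => (heav a x - heav b x)%R) <= `|b - a|%:E)%E.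
Proof.
wlog ab : a b / a <= b.
  move=> H; case: (leP a b) => [/H//|/ltW/H].
  move=> h; rewrite distrC; apply: (le_trans _ h).
  apply: le_L1; try by apply: measurable_funB; exact: measurable_heav.
  by move=> x; rewrite distrC.
rewrite [X in X%:E]ger0_norm ?subr_ge0 // -L1_indic_itv //; apply: le_L1.
- by apply: measurable_funB; exact: measurable_heav.
- exact: measurable_indic.
move=> x; rewrite indicE mem_setE in_itv /= /heav.
case: (lerP b x) => bx; first by rewrite (le_trans ab bx) subrr normr0.
by case: (lerP a x) => ax; rewrite /= ?subr0 ?subrr ?normr0 // (ltW bx).
Qed.

Lemma integrable_rect (f : R * R -> R) (C a b c d : R) : measurable_fun setT f ->
  (forall p, `|f p| <= C) -> (forall p, ~ (a <= p.1 <= b /\ c <= p.2 <= d) -> f p = 0) ->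
  (mu \x mu)%E.-integrable setT (EFin \o f).
Proof.
move=> mf fC f0.
pose A := (`[a, b]%classic `*` `[c, d]%classic) : set (R * R).
have mA : measurable A by apply: measurableX.
have -> : EFin \o f = (EFin \o f) \_ A.
  apply/funext => p; rewrite patchE; case: ifPn => // pA /=.
  rewrite f0 // => -[p1 p2]; move/negP: pA; apply; rewrite inE /A /=.
  by split; rewrite /= in_itv /=.
have mfA : measurable_fun A f by exact: measurable_funTS.
suff : (mu \x mu)%E.-integrable A (EFin \o f).
  move=> h; have mA' := mA; move: h; apply: (iffLR (@integrable_mkcond _ _ _ (mu \x mu)%E A _ _)). exact: mA'.
apply: measurable_bounded_integrable => //.
- rewrite [X in (X < _)%E](_ : _ = (mu `[a, b]%classic * mu `[c, d]%classic)%E).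
  by rewrite !lebesgue_measure_itv /=; do 2 case: ifP => _; rewrite ?mule0 ?mul0e // -EFinM ltry.
  exact: product_measure1E.
- exists C; split; first exact: num_real.
  by move=> M CM p _; apply: le_trans (fC p) (ltW CM).
Qed.

Lemma integral_drise (c w : R) : 0 < w -> (\int[mu]_x (drise c w x)%:E)%E = 1%:E.
Proof.
move=> w0.
have -> : (\int[mu]_x (drise c w x)%:E = \int[mu]_(x in `[c, (c + w)%R]) (drise c w x)%:E)%E.
  rewrite [RHS]integral_mkcond; apply: eq_integral => x _; rewrite patchE.
  case: ifPn => // /negP xA; have [xc|xc] := lerP x c; first by rewrite drise0.
  rewrite drise1 // leNgt; apply/negP => xw; apply: xA.
  by rewrite inE /= in_itv /= (ltW xc) ltW.
have cr : continuous (rise c w).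
  by move=> t; apply/differentiable_continuous/derivable1_diffP; case: (is_derive_rise c w t).
rewrite (@continuous_FTC2 _ (drise c w) (rise c w)).
- by rewrite rise1 // rise0 // sube0.
- by rewrite ltrDl.
- apply: continuous_subspaceT => t; apply: cvgM; first exact: cvg_cst.
  apply: (@continuous_comp _ _ _ (fun t => w^-1 * t + - (c / w)) (@dsstep R)).
    by apply: cvgD; [apply: cvgM => //; exact: cvg_cst | exact: cvg_cst].
  exact: continuous_dsstep.
- split.
  + by move=> t _; case: (is_derive_rise c w t).
  + by apply: cvg_at_right_filter; exact: cr.
  + by apply: cvg_at_left_filter; exact: cr.
- by move=> t _; rewrite derive1E; case: (is_derive_rise c w t).
Qed.

(** Passes from a sum over the regions between fronts to a sum over the fronts; [abel_fluxes] does
    the same when the two sides of a region carry different weights, as they do for moving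
    fronts. *)
Lemma abel_regions n (a r : nat -> R) :
  \sum_(i < n.+1) a i * (r i - r i.+1) =
  a 0%N * r 0%N - a n * r n.+1 + \sum_(i < n) (a i.+1 - a i) * r i.+1.
Proof.
elim: n => [|n IH]; first by rewrite big_ord_recr !big_ord0 /=; ring.
by rewrite big_ord_recr IH [in RHS]big_ord_recr /=; ring.
Qed.

End MeasureTools.

Section StripMeasurable.
Variable R : realType.
Local Notation mu := (@lebesgue_measure R).

Lemma measurable_rise_moving (p s w : R) :
  measurable_fun setT (fun q : R * R => rise (p + s * q.2) w q.1).
Proof.
rewrite (_ : (fun _ => _) =
   fun q : R * R => sstep (w^-1 * q.1 + (- (s / w)) * q.2 + - (p / w))).
  by apply: measurable_affine_comp; apply: continuous_measurableT; exact: continuous_sstep.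
by apply/funext => q; congr sstep; ring.
Qed.

Lemma measurable_drise_moving (p s w : R) :
  measurable_fun setT (fun q : R * R => drise (p + s * q.2) w q.1).
Proof.
rewrite (_ : (fun _ => _) =
   fun q : R * R => w^-1 * dsstep (w^-1 * q.1 + (- (s / w)) * q.2 + - (p / w))).
  apply: measurable_funM; first exact: measurable_cst.
  by apply: measurable_affine_comp; apply: continuous_measurableT; exact: continuous_dsstep.
by apply/funext => q; congr (_ * dsstep _); ring.
Qed.

Lemma measurable_rise_time (p w : R) : measurable_fun setT (fun q : R * R => rise p w q.2).
Proof.
rewrite (_ : (fun _ => _) =
   fun q : R * R => sstep (0 * q.1 + w^-1 * q.2 + - (p / w))).
  by apply: measurable_affine_comp; apply: continuous_measurableT; exact: continuous_sstep.
by apply/funext => q; congr sstep; ring.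
Qed.

Lemma measurable_drise_time (p w : R) : measurable_fun setT (fun q : R * R => drise p w q.2).
Proof.
rewrite (_ : (fun _ => _) =
   fun q : R * R => w^-1 * dsstep (0 * q.1 + w^-1 * q.2 + - (p / w))).
  apply: measurable_funM; first exact: measurable_cst.
  by apply: measurable_affine_comp; apply: continuous_measurableT; exact: continuous_dsstep.
by apply/funext => q; congr (_ * dsstep _); ring.
Qed.

Lemma measurable_drise (p w : R) : measurable_fun setT (drise p w).
Proof.
apply: measurable_funM; first exact: measurable_cst.
apply: (measurableT_comp (f := @dsstep R)).
  by apply: continuous_measurableT; exact: continuous_dsstep.
by apply: measurable_funD; [apply: measurable_funM|]; first [exact: measurable_cst | exact: measurable_id].
Qed.

Lemma abel_fluxes n (b c h : nat -> R) :
  \sum_(i < n.+1) (b i * h i - c i * h i.+1) =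
  b 0%N * h 0%N - c n * h n.+1 + \sum_(i < n) (b i.+1 - c i) * h i.+1.
Proof.
elim: n => [|n IH]; first by rewrite big_ord_recr !big_ord0 /=; ring.
by rewrite big_ord_recr IH [in RHS]big_ord_recr /=; ring.
Qed.

(* the jumps already crossed at a point form an initial segment of the fronts *)
Lemma crossed_fronts n (c : nat -> bool) :
  (forall i, (i.+1 < n)%N -> c i.+1 -> c i) ->
  exists2 r, (r <= n)%N & (forall i, (i < n)%N -> c i = (i < r)%N) /\
    forall f : nat -> R, f 0%N + \sum_(i < n) (f i.+1 - f i) * (c i)%:R = f r.
Proof.
elim: n => [|n IH] h; first by exists 0%N => //; split=> // f; rewrite big_ord0 addr0.
have [|r rn [rc rf]] := IH; first by move=> i lin; apply: h; exact: ltnW.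
have [cn|cn] := boolP (c n).
  have all_c i : (i <= n)%N -> c i.
    move=> lin; rewrite -(subKn lin); elim: (n - i)%N (leq_subr i n) => [|j IHj] jn; first by rewrite subn0.
    by apply: h; rewrite -subSn // subSS ?ltnS ?leq_subr // IHj // ltnW.
  exists n.+1 => //; split=> [i|f]; first by rewrite ltnS => lin; rewrite all_c ?ltnS.
  transitivity (f 0%N + \sum_(i < n.+1) (f i.+1 - f i)).
    by congr (_ + _); apply: eq_bigr => i _; rewrite all_c ?mulr1 // -ltnS.
  by rewrite -(big_mkord xpredT (fun i => f i.+1 - f i)) telescope_sumr // addrC subrK.
exists r; first exact: leqW.
split=> [i|f]; last by rewrite big_ord_recr /= (negPf cn) mulr0 addr0.
rewrite ltnS leq_eqVlt => /predU1P[->|/rc//].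
by rewrite (negPf cn) ltnNge rn.
Qed.
End StripMeasurable.

Section Fronts.
Variable R : realType.

(* piecewise constant function with value [k i] to the left of the front [l i] *)
Definition pwc (n : nat) (l k : nat -> R) (x : R) : R :=
  \sum_(i < n) (k i.+1 - k i) * heav (l i) x.

Definition total_jump (n : nat) (k : nat -> R) : R := \sum_(i < n) `|k i.+1 - k i|.

Lemma total_jump_ge0 n k : 0 <= total_jump n k.
Proof. exact: sumr_ge0. Qed.

Lemma measurable_pwc n l k : measurable_fun setT (pwc n l k).
Proof.
apply: measurable_sum => i; apply: measurable_funM; first exact: measurable_cst.
exact: measurable_heav.
Qed.

(** The crossed fronts form an initial segment, so the sum telescopes to [|v - k r|] for the region
    [r] of [x]. The distance becomes linear in the indicators of the fronts, and these can then be
    smoothed one by one. *)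
Lemma norm_pwc_region n (l k : nat -> R) (v x : R) :
  k 0%N = 0 -> (forall i, (i.+1 < n)%N -> l i <= l i.+1) ->
  `|v - pwc n l k x| = `|v| + \sum_(i < n) (`|v - k i.+1| - `|v - k i|) * heav (l i) x.
Proof.
move=> k0 sl.
have [|r _ [_ rf]] := @crossed_fronts R n (fun i => l i <= x).
  by move=> i lin; apply: le_trans; exact: sl.
have -> : pwc n l k x = k r by rewrite -[RHS]rf k0 add0r.
by have /= := rf (fun i => `|v - k i|); rewrite k0 subr0 => <-.
Qed.

Lemma L1_pwc_shift n (l l' k : nat -> R) :
  (L1 (fun x => (pwc n l' k x - pwc n l k x)%R) <=
   (\sum_(i < n) `|k i.+1 - k i| * `|l' i - l i|)%:E)%E.
Proof.
apply: (@le_L1_sum _ n _ (fun i x => (k i.+1 - k i) * (heav (l' i) x - heav (l i) x))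
   (fun i => `|k i.+1 - k i| * `|l' i - l i|)).
- by apply: measurable_funB; exact: measurable_pwc.
- move=> i; apply: measurable_funM; first exact: measurable_cst.
  by apply: measurable_funB; exact: measurable_heav.
- move=> x; rewrite /pwc -sumrB; apply: le_trans (ler_norm_sum _ _ _) _.
  by apply: ler_sum => i _; rewrite mulrBr.
- move=> i _; rewrite L1Z.
    rewrite EFinM; apply: lee_wpmul2l; first by rewrite lee_fin.
    by rewrite distrC; exact: L1_heavB.
  by apply: measurable_funB; exact: measurable_heav.
Qed.
End Fronts.

(** * Kruzhkov's inequality along moving fronts *)

Section SmoothedDistance.
Variable R : realType.
Local Notation mu := (@lebesgue_measure R).
Variables (u : R -> R -> R) (n : nat) (p s k : nat -> R).

Definition line i t : R := p i + s i * t.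

(* |u - w| with the jumps of w smoothed out over the width w to the right of each front *)
Definition sdist (w x t : R) : R :=
  `|u x t| + \sum_(i < n) (`|u x t - k i.+1| - `|u x t - k i|) * rise (line i t) w x.

Definition wav t x : R := pwc n (line^~ t) k x.

Lemma rise_heav (l w x : R) : 0 < w -> `|rise l w x - heav l x| <= \1_(`[l, l + w]%classic) x.
Proof.
move=> w0; rewrite indicE mem_setE in_itv /= /heav.
have [xl|lx] := ltrP x l; first by rewrite rise0 ?subrr ?normr0 // ltW.
have [xw|xw] := lerP x (l + w); last by rewrite rise1 ?subrr ?normr0 // ltW.
by rewrite /= ler_norml; have := rise_ge0 l w x; have := rise_le1 l w x; lra.
Qed.

Lemma sdist_near (w x t : R) : 0 < w -> k 0%N = 0 ->
  (forall i, (i.+1 < n)%N -> line i t <= line i.+1 t) ->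
  `|sdist w x t - `|u x t - wav t x| | <=
  \sum_(i < n) `|k i.+1 - k i| * \1_(`[line i t, line i t + w]%classic) x.
Proof.
move=> w0 k0 sl; rewrite /wav norm_pwc_region // /sdist opprD addrACA subrr add0r -sumrB.
apply: le_trans (ler_norm_sum _ _ _) _; apply: ler_sum => i _.
rewrite -mulrBr normrM; apply: ler_pM => //; last exact: rise_heav.
apply: le_trans (ler_dist_dist _ _) _.
by rewrite (_ : _ - _ = k i - k i.+1) 1?distrC //; ring.
Qed.

Hypothesis mu_ : measurable_fun setT (fun q : R * R => u q.1 q.2).

Lemma measurable_slice t : measurable_fun setT (fun x => u x t).
Proof. exact: (measurableT_comp mu_ (pair2_measurable t)). Qed.

Lemma measurable_wav t : measurable_fun setT (wav t).
Proof. exact: measurable_pwc. Qed.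

Lemma measurable_sdist w : measurable_fun setT (fun q : R * R => sdist w q.1 q.2).
Proof.
have mk c : measurable_fun setT (fun q : R * R => `|u q.1 q.2 - c|).
  apply: (measurableT_comp (@normr_measurable R setT)).
  by apply: measurable_funB => //; exact: measurable_cst.
apply: measurable_funD.
  exact: (measurableT_comp (@normr_measurable R setT)).
apply: measurable_sum => i; apply: measurable_funM; last exact: measurable_rise_moving.
exact: measurable_funB.
Qed.

Lemma measurable_sdist_slice w t : measurable_fun setT (fun x => sdist w x t).
Proof. exact: (measurableT_comp (measurable_sdist w) (pair2_measurable t)). Qed.

(** By parts, [sdist] is a sum of the [|u - k r|] with weights that are differences of consecutive
    steps. The weights are nonnegative because the fronts are sorted and the smoothing width is the
    same for all. *)
Lemma sdist_ge0 (w x t : R) : 0 < w -> k 0%N = 0 ->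
  (forall i, (i.+1 < n)%N -> line i t <= line i.+1 t) -> k n = 0 -> 0 <= sdist w x t.
Proof.
move=> w0 k0 sl kn.
have -> : sdist w x t = \sum_(r < n.+1) `|u x t - k r| *
   ((if r == 0%N :> nat then 1 else rise (line r.-1 t) w x) -
    (if r == n :> nat then 0 else rise (line r t) w x)).
  pose ro r := if r == 0%N then 1 else if r == n.+1 then 0 else rise (line r.-1 t) w x.
  transitivity (\sum_(r < n.+1) `|u x t - k r| * (ro r - ro r.+1)); last first.
    apply: eq_bigr => r _; rewrite /ro /= eqSS; congr (_ * (_ - _)).
    by case: eqP => // _; case: eqP => // rn; have := ltn_ord r; rewrite rn ltnn.
  rewrite (abel_regions n (fun r => `|u x t - k r|) ro) {1}/ro /= {1}/ro /= eqxx k0 subr0 mulr1 mulr0 subr0.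
  congr (_ + _); apply: eq_bigr => i _; congr (_ * _).
  by rewrite /ro /= eqSS (ltn_eqF (ltn_ord i)).
apply: sumr_ge0 => r _; apply: mulr_ge0 => //; rewrite subr_ge0.
case: ifPn => rn; case: ifPn => r0 //; rewrite ?rise_le1 ?rise_ge0 //.
apply: rise_antimono => //.
have := @sl r.-1; rewrite prednK ?lt0n //; apply.
by rewrite ltn_neqAle rn -ltnS ltn_ord.
Qed.

Lemma L1_jump_layers w t : 0 < w ->
  (L1 (fun x => (\sum_(i < n) `|k i.+1 - k i| * \1_(`[line i t, line i t + w]%classic) x)%R)
    <= (w * total_jump n k)%:E)%E.
Proof.
move=> w0; rewrite /total_jump mulr_sumr.
apply: (@le_L1_sum _ n _ (fun i x => `|k i.+1 - k i| * \1_(`[line i t, (line i t + w)%R]%classic) x)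
   (fun i => w * `|k i.+1 - k i|)).
- apply: measurable_sum => i; apply: measurable_funM; first exact: measurable_cst.
  exact: measurable_indic.
- move=> i; apply: measurable_funM; first exact: measurable_cst.
  exact: measurable_indic.
- by move=> x; exact: ler_norm_sum.
- move=> i _; rewrite L1Z; last exact: measurable_indic.
  by rewrite normr_id L1_indic_itv ?lerDl ?(ltW w0) // (_ : line i t + w - line i t = w) -?EFinM 1?mulrC //; ring.
Qed.

(** A Lipschitz constant of [wav] in time for the L^1 norm, see [L1_wav_shift]. *)
Definition speed_jump := \sum_(i < n) `|k i.+1 - k i| * `|s i|.

Lemma speed_jump_ge0 : 0 <= speed_jump.
Proof. by apply: sumr_ge0 => i _; rewrite mulr_ge0. Qed.

Lemma L1_wav_shift a t : (L1 (fun x => (wav t x - wav a x)%R) <= (speed_jump * `|t - a|)%:E)%E.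
Proof.
apply: le_trans (L1_pwc_shift _ _ _ _) _; rewrite lee_fin /speed_jump mulr_suml.
by apply: ler_sum => i _; rewrite /line opprD addrACA subrr add0r -mulrBr normrM mulrA.
Qed.

(** Three errors separate the smoothed distance at time [t] from the true one at time [a]: the
    change of [u], the motion of the fronts, and the smoothing layers. [L1_le_sdist] is the converse
    comparison, for the other end of the time slab. *)
Lemma L1_sdist_le w a t : 0 < w -> k 0%N = 0 -> k n = 0 ->
  (forall i, (i.+1 < n)%N -> line i t <= line i.+1 t) ->
  (L1 (fun x => sdist w x t) <= L1 (fun x => (u x a - wav a x)%R) +
     (L1 (fun x => (u x t - u x a)%R) + (speed_jump * `|t - a| + w * total_jump n k)%:E))%E.
Proof.
move=> w0 k0 kn sl.
have mua := measurable_slice a; have mut := measurable_slice t.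
have mwa := measurable_wav a; have mwt := measurable_wav t.
have mb : measurable_fun setT (fun x => \sum_(i < n) `|k i.+1 - k i| * \1_(`[line i t, line i t + w]%classic) x : R).
  apply: measurable_sum => i; apply: measurable_funM; first exact: measurable_cst.
  exact: measurable_indic.
apply: le_trans (le_L1D (f := fun x => sdist w x t)
  (g := fun x => u x a - wav a x) (h := fun x => `|u x t - u x a| + (`|wav t x - wav a x| +
     \sum_(i < n) `|k i.+1 - k i| * \1_(`[line i t, line i t + w]%classic) x)) _ _ _ _) _.
- exact: measurable_sdist_slice.
- exact: measurable_funB.
- apply: measurable_funD; first by apply: measurableT_comp => //; exact: measurable_funB.
  by apply: measurable_funD => //; apply: measurableT_comp => //; exact: measurable_funB.
- move=> x; have := sdist_near x w0 k0 sl.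
  rewrite (ger0_norm (sdist_ge0 x w0 k0 sl kn)).
  have bn : 0 <= \sum_(i < n) `|k i.+1 - k i| * \1_(`[line i t, line i t + w]%classic) x.
    by apply: sumr_ge0 => i _; rewrite mulr_ge0 // indicE.
  move: bn; set B := \sum_(i < n) _ => bn.
  rewrite (ger0_norm (x := _ + (_ + B))) ?addr_ge0 // ler_norml => /andP[_ h].
  have : `|u x t - wav t x| <= `|u x a - wav a x| + `|u x t - u x a| + `|wav t x - wav a x|.
    rewrite (_ : u x t - wav t x = (u x a - wav a x) + (u x t - u x a) - (wav t x - wav a x)); last by ring.
    by apply: le_trans (ler_normB _ _) _; rewrite lerD2r; exact: ler_normD.
  by lra.
rewrite leeD2l // ; apply: le_trans (le_L1D (g := fun x => u x t - u x a)
   (h := fun x => (`|wav t x - wav a x| +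
     \sum_(i < n) `|k i.+1 - k i| * \1_(`[line i t, line i t + w]%classic) x)) _ _ _ _) _.
- apply: measurable_funD; first by apply: measurableT_comp => //; exact: measurable_funB.
  by apply: measurable_funD => //; apply: measurableT_comp => //; exact: measurable_funB.
- exact: measurable_funB.
- by apply: measurable_funD => //; apply: measurableT_comp => //; exact: measurable_funB.
- by move=> x; apply: le_trans (ler_normD _ _) _; rewrite normr_id.
rewrite leeD2l //; apply: le_trans (le_L1D (g := fun x => wav t x - wav a x)
   (h := fun x => \sum_(i < n) `|k i.+1 - k i| * \1_(`[line i t, line i t + w]%classic) x) _ _ _ _) _ => //.
- by apply: measurable_funD => //; apply: measurableT_comp => //; exact: measurable_funB.
- exact: measurable_funB.
- by move=> x; apply: le_trans (ler_normD _ _) _; rewrite normr_id.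
rewrite EFinD; apply: leeD; first exact: L1_wav_shift.
exact: L1_jump_layers.
Qed.

Lemma L1_le_sdist w b t : 0 < w -> k 0%N = 0 -> k n = 0 ->
  (forall i, (i.+1 < n)%N -> line i t <= line i.+1 t) ->
  (L1 (fun x => (u x b - wav b x)%R) <= L1 (fun x => sdist w x t) +
     (L1 (fun x => (u x t - u x b)%R) + (speed_jump * `|t - b| + w * total_jump n k)%:E))%E.
Proof.
move=> w0 k0 kn sl.
have mub := measurable_slice b; have mut := measurable_slice t.
have mwb := measurable_wav b; have mwt := measurable_wav t.
have mb : measurable_fun setT (fun x => \sum_(i < n) `|k i.+1 - k i| * \1_(`[line i t, line i t + w]%classic) x : R).
  apply: measurable_sum => i; apply: measurable_funM; first exact: measurable_cst.
  exact: measurable_indic.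
apply: le_trans (le_L1D (g := fun x => sdist w x t)
  (h := fun x => `|u x t - u x b| + (`|wav t x - wav b x| +
     \sum_(i < n) `|k i.+1 - k i| * \1_(`[line i t, line i t + w]%classic) x)) _ _ _ _) _.
- exact: measurable_funB.
- exact: measurable_sdist_slice.
- apply: measurable_funD; first by apply: measurableT_comp => //; exact: measurable_funB.
  by apply: measurable_funD => //; apply: measurableT_comp => //; exact: measurable_funB.
- move=> x; have := sdist_near x w0 k0 sl.
  rewrite (ger0_norm (sdist_ge0 x w0 k0 sl kn)).
  have bn : 0 <= \sum_(i < n) `|k i.+1 - k i| * \1_(`[line i t, line i t + w]%classic) x.
    by apply: sumr_ge0 => i _; rewrite mulr_ge0 // indicE.
  move: bn; set B := \sum_(i < n) _ => bn.
  rewrite (ger0_norm (x := _ + (_ + B))) ?addr_ge0 // ler_norml => /andP[h _].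
  have : `|u x b - wav b x| <= `|u x t - wav t x| + `|u x t - u x b| + `|wav t x - wav b x|.
    rewrite (_ : u x b - wav b x = (u x t - wav t x) - (u x t - u x b) + (wav t x - wav b x)); last by ring.
    by apply: le_trans (ler_normD _ _) _; rewrite lerD2r; exact: ler_normB.
  by lra.
rewrite leeD2l // ; apply: le_trans (le_L1D (g := fun x => u x t - u x b)
   (h := fun x => (`|wav t x - wav b x| +
     \sum_(i < n) `|k i.+1 - k i| * \1_(`[line i t, line i t + w]%classic) x)) _ _ _ _) _.
- apply: measurable_funD; first by apply: measurableT_comp => //; exact: measurable_funB.
  by apply: measurable_funD => //; apply: measurableT_comp => //; exact: measurable_funB.
- exact: measurable_funB.
- by apply: measurable_funD => //; apply: measurableT_comp => //; exact: measurable_funB.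
- by move=> x; apply: le_trans (ler_normD _ _) _; rewrite normr_id.
rewrite leeD2l //; apply: le_trans (le_L1D (g := fun x => wav t x - wav b x)
   (h := fun x => \sum_(i < n) `|k i.+1 - k i| * \1_(`[line i t, line i t + w]%classic) x) _ _ _ _) _ => //.
- by apply: measurable_funD => //; apply: measurableT_comp => //; exact: measurable_funB.
- exact: measurable_funB.
- by move=> x; apply: le_trans (ler_normD _ _) _; rewrite normr_id.
rewrite EFinD; apply: leeD; first exact: L1_wav_shift.
exact: L1_jump_layers.
Qed.

End SmoothedDistance.

Section Regions.
Variable R : realType.
Variables (n : nat) (p s : nat -> R) (rad : R).

(* the fronts, completed by two far away stationary lines *)
Definition lp r := if r == 0%N then - rad else if r == n.+1 then rad else p r.-1.
Definition ls r := if r == 0%N then 0 else if r == n.+1 then 0 else s r.-1.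

Lemma lp_front i : (i < n)%N -> lp i.+1 = p i.
Proof. by move=> lin; rewrite /lp /= eqSS ltn_eqF. Qed.
Lemma ls_front i : (i < n)%N -> ls i.+1 = s i.
Proof. by move=> lin; rewrite /ls /= eqSS ltn_eqF. Qed.

Lemma regions_ordered t : (forall i, (i < n)%N -> `|line p s i t| <= rad) -> 0 <= rad ->
  (forall i, (i.+1 < n)%N -> line p s i t <= line p s i.+1 t) ->
  forall r, (r < n.+1)%N -> lp r + ls r * t <= lp r.+1 + ls r.+1 * t.
Proof.
move=> lb rad0 sl [|r] rn.
  rewrite /lp /ls /= eqSS; case: ifPn => [_|n0]; first by rewrite !mul0r; lra.
  have := lb 0%N; rewrite lt0n eq_sym n0 => /(_ isT).
  by rewrite /line ler_norml => /andP[? _]; rewrite mul0r; lra.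
rewrite lp_front // ls_front // /lp /ls /= eqSS; case: ifPn => [_|n0].
  by have := lb r rn; rewrite /line ler_norml => /andP[_ ?]; rewrite mul0r; lra.
by apply: sl; rewrite ltn_neqAle n0.
Qed.
End Regions.

Section EntropySum.
Variable R : realType.
Variables (F : R -> R) (u : R -> R -> R) (n : nat) (p s k : nat -> R) (rad : R).
Let P := lp n p rad.
Let S := ls n s.

(* the integrand of Kruzhkov's inequality for the region between two lines *)
Definition region_term c d w r (q : R * R) : R :=
  `|u q.1 q.2 - k r| * (dwindow c d w q.2 * strip (P r) (S r) (P r.+1) (S r.+1) w q.1 q.2
     + window c d w q.2 * dtstrip (P r) (S r) (P r.+1) (S r.+1) w q.1 q.2)
  + kflux F (k r) (u q.1 q.2) *
     (window c d w q.2 * dxstrip (P r) (S r) (P r.+1) (S r.+1) w q.1 q.2).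

(* Summation by parts: the strips add up to |u - w| and the entropy production at the fronts. *)
Lemma sum_region_term c d w x t : 0 < w -> k 0%N = 0 -> k n = 0 -> 1 + w <= rad ->
  (x <= 0 \/ 1 <= x -> u x t = 0) ->
  \sum_(r < n.+1) region_term c d w r (x, t) =
    dwindow c d w t * sdist u n p s k w x t +
    window c d w t * \sum_(i < n) (kflux F (k i.+1) (u x t) - kflux F (k i) (u x t) -
      s i * (`|u x t - k i.+1| - `|u x t - k i|)) * drise (line p s i t) w x.
Proof.
move=> w0 k0 kn rw u0.
pose A r := `|u x t - k r|; pose Q r := kflux F (k r) (u x t).
pose ro r := rise (P r + S r * t) w x; pose h r := drise (P r + S r * t) w x.
transitivity (dwindow c d w t * (\sum_(r < n.+1) A r * (ro r - ro r.+1)) + window c d w t *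
   \sum_(r < n.+1) ((Q r - S r * A r) * h r - (Q r - S r.+1 * A r) * h r.+1)).
  rewrite !mulr_sumr -big_split /=; apply: eq_bigr => r _.
  rewrite /region_term /strip /dtstrip /dxstrip /= -/(A r) -/(Q r).
  by rewrite -/(ro r) -/(ro r.+1) -/(h r) -/(h r.+1); ring.
rewrite (abel_regions n A ro) (abel_fluxes n (fun r => Q r - S r * A r) (fun r => Q r - S r.+1 * A r) h).
have P0 : P 0%N + S 0%N * t = - rad by rewrite /P /S /lp /ls /= mul0r addr0.
have Pn : P n.+1 + S n.+1 * t = rad by rewrite /P /S /lp /ls /= eqxx mul0r addr0.
have S0 : S 0%N = 0 by [].
have Sn : S n.+1 = 0 by rewrite /S /ls /= eqxx.
(* For [0 < x < 1] the outermost steps take the values 1 and 0, as [rad] exceeds [1 + w]. Elsewhere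
   [u] vanishes, and so do the boundary terms, because the first and last values of the profile are
   0. *)
have E1 : A 0%N * ro 0%N - A n * ro n.+1 = `|u x t|.
  rewrite /ro P0 Pn /A k0 kn !subr0.
  have [x0|x0] := lerP x 0; first by rewrite u0 ?normr0; [ring | left].
  have [x1|x1] := lerP 1 x; first by rewrite u0 ?normr0; [ring | right].
  rewrite rise1 ?rise0 //; [ring | lra | lra].
have E2 : (Q 0%N - S 0%N * A 0%N) * h 0%N - (Q n - S n.+1 * A n) * h n.+1 = 0.
  rewrite /h P0 Pn S0 Sn /Q k0 kn.
  have kf0 : kflux F 0 0 = 0 by rewrite /kflux (subrr (F 0)) mulr0.
  have [x0|x0] := lerP x 0; first by rewrite u0 ?kf0; [ring | left].
  have [x1|x1] := lerP 1 x; first by rewrite u0 ?kf0; [ring | right].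
  rewrite drise1 ?drise0 //; [ring | lra | lra].
rewrite E1 E2 add0r /sdist; congr (_ * (_ + _) + _ * _); apply: eq_bigr => i _;
  rewrite /ro /h /P /S lp_front // ls_front //.
by rewrite -/(line p s i t) /Q /A; congr (_ * _); ring.
Qed.
End EntropySum.

Section SlabFacts.
Variable R : realType.
Local Notation mu := (@lebesgue_measure R).
Variables (T M MF : R) (F : R -> R) (u : R -> R -> R).
Hypothesis mu_ : measurable_fun setT (fun q : R * R => u q.1 q.2).
Hypothesis cF : continuous F.
Hypothesis uM : forall x t, 0 <= t < T -> `|u x t| <= M.
Hypothesis FM : forall v, `|v| <= M -> `|F v| <= MF.
Hypothesis u0 : forall x t, 0 <= t < T -> (x <= 0 \/ 1 <= x) -> u x t = 0.
Variables (n : nat) (p s k : nat -> R) (rad : R).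
Hypotheses (k0 : k 0%N = 0) (kn : k n = 0).

Lemma bound_ge0 : 0 < T -> 0 <= M.
Proof. by move=> T0; apply: le_trans (@uM 0 0 _); rewrite ?lexx. Qed.

Lemma bound_flux_ge0 : 0 < T -> 0 <= MF.
Proof. by move=> T0; apply: le_trans (@FM 0 _); rewrite ?normr0 // bound_ge0. Qed.

Lemma measurable_kflux r : measurable_fun setT (fun q : R * R => kflux F (k r) (u q.1 q.2)).
Proof.
have -> : (fun q : R * R => kflux F (k r) (u q.1 q.2)) =
  (kflux F (k r)) \o (fun q : R * R => u q.1 q.2) by [].
apply: measurableT_comp mu_.
apply: measurable_funM.
  have -> : (fun x : R => Num.sg (x - k r)) =
     (fun x => heav (k r) x - heav (- k r) (- x)).
    apply/funext => x; rewrite /heav lerN2; case: (ltrgtP x (k r)) => h.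
    - by rewrite ltr0_sg ?subr_lt0 // sub0r.
    - by rewrite gtr0_sg ?subr_gt0 // subr0.
    - by rewrite h !subrr sgr0.
  apply: measurable_funB; first exact: measurable_heav.
  apply: (measurableT_comp (measurable_heav _)); exact: oppr_measurable.
apply: measurable_funB; last exact: measurable_cst.
exact: continuous_measurableT.
Qed.

Lemma norm_kflux r v : `|v| <= M -> `|kflux F (k r) v| <= MF + `|F (k r)|.
Proof.
move=> vM; rewrite /kflux normrM.
apply: le_trans (_ : 1 * (`|F v| + `|F (k r)|) <= _).
  apply: ler_pM => //; last exact: ler_normB.
  by rewrite normr_sg; case: (_ != _).
by rewrite mul1r lerD2r FM.
Qed.

Lemma L1_dist_fin t : 0 <= t < T -> (L1 (fun x => (u x t - wav n p s k t x)%R) < +oo)%E.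
Proof.
move=> t0T.
have mut := measurable_slice mu_ t.
(* With all its fronts moved to 0 the profile vanishes, because its jumps add up to [k n - k 0 = 0];
   moving them back costs a finite amount. *)
apply: (@le_lt_trans _ _ (L1 (fun x => (M * \1_(`[0%R, 1%R]%classic) x)%R) +
   L1 (fun x => (wav n p s k t x - pwc n (fun=> 0%R) k x)%R))%E).
  apply: le_L1D.
  - by apply: measurable_funB => //; exact: measurable_pwc.
  - by apply: measurable_funM; [exact: measurable_cst | exact: measurable_indic].
  - by apply: measurable_funB; exact: measurable_pwc.
  move=> x.
  have -> : pwc n (fun=> 0) k x = 0.
    rewrite /pwc -mulr_suml -(big_mkord xpredT (fun i => k i.+1 - k i)) telescope_sumr //.
    by rewrite k0 kn subrr mul0r.
  rewrite subr0; apply: le_trans (ler_normB _ _) _; rewrite lerD2r.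
  rewrite indicE mem_setE in_itv /=.
  have M0 : 0 <= M by apply: le_trans (uM x t0T).
  have [x0|x0] := lerP 0 x; last by rewrite u0 ?normr0 ?mulr0 ?normr0 //; left; exact: ltW.
  have [x1|x1] := lerP x 1; last by rewrite u0 ?normr0 ?mulr0 ?normr0 //; right; exact: ltW.
  by rewrite mulr1 (ger0_norm M0) uM.
rewrite L1Z; last exact: measurable_indic.
rewrite L1_indic_itv ?ler01 // -EFinM.
apply: (le_lt_trans (leeD2l _ (L1_pwc_shift n (fun=> 0) (line p s ^~ t) k))).
by rewrite -EFinD ltry.
Qed.

End SlabFacts.

Section StripBounds.
Variable R : realType.
Implicit Types (c d w t x : R).

Lemma norm_drise c w t : 0 < w -> `|drise c w t| <= 2 / w.
Proof. by move=> w0; rewrite ger0_norm ?drise_ge0 // drise_le. Qed.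

Lemma norm_drise_sub c d w t d' : 0 < w -> `|drise c w t - drise d w d'| <= 2 / w.
Proof.
move=> w0; rewrite ler_norml; have := drise_ge0 c t w0; have := drise_ge0 d d' w0.
by have := drise_le c t w0; have := drise_le d d' w0; lra.
Qed.

Lemma norm_rise_sub c d w t : `|rise c w t - rise d w t| <= 1.
Proof.
rewrite ler_norml; have := rise_ge0 c w t; have := rise_ge0 d w t.
by have := rise_le1 c w t; have := rise_le1 d w t; lra.
Qed.

Lemma norm_dtstrip p1 s1 p2 s2 w x t : 0 < w ->
  `|dtstrip p1 s1 p2 s2 w x t| <= (`|s1| + `|s2|) * (2 / w).
Proof.
move=> w0; rewrite mulrDl; apply: le_trans (ler_normD _ _) _.
by apply: lerD; rewrite normrM ?normrN; apply: ler_wpM2l => //; exact: norm_drise.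
Qed.

Lemma strip_vanish p1 s1 p2 s2 w x t rad : 0 < w ->
  - rad <= p1 + s1 * t -> p1 + s1 * t <= p2 + s2 * t -> p2 + s2 * t <= rad ->
  ~ (- rad <= x <= rad + w) ->
  [/\ strip p1 s1 p2 s2 w x t = 0, dxstrip p1 s1 p2 s2 w x t = 0 & dtstrip p1 s1 p2 s2 w x t = 0].
Proof.
move=> w0 l1 l2 l3 /negP; rewrite negb_and -!ltNge => /orP[x1|x1]; split.
- by rewrite /strip !rise0 ?subrr //; lra.
- by rewrite /dxstrip !drise0 ?subrr //; lra.
- by rewrite /dtstrip !drise0 ?mulr0 ?addr0 //; lra.
- by rewrite /strip !rise1 ?subrr //; lra.
- by rewrite /dxstrip !drise1 ?subrr //; lra.
- by rewrite /dtstrip !drise1 ?mulr0 ?addr0 //; lra.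
Qed.
End StripBounds.

Section SlabIntegrability.
Variable R : realType.
Local Notation mu := (@lebesgue_measure R).
Variables (T M MF : R) (F : R -> R) (u : R -> R -> R).
Hypothesis mu_ : measurable_fun setT (fun q : R * R => u q.1 q.2).
Hypothesis cF : continuous F.
Hypothesis uM : forall x t, 0 <= t < T -> `|u x t| <= M.
Hypothesis FM : forall v, `|v| <= M -> `|F v| <= MF.
Hypothesis u0 : forall x t, 0 <= t < T -> (x <= 0 \/ 1 <= x) -> u x t = 0.
Hypothesis kruzhkov : forall (l : R) (phi : R -> R -> R), test_fun T phi ->
   (0 <= \int[mu \x mu]_(q in setT)
      ((`|u q.1 q.2 - l| * dt phi q.1 q.2
        + Num.sg (u q.1 q.2 - l) * (F (u q.1 q.2) - F l) * dx phi q.1 q.2)%:E))%E.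
Variables (n : nat) (p s k : nat -> R) (rad a b c d w : R).
Hypotheses (k0 : k 0%N = 0) (kn : k n = 0) (w0 : 0 < w) (rw : 1 + w <= rad).
Hypotheses (a0 : 0 <= a) (ac : a < c) (cd : c <= d) (db : d + w <= b) (bT : b < T).
Hypothesis sorted_lines : forall t i, a <= t <= b -> (i.+1 < n)%N -> line p s i t <= line p s i.+1 t.
Hypothesis bounded_lines : forall t i, a <= t <= b -> (i < n)%N -> `|line p s i t| <= rad.

Local Notation P := (lp n p rad).
Local Notation S := (ls n s).

Lemma regions_in r t : (r < n.+1)%N -> a <= t <= b ->
  [/\ - rad <= P r + S r * t, P r + S r * t <= P r.+1 + S r.+1 * t & P r.+1 + S r.+1 * t <= rad].
Proof.
move=> rn tab.
have rad0 : 0 <= rad by move: rw w0; lra.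
have H := regions_ordered (fun i => @bounded_lines t i tab) rad0 (fun i => @sorted_lines t i tab).
have radN : - rad <= rad by lra.
split; last 2 first.
- exact: H.
- rewrite /lp /ls /= eqSS; case: ifPn => rn'; first by rewrite mul0r addr0.
  have := @bounded_lines t r tab; rewrite ltn_neqAle rn' -ltnS => /(_ rn).
  by rewrite /line ler_norml => /andP[].
case: r rn => [|r] rn; first by rewrite /lp /ls /= mul0r addr0.
rewrite lp_front // ls_front //.
by have := @bounded_lines t r tab rn; rewrite /line ler_norml => /andP[].
Qed.

Lemma time_window t : c <= t <= d + w -> a <= t <= b /\ 0 <= t < T.
Proof. by move: a0 ac cd db bT => ? ? ? ? ? /andP[? ?]; split; apply/andP; split; lra. Qed.

Lemma norm_region_term r q : c <= q.2 <= d + w ->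
  `|region_term F u n p s k rad c d w r q| <=
  (M + `|k r|) * (2 / w + (`|S r| + `|S r.+1|) * (2 / w)) + (MF + `|F (k r)|) * (2 / w).
Proof.
move=> tcd; have [tab tT] := time_window tcd.
have win1 : `|window c d w q.2| <= 1 by rewrite /window norm_rise_sub.
apply: le_trans (ler_normD _ _) _; apply: lerD; rewrite normrM.
- apply: ler_pM => //.
    by rewrite normr_id; apply: le_trans (ler_normB _ _) _; rewrite lerD2r; exact: uM.
  apply: le_trans (ler_normD _ _) _; apply: lerD; rewrite normrM.
    by rewrite -[leRHS]mulr1; apply: ler_pM => //; [exact: norm_drise_sub | exact: norm_rise_sub].
  by rewrite -[leRHS]mul1r; apply: ler_pM => //; exact: norm_dtstrip.
apply: ler_pM => //; first by apply: (norm_kflux FM); exact: uM.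
by rewrite normrM -[leRHS]mul1r; apply: ler_pM => //; exact: norm_drise_sub.
Qed.

Lemma region_term_outside r q : (r < n.+1)%N ->
  ~ (- rad <= q.1 <= rad + w /\ c <= q.2 <= d + w) -> region_term F u n p s k rad c d w r q = 0.
Proof.
move=> rn out; have [tcd|tcd] := boolP (c <= q.2 <= d + w); last first.
  by rewrite /region_term window0 ?dwindow0 //; [ring | exact/negP | exact/negP].
have [tab tT] := time_window tcd.
have [l1 l2 l3] := regions_in rn tab.
have [|e1 e2 e3] := strip_vanish (x := q.1) w0 l1 l2 l3; first by move=> h; apply: out.
by rewrite /region_term e1 e2 e3; ring.
Qed.

Lemma measurable_region_term r :
  measurable_fun setT (region_term F u n p s k rad c d w r).
Proof.
have mwin : measurable_fun setT (fun q : R * R => window c d w q.2).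
  by apply: measurable_funB; exact: measurable_rise_time.
apply: measurable_funD; apply: measurable_funM.
- apply: measurableT_comp => //; apply: measurable_funB => //; exact: measurable_cst.
- apply: measurable_funD; apply: measurable_funM => //.
  + by apply: measurable_funB; exact: measurable_drise_time.
  + by apply: measurable_funB; exact: measurable_rise_moving.
  + by apply: measurable_funD; apply: measurable_funM; try exact: measurable_cst; exact: measurable_drise_moving.
- exact: measurable_kflux.
- apply: measurable_funM => //.
  by apply: measurable_funB; exact: measurable_drise_moving.
Qed.

Lemma integrable_region_term r : (r < n.+1)%N ->
  (mu \x mu)%E.-integrable setT (EFin \o region_term F u n p s k rad c d w r).
Proof.
move=> rn; apply: integrable_rect.
- exact: measurable_region_term.
- move=> q; have [tcd|tcd] := boolP (c <= q.2 <= d + w); first exact: (norm_region_term r tcd).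
  rewrite region_term_outside // ?normr0; last by move=> [_ h]; move/negP: tcd; apply.
  have T0 : 0 < T by move: a0 ac cd db bT w0; lra.
  have := bound_ge0 uM T0; have := bound_flux_ge0 uM FM T0 => ? ?.
  have w2 : 0 <= 2 / w by rewrite divr_ge0 // ltW.
  by rewrite addr_ge0 // mulr_ge0 // addr_ge0 // mulr_ge0 // addr_ge0.
- by move=> q; exact: region_term_outside.
Qed.

(** Kruzhkov's inequality with the constant [k r], which is the value of the profile in region [r],
    so that [|u - k r|] is the distance to the profile there. *)
Lemma integral_region_term_ge0 r : (r < n.+1)%N ->
  (0 <= \int[mu \x mu]_q (region_term F u n p s k rad c d w r q)%:E)%E.
Proof.
move=> rn.
have tf : test_fun T (fun x t => window c d w t * strip (P r) (S r) (P r.+1) (S r.+1) w x t).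
  apply: test_fun_strip => //; first by move: a0 ac; lra.
    by move: db bT; lra.
  by move=> t tcd; have [tab _] := time_window tcd; have [] := regions_in rn tab.
have := kruzhkov (k r) tf; congr (_ <= _)%E; apply: eq_integral => q _.
by rewrite dt_strip dx_strip.
Qed.

Lemma integral_sum_region_term_ge0 :
  (0 <= \int[mu \x mu]_q (\sum_(r < n.+1) region_term F u n p s k rad c d w r q)%:E)%E.
Proof.
have -> : (\int[mu \x mu]_q (\sum_(r < n.+1) region_term F u n p s k rad c d w r q)%:E =
   \sum_(r < n.+1) \int[mu \x mu]_q (region_term F u n p s k rad c d w r q)%:E)%E.
  rewrite -integral_sum //; last by move=> r; exact: integrable_region_term.
  by apply: eq_integral => q _; rewrite sumEFin.
by apply: sume_ge0 => r _; exact: integral_region_term_ge0.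
Qed.

Lemma integrable_sum_region_term :
  (mu \x mu)%E.-integrable setT (fun q => (\sum_(r < n.+1) region_term F u n p s k rad c d w r q)%:E).
Proof.
have -> : (fun q => (\sum_(r < n.+1) region_term F u n p s k rad c d w r q)%:E) =
  (fun q => \sum_(r < n.+1) (EFin \o region_term F u n p s k rad c d w r) q)%E.
  by apply/funext => q; rewrite sumEFin.
by apply: integrable_sum => // r _; exact: integrable_region_term.
Qed.

Lemma sdist_vanish q : a <= q.2 <= b -> ~ (- rad <= q.1 <= rad + w) -> sdist u n p s k w q.1 q.2 = 0.
Proof.
move=> tab qx; have tT : 0 <= q.2 < T by move: a0 bT tab => ? ? /andP[? ?]; apply/andP; split; lra.
have rad1 : 1 < rad by move: rw w0; lra.
have [qr|qr] := ltrP q.1 (- rad).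
  rewrite /sdist u0 //; last by left; lra.
  rewrite normr0 add0r big1 // => i _; rewrite rise0 ?mulr0 //.
  by have := bounded_lines tab (ltn_ord i); rewrite ler_norml => /andP[? _]; lra.
have qr' : rad + w < q.1 by rewrite ltNge; apply/negP => h; apply: qx; rewrite qr.
rewrite /sdist u0 //; last by right; move: w0; lra.
rewrite normr0 add0r (eq_bigr (fun i : 'I_n => `|0 - k i.+1| - `|0 - k i|)); last first.
  move=> i _; rewrite rise1 ?mulr1 //.
  by have := bounded_lines tab (ltn_ord i); rewrite ler_norml => /andP[_ ?]; lra.
rewrite -(big_mkord xpredT (fun i => `|0 - k i.+1| - `|0 - k i|)) (telescope_sumr (fun i => `|0 - k i|)) //.
by rewrite k0 kn subrr.
Qed.

Lemma norm_sdist q : 0 <= q.2 < T -> `|sdist u n p s k w q.1 q.2| <= M + total_jump n k.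
Proof.
move=> tT; apply: le_trans (ler_normD _ _) _; apply: lerD; first by rewrite normr_id uM.
apply: le_trans (ler_norm_sum _ _ _) _; apply: ler_sum => i _.
rewrite normrM -[leRHS]mulr1; apply: ler_pM => //.
  apply: le_trans (ler_dist_dist _ _) _.
  by rewrite (_ : _ - _ - _ = k i - k i.+1) 1?distrC //; ring.
by rewrite ger0_norm ?rise_ge0 // rise_le1.
Qed.

Lemma integrable_drise_sdist e : a <= e -> e + w <= b ->
  (mu \x mu)%E.-integrable setT (fun q => (drise e w q.2 * sdist u n p s k w q.1 q.2)%:E).
Proof.
move=> ae eb.
have T0 : 0 < T by move: a0 ac cd db bT w0; lra.
have w2 : 0 <= 2 / w by rewrite divr_ge0 // ltW.
apply: (@integrable_rect _ (fun q : R * R => drise e w q.2 * sdist u n p s k w q.1 q.2)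
   (2 / w * (M + total_jump n k)) (- rad) (rad + w) e (e + w)).
- apply: measurable_funM; [exact: measurable_drise_time | exact: measurable_sdist].
- move=> q; rewrite normrM.
  have [te|te] := boolP (e <= q.2 <= e + w); last first.
    have -> : drise e w q.2 = 0.
      have [h|h] := lerP q.2 e; first exact: drise0.
      by rewrite drise1 // leNgt; apply/negP => h'; move/negP: te; apply; rewrite !ltW.
    rewrite normr0 mul0r; apply: mulr_ge0 => //; apply: addr_ge0; last exact: total_jump_ge0.
    exact: (bound_ge0 uM).
  apply: ler_pM => //; first exact: norm_drise.
  apply: norm_sdist; move: a0 bT te => ? ? /andP[? ?]; apply/andP; split; lra.
- move=> q out; have [te|te] := boolP (e <= q.2 <= e + w).
    rewrite sdist_vanish ?mulr0 //; last by move=> h; apply: out.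
    by move: te => /andP[? ?]; apply/andP; split; lra.
  have [h|h] := lerP q.2 e; first by rewrite drise0 ?mul0r.
  by rewrite drise1 ?mul0r // leNgt; apply/negP => h'; move/negP: te; apply; rewrite !ltW.
Qed.

End SlabIntegrability.

Lemma slab_times (R : realType) (a b w : R) : 0 < w -> 4 * w <= b - a ->
  [/\ [/\ a < a + w, a <= a + w, a <= b - w & b - w + w <= b], a + w + w <= b,
    forall t, a + w <= t <= a + w + w -> a <= t <= b /\ a <= t <= a + 2 * w &
    forall t, b - w <= t <= b - w + w -> a <= t <= b /\ b - w <= t <= b].
Proof.
move=> w0 wab; split; [by split; lra | by lra | |] => t /andP[? ?];
  by split; apply/andP; split; lra.
Qed.

Lemma slab_start (R : realType) (a b c w t : R) : 0 <= a -> b < c -> 0 < w -> 4 * w <= b - a ->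
  a <= t <= a + 2 * w -> [/\ a <= t <= b, 0 <= t < c & `|t - a| <= 2 * w].
Proof.
move=> a0 bc w0 wab /andP[t1 t2]; split; [apply/andP; split; lra | apply/andP; split; lra |].
by rewrite ger0_norm; lra.
Qed.

Lemma slab_end (R : realType) (a b c w t : R) : 0 <= a -> b < c -> 0 < w -> 4 * w <= b - a ->
  b - w <= t <= b -> [/\ a <= t <= b, 0 <= t < c & `|t - b| <= w].
Proof.
move=> a0 bc w0 wab /andP[t1 t2]; split; [apply/andP; split; lra | apply/andP; split; lra |].
by rewrite ler0_norm; lra.
Qed.

Section SlabStability.
Variable R : realType.
Local Notation mu := (@lebesgue_measure R).
Variables (T M MF : R) (F : R -> R) (u : R -> R -> R).
Hypothesis mu_ : measurable_fun setT (fun q : R * R => u q.1 q.2).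
Hypothesis cF : continuous F.
Hypothesis uM : forall x t, 0 <= t < T -> `|u x t| <= M.
Hypothesis FM : forall v, `|v| <= M -> `|F v| <= MF.
Hypothesis u0 : forall x t, 0 <= t < T -> (x <= 0 \/ 1 <= x) -> u x t = 0.
Hypothesis kruzhkov : forall (l : R) (phi : R -> R -> R), test_fun T phi ->
   (0 <= \int[mu \x mu]_(q in setT)
      ((`|u q.1 q.2 - l| * dt phi q.1 q.2
        + Num.sg (u q.1 q.2 - l) * (F (u q.1 q.2) - F l) * dx phi q.1 q.2)%:E))%E.
Hypothesis ucont : forall t0, 0 <= t0 < T ->
    (fun t => (\int[mu]_(x in setT) (`|u x t - u x t0|)%:E)%E)
       @ within [set t | 0 <= t < T] (nbhs t0) --> 0%E.

Lemma L1_continuity t0 r : 0 <= t0 < T -> 0 < r ->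
  exists2 e, 0 < e & forall t, 0 <= t < T -> `|t - t0| < e ->
    (L1 (fun x => (u x t - u x t0)%R) <= r%:E)%E.
Proof.
move=> t0T r0; have /fine_cvgP[Hfin Hcv] := ucont t0T.
have /cvgrPdist_le/(_ r r0) Hr := Hcv.
have : nbhs t0 (fun t => 0 <= t < T -> (\int[mu]_x `|u x t - u x t0|%:E)%E \is a fin_num /\
     `|0 - fine (\int[mu]_x `|u x t - u x t0|%:E)| <= r).
  exact: (@filterI _ _ (within_filter _ _) _ _ Hfin Hr).
move/nbhs_ballP => [e /= e0 He].
exists e => // t tT tt0.
have [|Ef El] := He t _ tT; first by rewrite /ball /= distrC.
move: El; rewrite sub0r normrN /= => El.
by rewrite /L1 -(fineK Ef) lee_fin (le_trans (ler_norm _) El).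
Qed.

Variables (n : nat) (p s k : nat -> R) (om a b : R).
Hypotheses (k0 : k 0%N = 0) (kn : k n = 0) (om0 : 0 <= om).
Hypotheses (a0 : 0 <= a) (ab : a < b) (bT : b < T).
Hypothesis sorted_lines : forall t i, a <= t <= b -> (i.+1 < n)%N -> line p s i t <= line p s i.+1 t.
Hypothesis front_cond : forall i v, (i < n)%N ->
  kflux F (k i.+1) v - kflux F (k i) v - s i * (`|v - k i.+1| - `|v - k i|) <= om * `|k i.+1 - k i|.

Local Notation J := (total_jump n k).
Local Notation SJ := (speed_jump n s k).

(** Contains the unit interval, one smoothing width and every front up to time [T]. *)
Definition slab_radius w := 1 + w + \sum_(i < n) (`|p i| + `|s i| * T).

Lemma slab_radius_line w t i : 0 < w -> a <= t <= b -> (i < n)%N -> `|line p s i t| <= slab_radius w.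
Proof.
have := a0; have := ab; have := bT => bT' ab' a0'.
move=> w0 /andP[ta tb] lin; have t0 : 0 <= t by lra.
have tT : t <= T by lra.
have T0 : 0 <= T by lra.
apply: le_trans (_ : `|p i| + `|s i| * T <= _).
  apply: le_trans (ler_normD _ _) _; rewrite lerD2l normrM (ger0_norm t0).
  exact: ler_wpM2l.
rewrite /slab_radius (bigD1 (Ordinal lin)) //= ; set B := (X in _ <= _ + (_ + X)).
have B0 : 0 <= B by apply: sumr_ge0 => j _; rewrite addr_ge0 // mulr_ge0.
by clearbody B; lra.
Qed.

(** The time derivative of the window is a positive bump near [c] minus one near [d]: the summed
    inequality bounds a time average of the smoothed distance near [d] by one near [c] plus the
    production at the fronts. *)
Lemma slab_energy c d w : 0 < w -> a < c -> c <= d -> d + w <= b ->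
  (\int[mu \x mu]_q (drise d w q.2 * sdist u n p s k w q.1 q.2)%:E <=
   \int[mu \x mu]_q (drise c w q.2 * sdist u n p s k w q.1 q.2 +
     window c d w q.2 * (om * \sum_(i < n) `|k i.+1 - k i| * drise (line p s i q.2) w q.1))%:E)%E.
Proof.
have := a0; have := ab; have := bT => bT' ab' a0'.
move=> w0 ac cd db.
have rw : 1 + w <= slab_radius w.
  rewrite /slab_radius lerDl; apply: sumr_ge0 => j _; rewrite addr_ge0 // mulr_ge0 //.
  by move: a0 ab bT; lra.
have bl t i : a <= t <= b -> (i < n)%N -> `|line p s i t| <= slab_radius w.
  by move=> *; exact: slab_radius_line.
pose G q := \sum_(r < n.+1) region_term F u n p s k (slab_radius w) c d w r q.
have IG := integrable_sum_region_term mu_ cF uM FM k w0 rw a0 ac cd db bT sorted_lines bl.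
have G0 := integral_sum_region_term_ge0 mu_ cF uM FM kruzhkov k w0 rw a0 ac cd db bT sorted_lines bl.
have ID := integrable_drise_sdist mu_ uM u0 k0 kn w0 rw a0 ac cd db bT bl.
pose W (q : R * R) := window c d w q.2 * (om * \sum_(i < n) `|k i.+1 - k i| * drise (line p s i q.2) w q.1).
have IW : (mu \x mu)%E.-integrable setT (EFin \o W).
  apply: (@integrable_rect _ W (om * \sum_(i < n) `|k i.+1 - k i| * (2 / w)) (- slab_radius w) (slab_radius w + w) c (d + w)).
  - apply: measurable_funM; first by apply: measurable_funB; exact: measurable_rise_time.
    apply: measurable_funM; first exact: measurable_cst.
    apply: measurable_sum => i; apply: measurable_funM; first exact: measurable_cst.
    exact: measurable_drise_moving.
  - move=> q; rewrite /W normrM -[leRHS]mul1r; apply: ler_pM => //.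
      by rewrite /window norm_rise_sub.
    rewrite normrM (ger0_norm om0); apply: ler_wpM2l => //.
    apply: le_trans (ler_norm_sum _ _ _) _; apply: ler_sum => i _.
    by rewrite normrM normr_id; apply: ler_wpM2l => //; exact: norm_drise.
  - move=> q out; rewrite /W; have [tcd|tcd] := boolP (c <= q.2 <= d + w); last first.
      by rewrite window0 ?mul0r //; exact/negP.
    have tab : a <= q.2 <= b by move: tcd => /andP[? ?]; apply/andP; split; lra.
    rewrite big1 ?mulr0 // => i _.
    have := bl _ _ tab (ltn_ord i); rewrite ler_norml => /andP[l1 l2].
    have [h|h] := lerP q.1 (line p s i q.2); first by rewrite drise0 ?mulr0.
    rewrite drise1 ?mulr0 // leNgt; apply/negP => h'; apply: out; split => //.
    by apply/andP; split; lra.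
(* Adding the nonnegative integral of [G] on the left turns the claim into a pointwise inequality
   between integrands, which is [sum_region_term]. *)
apply: (@le_trans _ _ (\int[mu \x mu]_q ((drise d w q.2 * sdist u n p s k w q.1 q.2)%:E + (G q)%:E))%E).
  by rewrite integralD // ?leeDl //; apply: ID => //; lra.
apply: le_integral => //.
- by apply: integrableD => //; apply: ID => //; lra.
- rewrite (_ : (fun _ => _) = (fun q => (drise c w q.2 * sdist u n p s k w q.1 q.2)%:E + (EFin \o W) q)%E).
    by apply: integrableD => //; apply: ID => //; lra.
  by apply/funext => q.
move=> [x t] _; rewrite -EFinD lee_fin /G /=.
have [tcd|tcd] := boolP (c <= t <= d + w); last first.
  rewrite big1; last first.
    move=> r _; apply: (region_term_outside F u k w0 rw a0 ac cd db bT sorted_lines bl) => //.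
    by move=> [_ /= h]; move/negP: tcd; apply.
  rewrite window0 //; last exact/negP.
  have [h|h] := lerP t c; first by rewrite !drise0 //; lra.
  have h' : d + w < t by rewrite ltNge; apply/negP => h'; move/negP: tcd; apply; rewrite ltW.
  by rewrite !drise1 //; lra.
have tT : 0 <= t < T by move: tcd => /andP[? ?]; apply/andP; split; lra.
rewrite sum_region_term //; last by move=> xo; apply: u0.
rewrite /dwindow addrA; apply: lerD; first by rewrite mulrBl addrC subrK.
apply: ler_wpM2l; first exact: window_ge0.
rewrite mulr_sumr; apply: ler_sum => i _; rewrite [leRHS]mulrA; apply: ler_wpM2r; first exact: drise_ge0.
exact: front_cond.
Qed.

Lemma integral_scale_sdist g t w : 0 <= g -> 0 < w -> a <= t <= b ->
  (\int[mu]_x (g * sdist u n p s k w x t)%:E = g%:E * L1 (fun x => sdist u n p s k w x t))%E.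
Proof.
move=> g0 w0 tab; rewrite /L1 -ge0_integralZl_EFin //.
- apply: eq_integral => x _; rewrite EFinM ger0_norm //.
  by apply: sdist_ge0 => // i; exact: sorted_lines.
- by apply/measurable_EFinP; apply: measurableT_comp => //; exact: measurable_sdist_slice.
Qed.

Lemma integral_layers g t w : 0 <= g -> 0 < w ->
  (\int[mu]_x (g * (om * \sum_(i < n) `|k i.+1 - k i| * drise (line p s i t) w x))%:E
   = (g * (om * J))%:E)%E.
Proof.
move=> g0 w0.
have md i : measurable_fun setT (fun x => (`|k i.+1 - k i| * drise (line p s i t) w x)%:E).
  apply/measurable_EFinP; apply: measurable_funM; first exact: measurable_cst.
  exact: measurable_drise.
have ms : measurable_fun setT (fun x => (\sum_(i < n) `|k i.+1 - k i| * drise (line p s i t) w x)%:E).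
  apply/measurable_EFinP; apply: measurable_sum => i; apply: measurable_funM; first exact: measurable_cst.
  exact: measurable_drise.
have d0 (i : nat) x : 0 <= `|k i.+1 - k i| * drise (line p s i t) w x.
  by rewrite mulr_ge0 // drise_ge0.
have gom0 : 0 <= g * om by exact: mulr_ge0.
transitivity ((g * om)%:E * \int[mu]_x (\sum_(i < n) `|k i.+1 - k i| * drise (line p s i t) w x)%:E)%E.
  rewrite -ge0_integralZl_EFin //; first by apply: eq_integral => x _; rewrite mulrA EFinM.
  by move=> x _; rewrite lee_fin; apply: sumr_ge0 => i _.
rewrite mulrA [RHS]EFinM; congr (_ * _)%E; rewrite /total_jump.
transitivity (\int[mu]_x (\sum_(i < n) (`|k i.+1 - k i| * drise (line p s i t) w x)%:E))%E.
  by apply: eq_integral => x _; rewrite sumEFin.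
rewrite ge0_integral_sum //; last by move=> i x _; rewrite lee_fin.
rewrite -sumEFin; apply: eq_bigr => i _.
transitivity (`|k i.+1 - k i|%:E * \int[mu]_x (drise (line p s i t) w x)%:E)%E.
  rewrite -ge0_integralZl_EFin //; first by move=> x _; rewrite lee_fin drise_ge0.
  by apply/measurable_EFinP; exact: measurable_drise.
  by rewrite integral_drise // mule1.
by move=> i; exact: md.
Qed.

(** At either end, replacing the time average of the smoothed distance by the distance at the end
    point itself costs at most [3 * dl]. *)
Lemma slab_eps dl : 0 < dl ->
  (L1 (fun x => (u x b - wav n p s k b x)%R) <=
   L1 (fun x => (u x a - wav n p s k a x)%R) + (om * (b - a) * J + 6 * dl)%:E)%E.
Proof.
move=> dl0.
have := a0; have := ab; have := bT => bT' ab' a0'.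
have aT : 0 <= a < T by apply/andP; split; lra.
have bT0 : 0 <= b < T by apply/andP; split; lra.
have [ea ea0 Ha] := L1_continuity aT dl0.
have [eb eb0 Hb] := L1_continuity bT0 dl0.
have J0 : 0 <= J := total_jump_ge0 _ _.
have SJ0 : 0 <= SJ := speed_jump_ge0 _ _ _.
(* One width for time and space: below the moduli of continuity of [u] at both ends, short against
   the slab, and so small that the motion of the fronts and the smoothing layers cost at most [dl].
   The summand 1 keeps the divisor positive. *)
have [w [w0 wea web wab wdl]] : exists w, [/\ 0 < w, 4 * w <= ea, 4 * w <= eb, 4 * w <= b - a &
    w * (2 * SJ + J + 1) <= dl].
  exists (Num.min (Num.min ea eb) (Num.min (b - a) (dl / (2 * SJ + J + 1))) / 4).
  have q0 : 0 < 2 * SJ + J + 1 by lra.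
  have dq : 0 < dl / (2 * SJ + J + 1) by apply: divr_gt0.
  set m := Num.min _ _.
  have m1 : m <= ea by rewrite /m !ge_min lexx.
  have m2 : m <= eb by rewrite /m !ge_min lexx !orbT.
  have m3 : m <= b - a by rewrite /m !ge_min lexx !orbT.
  have m4 : m <= dl / (2 * SJ + J + 1) by rewrite /m !ge_min lexx !orbT.
  have m0 : 0 < m by rewrite /m !lt_min ea0 eb0 dq subr_gt0 ab'.
  rewrite ler_pdivlMr // in m4; clearbody m.
  split; [lra | lra | lra | lra |].
  rewrite (_ : m / 4 * (2 * SJ + J + 1) = m * (2 * SJ + J + 1) / 4); last by ring.
  by lra.
have c_d : a + w <= b - w by lra.
have [[a_w aw_b a_bw bw_b] aw_b2 in_a in_b] := slab_times w0 wab.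
have Hen := slab_energy w0 a_w c_d bw_b.
have Na := L1_dist_fin mu_ uM u0 p s k0 kn aT.
have Nb := L1_dist_fin mu_ uM u0 p s k0 kn bT0.
have [na En] : exists na, L1 (fun x => (u x a - wav n p s k a x)%R) = na%:E.
  by exists (fine (L1 (fun x => (u x a - wav n p s k a x)%R))); rewrite fineK // ge0_fin_numE // L1_ge0.
have [nb Eb] : exists nb, L1 (fun x => (u x b - wav n p s k b x)%R) = nb%:E.
  by exists (fine (L1 (fun x => (u x b - wav n p s k b x)%R))); rewrite fineK // ge0_fin_numE // L1_ge0.
have na0 : 0 <= na by rewrite -lee_fin -En L1_ge0.
have slb t : a <= t <= b -> forall i, (i.+1 < n)%N -> line p s i t <= line p s i.+1 t.
  by move=> tab i; exact: sorted_lines.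
have up t : a <= t <= a + 2 * w -> (L1 (fun x => sdist u n p s k w x t) <= (na + 3 * dl)%:E)%E.
  move=> /(slab_start a0' bT' w0 wab)[tab tT ta].
  apply: (le_trans (L1_sdist_le mu_ (p := p) (s := s) a w0 k0 kn (slb t tab))).
  rewrite En [X in (_ <= X)%E]EFinD leeD2l //.
  rewrite (_ : 3 * dl = dl + 2 * dl); last by ring.
  rewrite [X in (_ <= X)%E]EFinD; apply: leeD.
    by apply: Ha => //; apply: le_lt_trans ta _; lra.
  have : SJ * `|t - a| <= SJ * (2 * w) by exact: ler_wpM2l.
  by rewrite lee_fin; nra.
have lo t : b - w <= t <= b -> ((nb - 3 * dl)%:E <= L1 (fun x => sdist u n p s k w x t))%E.
  move=> /(slab_end a0' bT' w0 wab)[tab tT tb].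
  rewrite EFinB leeBlDr //.
  rewrite -Eb; apply: (le_trans (L1_le_sdist mu_ (p := p) (s := s) b w0 k0 kn (slb t tab))).
  rewrite leeD2l // (_ : 3 * dl = dl + 2 * dl); last by ring.
  rewrite [X in (_ <= X)%E]EFinD; apply: leeD.
    by apply: Hb => //; apply: le_lt_trans tb _; lra.
  have : SJ * `|t - b| <= SJ * w by exact: ler_wpM2l.
  by rewrite lee_fin; nra.
rewrite En Eb -EFinD lee_fin.
(* The constant [nb - 3 * dl] is to be pulled out of an integral by a rule for nonnegative factors,
   so the trivial case is split off. *)
have [nbs|nbs] := lerP nb (3 * dl).
  have : 0 <= om * (b - a) * J by rewrite !mulr_ge0 //; lra.
  by lra.
have bds c t : drise c w t != 0 -> c <= t <= c + w.
  move=> h; apply/andP; split; rewrite leNgt; apply/negP => h'; move/eqP: h; apply.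
    by rewrite drise0 // ltW.
  by rewrite drise1 // ltW.
have sd_ge0 c q : a <= c -> c + w <= b -> 0 <= drise c w q.2 * sdist u n p s k w q.1 q.2.
  move=> ac cb; have [->|/bds /andP[h1 h2]] := eqVneq (drise c w q.2) 0; first by rewrite mul0r.
  rewrite mulr_ge0 ?drise_ge0 // sdist_ge0 //; apply: slb; apply/andP.
  by split; [exact: le_trans h1 | exact: le_trans cb].
have layer_ge0 (q : R * R) : 0 <= window (a + w) (b - w) w q.2 *
    (om * \sum_(i < n) `|k i.+1 - k i| * drise (line p s i q.2) w q.1).
  rewrite !mulr_ge0 ?window_ge0 //; apply: sumr_ge0 => i _; rewrite mulr_ge0 // drise_ge0 //.
have mds c : measurable_fun setT (fun q : R * R => drise c w q.2 * sdist u n p s k w q.1 q.2).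
  by apply: measurable_funM; [exact: measurable_drise_time | exact: measurable_sdist].
have mlay : measurable_fun setT (fun q : R * R => window (a + w) (b - w) w q.2 *
    (om * \sum_(i < n) `|k i.+1 - k i| * drise (line p s i q.2) w q.1)).
  apply: measurable_funM; first by apply: measurable_funB; exact: measurable_rise_time.
  apply: measurable_funM; first exact: measurable_cst.
  apply: measurable_sum => i; apply: measurable_funM; first exact: measurable_cst.
  exact: measurable_drise_moving.
have mE1 : measurable_fun setT (fun q : R * R => (drise (b - w) w q.2 * sdist u n p s k w q.1 q.2)%:E).
  by apply/measurable_EFinP.
have mE2 : measurable_fun setT (fun q : R * R => (drise (a + w) w q.2 * sdist u n p s k w q.1 q.2 +
     window (a + w) (b - w) w q.2 * (om * \sum_(i < n) `|k i.+1 - k i| * drise (line p s i q.2) w q.1))%:E).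
  by apply/measurable_EFinP; exact: measurable_funD.
have sd0b q : (0 <= (drise (b - w) w q.2 * sdist u n p s k w q.1 q.2)%:E)%E.
  by rewrite lee_fin; exact: sd_ge0.
have sdl0 q : (0 <= (drise (a + w) w q.2 * sdist u n p s k w q.1 q.2 +
     window (a + w) (b - w) w q.2 * (om * \sum_(i < n) `|k i.+1 - k i| * drise (line p s i q.2) w q.1))%:E)%E.
  by rewrite lee_fin; apply: addr_ge0 => //; exact: sd_ge0.
(* By Tonelli both sides become time integrals of slices. Since [drise] has integral 1 and lives
   near one end of the slab, the bounds [lo] and [up] for the slices pass to the averages. *)
have F1 := @fubini_tonelli2 _ _ _ _ R mu mu _ mE1 (fun q => sd0b q).
have F2 := @fubini_tonelli2 _ _ _ _ R mu mu _ mE2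
  sdl0.
have mdr c : measurable_fun setT (fun t : R => (drise c w t)%:E).
  by apply/measurable_EFinP; exact: measurable_drise.
have dge0 c : forall t : R, setT t -> (0 <= (drise c w t)%:E)%E by move=> t _; rewrite lee_fin drise_ge0.
have nbs' : 0 <= nb - 3 * dl by rewrite subr_ge0 ltW.
have nas' : 0 <= na + 3 * dl by rewrite addr_ge0 // mulr_ge0 // ltW.
have L : ((nb - 3 * dl)%:E <= \int[mu]_t fubini_G mu (fun q => (drise (b - w) w q.2 * sdist u n p s k w q.1 q.2)%:E) t)%E.
  rewrite -[leLHS]mule1 -(integral_drise (b - w) w0) -(ge0_integralZl_EFin mu measurableT (dge0 _) (mdr _) nbs').
  apply: ge0_le_integral => //.
  - by move=> t _; rewrite -EFinM lee_fin mulr_ge0 ?drise_ge0.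
  - by apply: measurable_funeM; exact: mdr.
  - exact: measurable_fun_fubini_tonelli_G.
  move=> t _; rewrite /fubini_G /=.
  have [->|dt0] := eqVneq (drise (b - w) w t) 0.
    by rewrite mule0; apply: integral_ge0 => x _; rewrite lee_fin mul0r.
  have [tab tb] := in_b t (bds _ _ dt0).
  rewrite integral_scale_sdist ?drise_ge0 //.
  rewrite muleC; apply: lee_wpmul2l; first by rewrite lee_fin drise_ge0.
  exact: lo.
have mab : measurable_fun setT (fun t : R => (\1_(`[a, b]%classic) t : R)%:E).
  by apply/measurable_EFinP; exact: measurable_indic.
have mm1 : measurable_fun setT (fun t : R => ((na + 3 * dl)%:E * (drise (a + w) w t)%:E)%E).
  by apply/measurable_EFinP; apply: measurable_funM; [exact: measurable_cst | exact: measurable_drise].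
have mm2 : measurable_fun setT (fun t : R => ((om * J)%:E * (\1_(`[a, b]%classic) t : R)%:E)%E : \bar R).
  by apply/measurable_EFinP; apply: measurable_funM; [exact: measurable_cst | exact: measurable_indic].
have U : (\int[mu]_t fubini_G mu (fun q => (drise (a + w) w q.2 * sdist u n p s k w q.1 q.2 +
     window (a + w) (b - w) w q.2 * (om * \sum_(i < n) `|k i.+1 - k i| * drise (line p s i q.2) w q.1))%:E) t
   <= (na + 3 * dl + om * J * (b - a))%:E)%E.
  apply: (@le_trans _ _ (\int[mu]_t ((na + 3 * dl)%:E * (drise (a + w) w t)%:E
      + (om * J)%:E * (\1_(`[a, b]%classic) t : R)%:E))%E); last first.
    have g1 : forall t : R, setT t -> (0 <= (na + 3 * dl)%:E * (drise (a + w) w t)%:E)%E.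
      by move=> t _; rewrite -EFinM lee_fin mulr_ge0 ?drise_ge0.
    have g2 : forall t : R, setT t -> (0 <= (om * J)%:E * (\1_(`[a, b]%classic) t : R)%:E :> \bar R)%E.
      by move=> t _; rewrite -EFinM lee_fin !mulr_ge0 // indicE.
    rewrite (ge0_integralD mu measurableT g1 mm1 g2 mm2).
    rewrite (ge0_integralZl_EFin mu measurableT (dge0 _) (mdr _) nas').
    have ab0 : forall t : R, setT t -> (0 <= (\1_(`[a, b]%classic) t : R)%:E :> \bar R)%E.
      by move=> t _; rewrite lee_fin indicE.
    have omJ : 0 <= om * J by exact: mulr_ge0.
    rewrite integral_drise // mule1 (ge0_integralZl_EFin mu measurableT ab0 mab omJ).
    have -> : (\int[mu]_t (\1_(`[a, b]%classic) t : R)%:E = (b - a)%:E)%E.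
      rewrite -(L1_indic_itv (ltW ab')); apply: eq_integral => t _.
      by rewrite ger0_norm // indicE.
    by rewrite -EFinM -EFinD.
  apply: ge0_le_integral => //.
  - by move=> t _; apply: integral_ge0 => x _; exact: (sdl0 (x, t)).
  - exact: measurable_fun_fubini_tonelli_G.
  - exact: (emeasurable_funD mm1 mm2).
  move=> t _; rewrite /fubini_G /=.
  under eq_integral do rewrite EFinD.
  have h1 : forall x : R, setT x -> (0 <= (drise (a + w) w t * sdist u n p s k w x t)%:E)%E.
    by move=> x _; rewrite lee_fin; exact: (sd_ge0 (a + w) (x, t)).
  have h2 : measurable_fun setT (fun x : R => (drise (a + w) w t * sdist u n p s k w x t)%:E).
    apply/measurable_EFinP; apply: measurable_funM; first exact: measurable_cst.
    exact: measurable_sdist_slice.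
  have h3 : forall x : R, setT x -> (0 <= (window (a + w) (b - w) w t *
      (om * \sum_(i < n) `|k i.+1 - k i| * drise (line p s i t) w x))%:E)%E.
    by move=> x _; rewrite lee_fin; exact: (layer_ge0 (x, t)).
  have h4 : measurable_fun setT (fun x : R => (window (a + w) (b - w) w t *
      (om * \sum_(i < n) `|k i.+1 - k i| * drise (line p s i t) w x))%:E).
    apply/measurable_EFinP; apply: measurable_funM; first exact: measurable_cst.
    apply: measurable_funM; first exact: measurable_cst.
    apply: measurable_sum => i; apply: measurable_funM; first exact: measurable_cst.
    exact: measurable_drise.
  rewrite (ge0_integralD mu measurableT h1 h2 h3 h4).
  rewrite integral_layers ?window_ge0 //; apply: leeD.
    have [->|dt0] := eqVneq (drise (a + w) w t) 0.
      by rewrite mule0; under eq_integral do rewrite mul0r; rewrite integral0.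
    have [tab ta] := in_a t (bds _ _ dt0).
    rewrite integral_scale_sdist ?drise_ge0 //.
    rewrite [X in (_ <= X)%E]muleC; apply: lee_wpmul2l; first by rewrite lee_fin drise_ge0.
    exact: up.
  rewrite -EFinM lee_fin mulrC; apply: ler_wpM2l; first exact: mulr_ge0.
  rewrite indicE mem_setE in_itv /=; have [tab|tab] := boolP (a <= t <= b); first exact: window_le1.
  rewrite window0 // => /andP[t1 t2]; move/negP: tab; apply; apply/andP.
  by split; [exact: le_trans t1 | exact: le_trans bw_b].
have : ((nb - 3 * dl)%:E <= (na + 3 * dl + om * J * (b - a))%:E)%E.
  by apply: le_trans L _; rewrite -F1; apply: le_trans Hen _; rewrite F2.
by rewrite lee_fin; lra.
Qed.

End SlabStability.

(** * Front tracking *)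

Section FrontStates.
Variables (R : realType) (F dF : R -> R) (Gr : seq R).

(* the front [i] sits at [fy i] and separates the values [fk i] and [fk i.+1] *)
Record fstate := FState { fn : nat; fy : nat -> R; fk : nat -> R }.

Definition fspeed st i : R := slope F dF (fk st i) (fk st i.+1).
Definition fadv st (t : R) := FState (fn st) (fun i => fy st i + fspeed st i * t) (fk st).
(** When the fronts [j] and [j.+1] meet, the value [fk st j.+1] between them disappears; [bump j.+1]
    skips this index, among the fronts as well. *)
Definition fdrop st j := FState (fn st).-1 (fun i => fy st (bump j.+1 i)) (fun i => fk st (bump j.+1 i)).
Definition fsorted st := forall i, (i.+1 < fn st)%N -> fy st i <= fy st i.+1.
Definition fprofile st : R -> R := pwc (fn st) (fy st) (fk st).

(* upward jumps join neighbouring grid values: they stand for rarefactions *)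
Definition admissible_front (a b : R) :=
  b <= a \/ (a < b /\ forall p, p \in Gr -> ~~ (a < p < b)).

Definition fvalid st := [/\ fk st 0%N = 0, fk st (fn st) = 0,
  forall i, (i <= fn st)%N -> fk st i \in Gr &
  forall i, (i < fn st)%N -> admissible_front (fk st i) (fk st i.+1)].

(** A relation indexed by collisions: the estimates are inductions on it, and existence is a
    separate question. Fronts move along lines, so sortedness at both ends of a free piece implies
    sortedness throughout. *)
Inductive evo : fstate -> R -> fstate -> Prop :=
| evo_free st t : 0 <= t -> fvalid st -> fsorted st -> fsorted (fadv st t) -> evo st t (fadv st t)
| evo_merge st t j t' st' : 0 <= t -> fvalid st -> fsorted st -> fsorted (fadv st t) ->
    (j.+1 < fn st)%N -> fy (fadv st t) j = fy (fadv st t) j.+1 ->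
    evo (fdrop (fadv st t) j) t' st' -> evo st (t + t') st'.

Lemma evo_ge0 st t st' : evo st t st' -> 0 <= t.
Proof. by move=> h; induction h => //; exact: addr_ge0. Qed.

Lemma evo_valid st t st' : evo st t st' -> fvalid st /\ fsorted st.
Proof. by case. Qed.

(** With [c] arbitrary it serves the profile ([heav]) and the potential ([pos_part]) alike. *)
Lemma sum_drop st j (c : R -> R) : (j.+1 < fn st)%N -> fy st j = fy st j.+1 ->
  \sum_(i < fn (fdrop st j)) (fk (fdrop st j) i.+1 - fk (fdrop st j) i) * c (fy (fdrop st j) i) =
  \sum_(i < fn st) (fk st i.+1 - fk st i) * c (fy st i).
Proof.
case: st => [[//|m] y k] /=; rewrite ltnS => jm yj.
pose g i := (k i.+1 - k i) * c (y i).
rewrite [RHS](bigD1_ord (Ordinal (jm : j.+1 < m.+1)%N)) //= -/(g _).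
have jm' : (j < m)%N by [].
rewrite (bigD1 (Ordinal jm')) //= [in RHS](bigD1 (Ordinal jm')) //= addrA; congr (_ + _).
  have -> : bump j.+1 j = j by rewrite /bump ltnn.
  by rewrite /bump leqnn /= add1n /g yj -mulrDl addrA subrK.
apply: eq_bigr => i ij; rewrite /g -/(bump j.+1 i) bumpS; congr ((k _.+1 - _) * _).
by rewrite /bump [in RHS]ltn_neqAle eq_sym -val_eqE /= in ij *; rewrite ij.
Qed.

Lemma profile_drop st j x : (j.+1 < fn st)%N -> fy st j = fy st j.+1 ->
  fprofile (fdrop st j) x = fprofile st x.
Proof. by move=> jn yj; rewrite /fprofile /pwc (sum_drop (fun l => heav l x)). Qed.

Lemma total_jump_drop st j : (j.+1 < fn st)%N ->
  total_jump (fn (fdrop st j)) (fk (fdrop st j)) <= total_jump (fn st) (fk st).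
Proof.
case: st => [[//|m] y k] /=; rewrite ltnS => jm; rewrite /total_jump.
pose g i := `|k i.+1 - k i|.
rewrite [leRHS](bigD1_ord (Ordinal (jm : j.+1 < m.+1)%N)) //= -/(g _).
have jm' : (j < m)%N by [].
rewrite (bigD1 (Ordinal jm')) //= [in leRHS](bigD1 (Ordinal jm')) //= addrA; apply: lerD.
  have -> : bump j.+1 j = j by rewrite /bump ltnn.
  rewrite /bump leqnn /= add1n /g.
  by rewrite (_ : k j.+2 - k j = (k j.+2 - k j.+1) + (k j.+1 - k j)) ?ler_normD //; ring.
apply: ler_sum => i ij; rewrite bumpS.
suff -> : bump j i = bump j.+1 i by [].
by rewrite /bump [in RHS]ltn_neqAle eq_sym -val_eqE /= in ij *; rewrite ij.
Qed.

End FrontStates.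

Section KruzhkovStability.
Variable R : realType.
Local Notation mu := (@lebesgue_measure R).
Variables (T M MF om : R) (F dF : R -> R) (Gr : seq R) (u : R -> R -> R).
Hypothesis tang : forall a b, F a + dF a * (b - a) <= F b.
Hypothesis fine_grid : forall a b, a \in Gr -> b \in Gr -> a < b ->
  (forall p, p \in Gr -> ~~ (a < p < b)) -> 2 * (dF b - dF a) <= om.
Hypothesis om0 : 0 <= om.
Hypothesis mu_ : measurable_fun setT (fun q : R * R => u q.1 q.2).
Hypothesis cF : continuous F.
Hypothesis uM : forall x t, 0 <= t < T -> `|u x t| <= M.
Hypothesis FM : forall v, `|v| <= M -> `|F v| <= MF.
Hypothesis u0 : forall x t, 0 <= t < T -> (x <= 0 \/ 1 <= x) -> u x t = 0.
Hypothesis kruzhkov : forall (l : R) (phi : R -> R -> R), test_fun T phi ->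
   (0 <= \int[mu \x mu]_(q in setT)
      ((`|u q.1 q.2 - l| * dt phi q.1 q.2
        + Num.sg (u q.1 q.2 - l) * (F (u q.1 q.2) - F l) * dx phi q.1 q.2)%:E))%E.
Hypothesis ucont : forall t0, 0 <= t0 < T ->
    (fun t => (\int[mu]_(x in setT) (`|u x t - u x t0|)%:E)%E)
       @ within [set t | 0 <= t < T] (nbhs t0) --> 0%E.

Lemma front_entropy st i v : fvalid Gr st -> (i < fn st)%N ->
  kflux F (fk st i.+1) v - kflux F (fk st i) v - fspeed F dF st i * (`|v - fk st i.+1| - `|v - fk st i|)
    <= om * `|fk st i.+1 - fk st i|.
Proof.
move=> [_ _ inGr adm] lin.
have -> : kflux F (fk st i.+1) v - kflux F (fk st i) v - fspeed F dF st i *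
  (`|v - fk st i.+1| - `|v - fk st i|) = front_prod F dF (fk st i) (fk st i.+1) v by [].
have [ba|[ab nogap]] := adm i lin.
  apply: le_trans (front_prod_down tang _ ba) _; exact: mulr_ge0.
apply: le_trans (front_prod_up tang _ (ltW ab)) _.
rewrite ger0_norm ?subr_ge0 ?(ltW ab) //; apply: ler_wpM2r; first by rewrite subr_ge0 ltW.
by apply: fine_grid => //; apply: inGr => //; exact: ltnW.
Qed.

Lemma free_stability st t0 t : 0 <= t0 -> t0 + t < T -> 0 <= t -> fvalid Gr st -> fsorted st ->
  fsorted (fadv F dF st t) ->
  (L1 (fun x => (u x (t0 + t) - fprofile (fadv F dF st t) x)%R) <=
   L1 (fun x => (u x t0 - fprofile st x)%R) + (om * t * total_jump (fn st) (fk st))%:E)%E.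
Proof.
move=> t00 tT; rewrite le_eqVlt => /predU1P[<-|tpos] vst sst ssta.
  rewrite addr0 mulr0 mul0r adde0; apply: le_L1.
  - by apply: measurable_funB; [exact: measurable_slice | exact: measurable_pwc].
  - by apply: measurable_funB; [exact: measurable_slice | exact: measurable_pwc].
  move=> x; suff -> : fprofile (fadv F dF st 0) x = fprofile st x by [].
  by rewrite /fprofile /pwc; apply: eq_bigr => i _; rewrite /= mulr0 addr0.
pose n := fn st; pose k := fk st; pose s := fspeed F dF st.
(* [line] measures time from 0, so the front is extrapolated back from [t0]. *)
pose p i := fy st i - s i * t0.
have Ea : forall x, fprofile st x = wav n p s k t0 x.
  move=> x; rewrite /wav /fprofile /pwc; apply: eq_bigr => i _.
  by rewrite /line /p subrK.
have Eb : forall x, fprofile (fadv F dF st t) x = wav n p s k (t0 + t) x.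
  move=> x; rewrite /wav /fprofile /pwc; apply: eq_bigr => i _; congr (_ * heav _ _).
  by rewrite /line /p /= /s; ring.
under [X in (L1 X <= _)%E]eq_fun do rewrite Eb.
under [X in (_ <= L1 X + _)%E]eq_fun do rewrite Ea.
have [k0 kn _ _] := vst.
have t0t : t0 < t0 + t by rewrite ltrDl.
have sl : forall r i, t0 <= r <= t0 + t -> (i.+1 < n)%N -> line p s i r <= line p s i.+1 r.
  move=> r i /andP[r1 r2] lin; have := sst i lin; have := ssta i lin.
  rewrite /line /p /= -/(s i) -/(s i.+1) => h1 h2.
  have : 0 <= ((fy st i.+1 + s i.+1 * t) - (fy st i + s i * t)) * (r - t0) +
     (fy st i.+1 - fy st i) * (t0 + t - r) by rewrite addr_ge0 // mulr_ge0 //; lra.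
  rewrite (_ : _ + _ = ((fy st i.+1 - s i.+1 * t0 + s i.+1 * r) - (fy st i - s i * t0 + s i * r)) * t); last by ring.
  by rewrite pmulr_lge0 // subr_ge0.
have fc : forall i v, (i < n)%N ->
  kflux F (k i.+1) v - kflux F (k i) v - s i * (`|v - k i.+1| - `|v - k i|) <= om * `|k i.+1 - k i|.
  by move=> i v lin; exact: front_entropy.
apply/lee_addgt0Pr => e e0; rewrite -addeA -EFinD.
have e6 : 0 < e / 6 by rewrite divr_gt0.
have := slab_eps mu_ cF uM FM u0 kruzhkov ucont k0 kn om0 t00 t0t tT sl fc e6.
congr (_ <= _ + _%:E)%E; rewrite (addrC t0) addrK; congr (_ + _); by field.
Qed.

(** A merge leaves the profile unchanged and does not increase the total jump, so the estimates of
    the free pieces add up. *)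
Lemma evo_stability st t st' : evo F dF Gr st t st' -> forall t0, 0 <= t0 -> t0 + t < T ->
  (L1 (fun x => (u x (t0 + t) - fprofile st' x)%R) <=
   L1 (fun x => (u x t0 - fprofile st x)%R) + (om * t * total_jump (fn st) (fk st))%:E)%E.
Proof.
move=> h; induction h as [st t tp vst sst ssta | st t j t' st' tp vst sst ssta jn yj h IH] => t0 t00 tT.
  exact: free_stability.
have t'0 := evo_ge0 h.
have t0tT : t0 + t < T by lra.
have t0t : 0 <= t0 + t by lra.
have tT' : t0 + t + t' < T by lra.
rewrite addrA; apply: le_trans (IH _ t0t tT') _.
under [X in (L1 X + _ <= _)%E]eq_fun do rewrite profile_drop //.
apply: le_trans (leeD2r _ (free_stability t00 t0tT tp vst sst ssta)) _.
rewrite -addeA leeD2l // -EFinD lee_fin.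
rewrite mulrDr mulrDl lerD2l; apply: ler_wpM2l; first exact: mulr_ge0.
exact: (@total_jump_drop _ (fadv F dF st t)).
Qed.

End KruzhkovStability.

(** * The Hopf-Lax formula on a grid of values *)

Section HopfLax.
Variables (R : realType) (F dF : R -> R) (Gr : seq R).

(* Legendre transform of the flux restricted to the grid, scaled by the elapsed time *)
Definition legendre (t z : R) : R := \big[Num.max/0]_(p <- Gr) (z * p - t * (F p - F 0)).

(** The primitive of [fprofile st] that vanishes to the left of all fronts. The Hopf-Lax formula
    holds for it, not for the profile. *)
Definition fpot (st : fstate R) (x : R) : R :=
  \sum_(i < fn st) (fk st i.+1 - fk st i) * pos_part (x - fy st i).

Lemma legendre_ge0 t z : 0 <= legendre t z.
Proof. exact: bigmax_ge_id. Qed.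

Lemma legendre_ge t z p : p \in Gr -> z * p - t * (F p - F 0) <= legendre t z.
Proof. by move=> pG; exact: (@le_bigmax_seq _ _ _ _ 0 p xpredT (fun p => z * p - t * (F p - F 0)) pG). Qed.

Lemma legendre_le t z c : 0 <= c -> (forall p, p \in Gr -> z * p - t * (F p - F 0) <= c) ->
  legendre t z <= c.
Proof.
move=> c0 h; rewrite /legendre big_seq; apply: (big_ind (fun v => v <= c)) => //.
by move=> a b ac bc; rewrite ge_max ac.
Qed.

(** Every term is linear in the pair [(t, z)], so the maximum is subadditive in the pair and, by
    [legendre_scale], homogeneous. These two facts make the Hopf-Lax formula pass through
    collisions. *)
Lemma legendre_subadd t t' z z' : legendre (t + t') (z + z') <= legendre t z + legendre t' z'.
Proof.
apply: legendre_le; first by rewrite addr_ge0 ?legendre_ge0.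
move=> p pG; have := legendre_ge t z pG; have := legendre_ge t' z' pG; lra.
Qed.

Lemma legendre_scale t z l : 0 <= l -> legendre (l * t) (l * z) <= l * legendre t z.
Proof.
move=> l0; apply: legendre_le; first by rewrite mulr_ge0 ?legendre_ge0.
move=> p pG; rewrite -!mulrA -mulrBr; apply: ler_wpM2l => //.
exact: legendre_ge.
Qed.

(* mean value of the Heaviside function on the segment from a to b *)
Definition crossing (a b : R) : R :=
  if (a <= 0) && (b <= 0) then 0 else if (0 <= a) && (0 <= b) then 1 else
  (pos_part b - pos_part a) / (b - a).

Lemma crossingE a b : pos_part b - pos_part a = crossing a b * (b - a).
Proof.
rewrite /crossing !pos_partE.
case: (lerP a 0) => a0; case: (lerP b 0) => b0; case: (lerP 0 a) => a1; case: (lerP 0 b) => b1 /=;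
  try lra; rewrite divfK //; apply/eqP; lra.
Qed.

Lemma crossing_ge0 a b : 0 <= crossing a b.
Proof.
rewrite /crossing !pos_partE.
case: (lerP a 0) => a0; case: (lerP b 0) => b0; case: (lerP 0 a) => a1; case: (lerP 0 b) => b1 //=; try lra.
- by apply: divr_ge0; lra.
- by rewrite -mulrNN -invrN; apply: divr_ge0; lra.
Qed.

Lemma crossing_le1 a b : crossing a b <= 1.
Proof.
rewrite /crossing !pos_partE.
case: (lerP a 0) => a0; case: (lerP b 0) => b0; case: (lerP 0 a) => a1; case: (lerP 0 b) => b1 //=; try lra.
- by rewrite ler_pdivrMr; lra.
- by rewrite -mulrNN -invrN ler_pdivrMr; lra.
Qed.

Lemma crossing_nonpos a b : a <= 0 -> b <= 0 -> crossing a b = 0.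
Proof. by rewrite /crossing => -> ->. Qed.

Lemma crossing_nonneg a b : 0 <= a -> 0 <= b -> 0 < a + b -> crossing a b = 1.
Proof.
rewrite /crossing => a0 b0 ab; rewrite a0 b0; case: ifP => // /andP[? ?]; lra.
Qed.

Lemma crossing_up a b : a < 0 -> 0 < b -> crossing a b = b / (b - a).
Proof.
move=> a0 b0; rewrite /crossing !pos_partE (ltW a0) (ltW b0) (lt_geF a0) (lt_geF b0) /=.
by rewrite subr0.
Qed.

Lemma crossing_down a b : 0 < a -> b < 0 -> crossing a b = a / (a - b).
Proof.
move=> a0 b0; rewrite /crossing !pos_partE (ltW a0) (ltW b0) (lt_geF a0) (lt_geF b0) /=.
by rewrite sub0r -mulrNN -invrN opprK opprB.
Qed.

Lemma crossing_homo a b a' b' : a <= a' -> b <= b' -> crossing a b <= crossing a' b'.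
Proof.
move=> aa bb.
have [a0|a0] := lerP a 0; have [b0|b0] := lerP b 0.
- by rewrite crossing_nonpos // crossing_ge0.
- have b0' : 0 < b' by lra.
  have [a1|a1] := lerP 0 a'; first by rewrite (crossing_nonneg a1 (ltW b0')) ?crossing_le1 //; lra.
  have a2 : a < 0 by lra.
  rewrite !crossing_up // ler_pdivrMr; last by lra.
  rewrite mulrAC ler_pdivlMr; last by lra.
  have : 0 <= (b' - b) * - a by apply: mulr_ge0; lra.
  have : 0 <= b * (a' - a) by apply: mulr_ge0; lra.
  by lra.
- have a0' : 0 < a' by lra.
  have [b1|b1] := lerP 0 b'; first by rewrite (crossing_nonneg (ltW a0') b1) ?crossing_le1 //; lra.
  have b2 : b < 0 by lra.
  rewrite !crossing_down // ler_pdivrMr; last by lra.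
  rewrite mulrAC ler_pdivlMr; last by lra.
  have : 0 <= (a' - a) * - b by apply: mulr_ge0; lra.
  have : 0 <= a * (b' - b) by apply: mulr_ge0; lra.
  by lra.
- by rewrite (@crossing_nonneg a' b') ?crossing_le1 //; lra.
Qed.

(** By parts the sum is a combination of values of [f] with nonnegative weights, because [m]
    decreases, and the weights add up to [m 0], which is at most 1. *)
Lemma abel_max n (f m : nat -> R) (c : R) : f 0%N = 0 -> 0 <= c ->
  (forall i, (i <= n)%N -> f i <= c) -> (forall i, 0 <= m i <= 1) ->
  (forall i, (i.+1 < n)%N -> m i.+1 <= m i) ->
  \sum_(i < n) (f i.+1 - f i) * m i <= c.
Proof.
move=> f0 c0 fc m01 md.
suff H : forall j, (j < n)%N -> \sum_(i < j.+1) (f i.+1 - f i) * m i <= f j.+1 * m j + c * (m 0%N - m j).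
  case: n fc md H => [|n] fc md H; first by rewrite big_ord0.
  apply: le_trans (H n (ltnSn n)) _.
  have /andP[? ?] := m01 n; have /andP[? ?] := m01 0%N.
  have : f n.+1 * m n <= c * m n by apply: ler_wpM2r => //; exact: fc.
  have : c * m 0%N <= c * 1 by exact: ler_wpM2l.
  by lra.
elim=> [|j IH] jn; first by rewrite big_ord_recr big_ord0 /= f0; lra.
rewrite big_ord_recr /=; have := IH (ltnW jn).
have := md j jn; have := fc j.+1 (ltnW jn).
move: (f j.+2) (f j.+1) (m j.+1) (m j) (m 0%N) => f2 f1 m1 m' m0 fc1 m1m h.
have : 0 <= (c - f1) * (m' - m1) by apply: mulr_ge0; lra.
by lra.
Qed.

Hypothesis tang : forall a b, F a + dF a * (b - a) <= F b.
Hypothesis Gr0 : 0 \in Gr.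

(** Along the segment from [y] at time 0 to [x] at time [t], front [i] adds its jump of [Phi] times
    the fraction [m i] of the segment lying to its right. Sorted fronts make [m] decreasing, and
    [abel_max] bounds the sum by the maximum of [Phi] over the grid. *)
Lemma fpot_free_le st t x y : 0 <= t -> fvalid Gr st -> fsorted st -> fsorted (fadv F dF st t) ->
  fpot (fadv F dF st t) x <= fpot st y + legendre t (x - y).
Proof.
move=> t0 [k0 kn inGr adm] sst ssta; rewrite -lerBlDl /fpot -sumrB /=.
pose Phi p := (x - y) * p - t * (F p - F 0).
pose m i := crossing (y - fy st i) (x - (fy st i + fspeed F dF st i * t)).
rewrite (eq_bigr (fun i : 'I_(fn st) => (Phi (fk st i.+1) - Phi (fk st i)) * m i)); last first.
  move=> i _; rewrite -mulrBr crossingE -/(m i) mulrCA [RHS]mulrC; congr (_ * _).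
  have := slopeE F dF (fk st i) (fk st i.+1); rewrite -/(fspeed F dF st i) /Phi => E.
  rewrite (_ : F (fk st i.+1) = F (fk st i) + fspeed F dF st i * (fk st i.+1 - fk st i)); last by rewrite E addrC subrK.
  by ring.
apply: (@abel_max _ (fun i => Phi (fk st i)) m).
- by rewrite /Phi k0 !subrr !mulr0 subrr.
- exact: legendre_ge0.
- by move=> i lin; apply: legendre_ge; exact: inGr.
- by move=> i; rewrite crossing_ge0 crossing_le1.
- move=> i lin; apply: crossing_homo; first by have := sst i lin; lra.
  by have := ssta i lin; rewrite /=; lra.
Qed.

(** A chord over a gap of the grid lies above [F] inside the gap but supports it at every grid
    point: it is a subgradient of the restricted flux. This is why an upward jump between neighbours
    obeys an exact Hopf-Lax formula. *)
Lemma slope_subgradient_left a b p : a <= b -> p \in Gr -> (forall q, q \in Gr -> ~~ (a < q < b)) ->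
  slope F dF a b * (p - b) <= F p - F b.
Proof.
move=> ab pG gap; rewrite -(slopeE F dF b p) slopeC.
have [pb|bp] := lerP b p.
  by apply: ler_wpM2r; [lra | apply: (slope_monor tang); lra].
have pa : p <= a by rewrite leNgt; apply/negP => h; have := gap p pG; rewrite h bp.
by apply: ler_wnM2r; [lra | apply: (slope_monor tang)].
Qed.

Lemma slope_subgradient_right a b p : a <= b -> p \in Gr -> (forall q, q \in Gr -> ~~ (a < q < b)) ->
  slope F dF a b * (p - a) <= F p - F a.
Proof.
move=> ab pG gap; rewrite -(slopeE F dF a p).
have [pa|ap] := lerP p a.
  by apply: ler_wnM2r; [lra | apply: (slope_monor tang); lra].
have pb : b <= p by rewrite leNgt; apply/negP => h; have := gap p pG; rewrite h ap.
by apply: ler_wpM2r; [lra | apply: (slope_monor tang)].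
Qed.

Lemma admissible_gap a b : admissible_front Gr a b -> a <= b -> forall q, q \in Gr -> ~~ (a < q < b).
Proof.
move=> [ba|[_ gap]] ab q qG; last exact: gap.
by apply/negP => /andP[h1 h2]; move: (lt_trans h1 h2); rewrite ltNge ba.
Qed.

(* a backward characteristic through a point of region r that stays in this region *)
Lemma backward_speed st t x r : 0 <= t -> fvalid Gr st -> fsorted st ->
  (r <= fn st)%N ->
  (forall i, (i < fn st)%N -> (fy st i + fspeed F dF st i * t <= x) = (i < r)%N) ->
  exists c, [/\ forall p, p \in Gr -> c * (p - fk st r) <= F p - F (fk st r),
    (0 < r)%N -> fy st r.-1 <= x - c * t & (r < fn st)%N -> x - c * t <= fy st r].
Proof.
move=> t0 [k0 kn inGr adm] sst rn hr.
pose lgood := (0 < r)%N && (fk st r.-1 <= fk st r).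
pose rgood := (r < fn st)%N && (fk st r <= fk st r.+1).
have kG : fk st r \in Gr by exact: inGr.
have speedl : (0 < r)%N -> fspeed F dF st r.-1 = slope F dF (fk st r.-1) (fk st r).
  by move=> r0; rewrite /fspeed prednK.
have lpos : (0 < r)%N -> fy st r.-1 + fspeed F dF st r.-1 * t <= x.
  by move=> r0; rewrite hr ?prednK // (leq_trans _ rn) // prednK.
have rpos : (r < fn st)%N -> x < fy st r + fspeed F dF st r * t.
  by move=> rn'; rewrite ltNge hr // ltnn.
have ladm : (0 < r)%N -> admissible_front Gr (fk st r.-1) (fk st r).
  by move=> r0; have := adm r.-1; rewrite prednK //; apply.
have lsub : lgood -> forall p, p \in Gr -> fspeed F dF st r.-1 * (p - fk st r) <= F p - F (fk st r).
  move=> /andP[r0 lk] p pG; rewrite speedl //; apply: slope_subgradient_left => //.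
  exact: (admissible_gap (ladm r0)).
have rsub : rgood -> forall p, p \in Gr -> fspeed F dF st r * (p - fk st r) <= F p - F (fk st r).
  move=> /andP[r0 lk] p pG; apply: slope_subgradient_right => //.
  by apply: (admissible_gap _ lk); exact: adm.
have lbad : (0 < r)%N -> ~~ lgood -> fk st r < fk st r.-1.
  by move=> r0; rewrite /lgood r0 /= -ltNge.
have rbad : (r < fn st)%N -> ~~ rgood -> fk st r.+1 < fk st r.
  by move=> r0; rewrite /rgood r0 /= -ltNge.
have suffl c : (0 < r)%N -> c <= fspeed F dF st r.-1 -> fy st r.-1 <= x - c * t.
  move=> r0 cs; have := lpos r0; have : c * t <= fspeed F dF st r.-1 * t by exact: ler_wpM2r.
  by lra.
have suffr c : (r < fn st)%N -> fspeed F dF st r <= c -> x - c * t <= fy st r.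
  move=> r0 cs; have := rpos r0; have : fspeed F dF st r * t <= c * t by exact: ler_wpM2r.
  by lra.
(* A front next to the region is good if its jump goes up: its speed is then a subgradient at
   [fk st r]. With two good fronts the backward line keeps the ratio [mu] in which [x] divides the
   region; with one it follows that front; with none, both sides being shocks or absent, the tangent
   slope does. *)
have [lg|lb] := boolP lgood; have [rg|rb] := boolP rgood.
- have [r0 _] := andP lg; have [r1 _] := andP rg.
  have l1 := lpos r0; have l2 := rpos r1.
  have srt : fy st r.-1 <= fy st r by have := sst r.-1; rewrite prednK //; apply.
  pose yl := fy st r.-1; pose yr := fy st r; pose sl := fspeed F dF st r.-1; pose sr := fspeed F dF st r.
  rewrite -/yl -/yr -/sl -/sr in l1 l2 srt *.
  pose w := (yr + sr * t) - (yl + sl * t).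
  have w0 : 0 < w by rewrite /w; lra.
  pose mu := (x - (yl + sl * t)) / w.
  have mu0 : 0 <= mu by apply: divr_ge0; lra.
  have mu1 : mu <= 1 by rewrite ler_pdivrMr // /w; lra.
  have Ex : x = yl + sl * t + mu * w by rewrite divfK ?gt_eqF //; ring.
  exists ((1 - mu) * sl + mu * sr).
  have Ey : x - ((1 - mu) * sl + mu * sr) * t = yl + mu * (yr - yl) by rewrite Ex /w; ring.
  rewrite Ey; split.
  + move=> p pG; have h1 := lsub lg p pG; have h2 := rsub rg p pG.
    have : (1 - mu) * (sl * (p - fk st r)) <= (1 - mu) * (F p - F (fk st r)) by apply: ler_wpM2l => //; lra.
    have : mu * (sr * (p - fk st r)) <= mu * (F p - F (fk st r)) by apply: ler_wpM2l.
    by lra.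
  + by move=> _; rewrite lerDl mulr_ge0 // subr_ge0.
  + have : mu * (yr - yl) <= 1 * (yr - yl) by apply: ler_wpM2r => //; lra.
    by lra.
- have [r0 lk] := andP lg; exists (fspeed F dF st r.-1); split.
  + exact: lsub.
  + by move=> _; exact: suffl.
  + move=> r1; apply: suffr => //; rewrite speedl // /fspeed slopeC.
    apply: (slope_monol tang); have kr := rbad r1 rb.
    rewrite leNgt; apply/negP => h.
    by have := admissible_gap (ladm r0) lk (inGr r.+1 r1); rewrite h kr.
- have [r1 rk] := andP rg; exists (fspeed F dF st r); split.
  + exact: rsub.
  + move=> r0; apply: suffl => //; rewrite speedl // /fspeed (slopeC _ _ (fk st r.-1)).
    apply: (slope_monor tang); have kl := lbad r0 lb.
    rewrite leNgt; apply/negP => h.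
    have rin : fk st r.-1 \in Gr by apply: inGr; apply: leq_trans rn; exact: leq_pred.
    by have := admissible_gap (adm r r1) rk rin; rewrite h kl.
  + by move=> _; exact: suffr.
- exists (dF (fk st r)); split.
  + by move=> p pG; have := tang (fk st r) p; lra.
  + move=> r0; apply: suffl => //; rewrite speedl // slopeC.
    by have /andP[] := tangent_slope tang (ltW (lbad r0 lb)).
  + move=> r1; apply: suffr => //; rewrite /fspeed slopeC.
    by have /andP[] := tangent_slope tang (ltW (rbad r1 rb)).
Qed.

(** The backward characteristic crosses no front, so the increment of the potential along it is
    exactly [Phi (fk st r)], and the subgradient property makes [fk st r] a maximizer of [Phi]. *)
Lemma fpot_free_ge st t x : 0 <= t -> fvalid Gr st -> fsorted st -> fsorted (fadv F dF st t) ->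
  exists y, fpot st y + legendre t (x - y) <= fpot (fadv F dF st t) x.
Proof.
move=> t0 vst sst ssta; have [k0 kn inGr adm] := vst.
have [|r rn [rc rf]] := @crossed_fronts R (fn st) (fun i => fy st i + fspeed F dF st i * t <= x).
  by move=> i lin; apply: le_trans; exact: ssta.
have [c [c1 c2 c3]] := backward_speed t0 vst sst rn rc.
exists (x - c * t).
have sort_st i j : (i <= j)%N -> (j < fn st)%N -> fy st i <= fy st j.
  move=> ij jn; elim: j ij jn => [|j IH]; first by rewrite leqn0 => /eqP->.
  rewrite leq_eqVlt => /predU1P[-> //|ij] jn.
  by apply: le_trans (IH ij (ltnW jn)) _; exact: sst.
rewrite -lerBrDl /fpot -sumrB /= (_ : x - (x - c * t) = c * t); last by ring.
pose Phi p := c * t * p - t * (F p - F 0).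
rewrite (eq_bigr (fun i : 'I_(fn st) => (Phi (fk st i.+1) - Phi (fk st i)) *
    (fy st i + fspeed F dF st i * t <= x)%R%:R)); last first.
  move=> i _; rewrite -mulrBr rc //.
  have := slopeE F dF (fk st i) (fk st i.+1); rewrite -/(fspeed F dF st i) /Phi => E.
  rewrite (_ : F (fk st i.+1) = F (fk st i) + fspeed F dF st i * (fk st i.+1 - fk st i)); last by rewrite E addrC subrK.
  rewrite !pos_partE; have [ir|ri] := boolP (i < r)%N.
    have r0 : (0 < r)%N by exact: leq_ltn_trans ir.
    have h1 := c2 r0.
    have h2 : fy st i <= fy st r.-1.
      by apply: sort_st; [rewrite -ltnS prednK | rewrite prednK].
    have h3 : fy st i + fspeed F dF st i * t <= x by rewrite rc.
    have -> : 0 <= x - (fy st i + fspeed F dF st i * t) by lra.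
    have -> : 0 <= x - c * t - fy st i by lra.
    by rewrite mulr1; ring.
  have rn' : (r < fn st)%N by apply: leq_ltn_trans (ltn_ord i); rewrite leqNgt.
  have h1 := c3 rn'.
  have h2 : fy st r <= fy st i by apply: sort_st => //; rewrite leqNgt.
  have h3 : x < fy st i + fspeed F dF st i * t by rewrite ltNge rc.
  rewrite mulr0; case: ifP => h4; first lra.
  by case: ifP => h5; [have -> : x - c * t - fy st i = 0 by lra|]; ring.
have P0 : Phi 0 = 0 by rewrite /Phi subrr !mulr0 subrr.
have -> : \sum_(i < fn st) (Phi (fk st i.+1) - Phi (fk st i)) *
   (fy st i + fspeed F dF st i * t <= x)%R%:R = Phi (fk st r).
  have := rf (fun i => Phi (fk st i)); rewrite /= k0 => <-.
  by rewrite P0 add0r.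
have Phi_max p : p \in Gr -> Phi p <= Phi (fk st r).
  move=> pG; have := c1 p pG => h.
  have : t * (c * (p - fk st r)) <= t * (F p - F (fk st r)) by exact: ler_wpM2l.
  by rewrite /Phi; lra.
apply: legendre_le; last by move=> p pG; exact: Phi_max.
by rewrite -P0; exact: Phi_max.
Qed.

Lemma fpot_drop st j x : (j.+1 < fn st)%N -> fy st j = fy st j.+1 ->
  fpot (fdrop st j) x = fpot st x.
Proof. by move=> jn yj; rewrite /fpot (sum_drop (fun l => pos_part (x - l))). Qed.

(** At the collision time the comparison passes through the point [z] of the straight segment from
    [y] to [x]; on proportional pieces of a segment homogeneity lets the two Legendre terms add up
    to the single one. *)
Lemma evo_fpot_le st t st' x y : evo F dF Gr st t st' ->
  fpot st' x <= fpot st y + legendre t (x - y).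
Proof.
move=> h; move: x y; induction h as [st t tp vst sst ssta | st t j t' st' tp vst sst ssta jn yj h IH] => x y.
  exact: fpot_free_le.
have t'0 := evo_ge0 h.
pose tau := t + t'.
(* Collisions may take no time at all, and then the proportions [l] and [l'] are undefined. *)
have [tau0|taupos] := eqVneq tau 0.
  have t00 : t = 0 by rewrite /tau in tau0; lra.
  apply: le_trans (IH x y) _; rewrite fpot_drop //.
  apply: le_trans (lerD (fpot_free_le y y tp vst sst ssta) (lexx _)) _.
  rewrite -addrA lerD2l subrr t00 add0r gerDr; apply: legendre_le => // p _.
  by rewrite !mul0r subrr.
have taup : 0 < tau by rewrite lt_neqAle eq_sym taupos /tau; lra.
pose l := t / tau; pose l' := t' / tau.
have l0 : 0 <= l by apply: divr_ge0 => //; lra.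
have l0' : 0 <= l' by apply: divr_ge0 => //; lra.
have ll : l + l' = 1 by rewrite /l /l' -mulrDl divff.
have El : l * tau = t by rewrite divfK.
have El' : l' * tau = t' by rewrite divfK.
pose z := y + l * (x - y).
apply: le_trans (IH x z) _; rewrite fpot_drop //.
apply: le_trans (lerD (fpot_free_le z y tp vst sst ssta) (lexx _)) _.
rewrite -addrA lerD2l.
have h1 := legendre_scale tau (x - y) l0; have h2 := legendre_scale tau (x - y) l0'.
rewrite El in h1; rewrite El' in h2.
have -> : z - y = l * (x - y) by rewrite /z; ring.
have -> : x - z = l' * (x - y) by rewrite /z (_ : l' = 1 - l); [ring | lra].
apply: le_trans (lerD h1 h2) _.
by rewrite -mulrDl ll mul1r.
Qed.

(** Backward points are concatenated through the collisions; here subadditivity goes in the right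
    direction. *)
Lemma evo_fpot_ge st t st' x : evo F dF Gr st t st' ->
  exists y, fpot st y + legendre t (x - y) <= fpot st' x.
Proof.
move=> h; move: x; induction h as [st t tp vst sst ssta | st t j t' st' tp vst sst ssta jn yj h IH] => x.
  exact: fpot_free_ge.
have [z hz] := IH x; rewrite fpot_drop // in hz.
have [y hy] := fpot_free_ge z tp vst sst ssta.
exists y; apply: le_trans hz; apply: le_trans (lerD hy (lexx _)).
rewrite -addrA lerD2l.
by have := legendre_subadd t t' (z - y) (x - z); rewrite (_ : z - y + (x - z) = x - y) //; ring.
Qed.

End HopfLax.

(** * Variation of a difference of infimal convolutions *)

Section InfConvolutionStability.
Variable R : realType.
Implicit Types x y z th : R.

Definition convexf (f : R -> R) :=
  forall l x y, 0 <= l <= 1 -> f ((1 - l) * x + l * y) <= (1 - l) * f x + l * f y.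

Lemma convexf_exchange (f : R -> R) a d : convexf f -> forall b c, a <= b -> a <= c -> b + c = a + d ->
  f b + f c <= f a + f d.
Proof.
move=> cf b c ab ac E.
have [ad|nad] := eqVneq a d.
  have -> : b = a by lra.
  by have -> : c = d by lra.
have dpos : 0 < d - a by rewrite lt_neqAle eq_sym subr_eq0 eq_sym nad; lra.
pose l := (b - a) / (d - a).
have l0 : 0 <= l by apply: divr_ge0; lra.
have l1 : l <= 1 by rewrite ler_pdivrMr //; lra.
have Eb : b = (1 - l) * a + l * d.
  by have : l * (d - a) = b - a by [rewrite divfK ?gt_eqF]; lra.
have Ec : c = (1 - (1 - l)) * a + (1 - l) * d by lra.
have h1 := cf l a d; have h2 := cf (1 - l) a d.
rewrite -Eb l0 l1 in h1; rewrite -Ec in h2.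
have := h1 isT; have : 0 <= 1 - l <= 1 by apply/andP; split; lra.
move=> /h2; lra.
Qed.

Lemma convexf_away (f : R -> R) z0 : convexf f -> f z0 = 0 -> (forall z, 0 <= f z) ->
  forall a b, (z0 <= a <= b) || (b <= a <= z0) -> f a <= f b.
Proof.
move=> cf f0 fpos a b h.
have [eb|nb] := eqVneq b z0; first by have -> : a = b by case/orP: h => /andP[? ?]; lra.
pose l := (a - z0) / (b - z0).
have bz : b - z0 != 0 by rewrite subr_eq0.
have l01 : 0 <= l <= 1.
  case/orP: h => /andP[h1 h2].
    have p : 0 < b - z0 by rewrite lt_neqAle eq_sym bz; lra.
    by rewrite /l ler_pdivrMr // divr_ge0 ?(ltW p) ?mul1r //; lra.
  have p : 0 < z0 - b by rewrite lt_neqAle eq_sym subr_eq0 eq_sym nb; lra.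
  rewrite /l -mulrNN -invrN !opprB ler_pdivrMr // divr_ge0 ?(ltW p) ?mul1r //; lra.
have Ea : a = (1 - l) * z0 + l * b by have : l * (b - z0) = a - z0 by [rewrite divfK]; lra.
have := cf l z0 b l01; rewrite -Ea f0 mulr0 add0r => /le_trans; apply.
by have := fpos b; case/andP: l01 => l0 l1; nra.
Qed.

Variables (A0 A1 v0 : R -> R) (h zs m : R).
Let B z := A1 z - A0 z.
Hypotheses (cA0 : continuous A0) (cA1 : continuous A1) (cv0 : continuous v0).
Hypotheses (xA0 : convexf A0) (xA1 : convexf A1).
Hypotheses (pA0 : forall z, 0 <= A0 z) (pA1 : forall z, 0 <= A1 z).
Hypotheses (zA0 : A0 zs = 0) (zA1 : A1 zs = 0).
Hypothesis h0 : 0 <= h.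
Hypothesis BL : forall z z', `|B z - B z'| <= h * `|z - z'|.
Hypothesis B0 : B 0 = 0.
Hypothesis v0l : forall y, y <= 0 -> v0 y = 0.
Hypothesis v0r : forall y, 1 <= y -> v0 y = m.

Definition mixA th z := (1 - th) * A0 z + th * A1 z.

Definition argmin th x y := forall y', v0 y + mixA th (x - y) <= v0 y' + mixA th (x - y').
(** Off the unit interval [v0] is constant on either side, so the only point competing there is
    [x - zs], where [A0] and [A1] vanish. Minimizers of this kind keep [B (x - y)] under control: it
    is 0 outside and at most [h] inside. *)
Definition candidate x y := 0 <= y <= 1 \/ y = x - zs.

Lemma mixA_ge0 th z : 0 <= th <= 1 -> 0 <= mixA th z.
Proof.
have := pA0 z; have := pA1 z => ? ? /andP[? ?].
by rewrite /mixA addr_ge0 // mulr_ge0 // subr_ge0.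
Qed.

Lemma mixA_zs th : mixA th zs = 0. Proof. by rewrite /mixA zA0 zA1 !mulr0 addr0. Qed.

Lemma convexf_mixA th : 0 <= th <= 1 -> convexf (mixA th).
Proof.
have := xA0; have := xA1 => c1 c0 /andP[t0 t1] l x y l01.
have h1 : (1 - th) * A0 ((1 - l) * x + l * y) <= (1 - th) * ((1 - l) * A0 x + l * A0 y).
  by apply: ler_wpM2l; [rewrite subr_ge0 | exact: c0].
have h2 : th * A1 ((1 - l) * x + l * y) <= th * ((1 - l) * A1 x + l * A1 y).
  by apply: ler_wpM2l => //; exact: c1.
by rewrite /mixA; lra.
Qed.

Lemma ex_argmin th x : 0 <= th <= 1 -> exists2 y, candidate x y & argmin th x y.
Proof.
move=> th01; have mp := fun z => mixA_ge0 z th01.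
have mono := convexf_away (convexf_mixA th01) (mixA_zs th) mp.
pose f y := v0 y + mixA th (x - y).
have cf : continuous f.
  move=> y; apply: cvgD; first exact: cv0.
  have cs : (fun y : R => x - y) @ y --> x - y.
    by apply: cvgB; [exact: cvg_cst | exact: cvg_id].
  have c0 : A0 (x - r) @[r --> y] --> A0 (x - y).
    by apply: (@continuous_comp _ _ _ (fun y : R => x - y) A0); [exact: cs | exact: cA0].
  have c1 : A1 (x - r) @[r --> y] --> A1 (x - y).
    by apply: (@continuous_comp _ _ _ (fun y : R => x - y) A1); [exact: cs | exact: cA1].
  by apply: cvgD; apply: cvgM => //; exact: cvg_cst.
have [y0 y0in y0min] := @EVT_min R f 0 1 ler01 (continuous_subspaceT cf).
have y01 : 0 <= y0 <= 1 by rewrite in_itv in y0in.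
have inner y' : 0 <= y' <= 1 -> f y0 <= f y' by move=> ?; apply: y0min; rewrite in_itv.
have fout : f (x - zs) = v0 (x - zs).
  by rewrite /f (_ : x - (x - zs) = zs) ?mixA_zs ?addr0 //; ring.
(* On either side of the unit interval, if [x - zs] lies on that side it wins with cost 0; otherwise
   the nearer end wins, since [mixA] grows away from [zs]. *)
have outer y' : ~ (0 <= y' <= 1) -> f y0 <= f y' \/ f (x - zs) <= f y'.
  move=> ny; have [yn|yp] := ltrP y' 0.
    have [xz|xz] := lerP (x - zs) 0.
      right; rewrite fout v0l // /f v0l ?(ltW yn) // add0r; exact: mp.
    left; apply: le_trans (inner 0 _) _; first by rewrite lexx ler01.
    rewrite /f !v0l ?(ltW yn) // !add0r subr0; apply: mono.
    by apply/orP; left; apply/andP; split; lra.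
  have y1 : 1 < y' by rewrite ltNge; apply/negP => hy; apply: ny; rewrite yp.
  have [xz|xz] := lerP 1 (x - zs).
    right; rewrite fout v0r // /f v0r ?(ltW y1) // lerDl; exact: mp.
  left; apply: le_trans (inner 1 _) _; first by rewrite lexx ler01.
  rewrite /f !v0r ?(ltW y1) // lerD2l; apply: mono.
  by apply/orP; right; apply/andP; split; lra.
have [le1|lt1] := lerP (f y0) (f (x - zs)).
  exists y0; first by left.
  move=> y'; have [yin|yout] := pselect (0 <= y' <= 1); first exact: inner.
  by case: (outer y' yout) => // h'; exact: le_trans h'.
exists (x - zs); first by right.
move=> y'; have [yin|yout] := pselect (0 <= y' <= 1); first exact: le_trans (ltW lt1) (inner _ yin).
by case: (outer y' yout) => // h'; exact: le_trans (ltW lt1) h'.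
Qed.

(** If minimizers are in the wrong order, exchanging them does not raise the total cost, because the
    arguments [x - y'] and [x' - y] lie between the other two and have the same sum. *)
Lemma argmin_exchange th x x' y y' : 0 <= th <= 1 -> x <= x' -> y' <= y ->
  argmin th x y -> argmin th x' y' -> argmin th x' y.
Proof.
move=> th01 xx yy my my' z; apply: le_trans (my' z).
have := @convexf_exchange _ (x - y) (x' - y') (convexf_mixA th01) (x - y') (x' - y).
have := my y' => h1 h2.
have : mixA th (x - y') + mixA th (x' - y) <= mixA th (x - y) + mixA th (x' - y') by apply: h2; lra.
by lra.
Qed.

(** If the minimizer found at [x'] lies to the left of [y], then [y] itself is one by exchange. It
    may fail to be a candidate only off the unit interval: beyond 1 it is replaced by [x' - zs],
    below 0 the situation is contradictory. *)
Lemma next_argmin th x x' y : 0 <= th <= 1 -> x <= x' -> candidate x y -> argmin th x y ->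
  exists y', [/\ y <= y', candidate x' y' & argmin th x' y'].
Proof.
move=> th01 xx cy my; have [y' cy' my'] := ex_argmin x' th01.
have [yy|yy] := lerP y y'; first by exists y'.
have my2 := argmin_exchange th01 xx (ltW yy) my my'.
case: cy => [yin|yout]; first by exists y; split => //; left.
have [y1|y1] := lerP y 1; last first.
  have r1 : 1 <= x' - zs by rewrite yout in y1; lra.
  exists (x' - zs); split; [by rewrite yout; lra | by right |].
  move=> z; apply: le_trans (my2 z).
  rewrite (_ : x' - (x' - zs) = zs); last by ring.
  rewrite mixA_zs addr0 !v0r ?(ltW y1) // lerDl; exact: mixA_ge0.
have [y0|y0] := lerP 0 y; first by exists y; split => //; left; rewrite y0.
case: cy' => [/andP[y'0 _]|y'out]; first by move: (lt_trans yy y0); rewrite ltNge y'0.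
by rewrite y'out yout in yy; lra.
Qed.

Lemma monotone_argmins th n (x : nat -> R) : 0 <= th <= 1 ->
  (forall i, (i < n)%N -> x i <= x i.+1) ->
  exists y : nat -> R, (forall i, (i <= n)%N -> candidate (x i) (y i) /\ argmin th (x i) (y i)) /\
    (forall i, (i < n)%N -> y i <= y i.+1).
Proof.
move=> th01; elim: n => [|n IH] xm.
  have [y cy my] := ex_argmin (x 0%N) th01; exists (fun=> y); split=> // i.
  by rewrite leqn0 => /eqP ->.
have [|y [yc ym]] := IH; first by move=> i lin; apply: xm; exact: ltnW.
have [cn mn] := yc n (leqnn n).
have [y' [yy cy' my']] := next_argmin th01 (xm n (ltnSn n)) cn mn.
exists (fun i => if (i <= n)%N then y i else y'); split=> i lin.
  case: (leqP i n) => [|ni]; first exact: yc.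
  by have -> : i = n.+1 by apply/eqP; rewrite eqn_leq lin.
have lin' : (i <= n)%N by [].
rewrite lin'; case: (ltnP i n) => [|ni]; first exact: ym.
by have -> : i = n by apply/eqP; rewrite eqn_leq lin'.
Qed.

(** Pays for the variation of a monotone [y] within the unit interval, plus one unit for crossing
    each end, where [B (x - y)] may jump between 0 and a value of size at most [h]. Its range 3,
    with the range 1 of [x], gives the factor 4. *)
Definition clamp01 y : R := if y < 0 then 0 else if y <= 1 then y + 1 else 3.

Lemma B_step x x' y y' : 0 <= x -> x <= x' -> x' <= 1 -> y <= y' -> candidate x y -> candidate x' y' ->
  `|B (x' - y') - B (x - y)| <= h * ((x' + clamp01 y') - (x + clamp01 y)).
Proof.
have h_ge0 := h0; have Bzs : B zs = 0 by rewrite /B zA0 zA1 subrr.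
have Bin z : - 1 <= z <= 1 -> `|B z| <= h.
  move=> /andP[z1 z2]; have := BL z 0; rewrite B0 !subr0 => /le_trans; apply.
  by rewrite -[leRHS]mulr1; apply: ler_wpM2l => //; rewrite ler_norml; apply/andP; split.
move=> x0 xx x1 yy cy cy'.
have out t r : candidate t r -> ~~ (0 <= r <= 1) -> B (t - r) = 0.
  move=> [-> //|->] _; by rewrite (_ : t - (t - zs) = zs) //; ring.
have bnd c : 1 <= c -> h <= h * c by move=> c1; rewrite -[leLHS]mulr1; exact: ler_wpM2l.
have pos c : 0 <= c -> 0 <= h * c by move=> ?; exact: mulr_ge0.
rewrite /clamp01; case: (ltrP y 0) => y0.
  rewrite (out x y) //; last by rewrite leNgt y0.
  rewrite subr0; case: (ltrP y' 0) => y'0.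
    rewrite (out x' y') //; last by rewrite leNgt y'0.
    by rewrite normr0; apply: pos; lra.
  case: (lerP y' 1) => y'1.
    by apply: le_trans (Bin _ _) (bnd _ _); [apply/andP; split; lra | lra].
  rewrite (out x' y') //; last by rewrite y'0 leNgt y'1.
  by rewrite normr0; apply: pos; lra.
case: (ltrP y' 0) => y'0; first lra.
case: (lerP y 1) => y1; case: (lerP y' 1) => y'1; last 2 first.
- by lra.
- rewrite (out x y) ?(out x' y') //; last 2 first.
  + by rewrite y'0 leNgt y'1.
  + by rewrite y0 leNgt y1.
  by rewrite subrr normr0; apply: pos; lra.
- apply: le_trans (BL _ _) _; apply: ler_wpM2l => //.
  by rewrite ler_norml; apply/andP; split; lra.
rewrite (out x' y') //; last by rewrite y'0 leNgt y'1.
rewrite sub0r normrN; apply: le_trans (Bin _ _) (bnd _ _); [apply/andP; split; lra | lra].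
Qed.

Variables (V0 V1 : R -> R).
Hypothesis V0le : forall x y, V0 x <= v0 y + A0 (x - y).
Hypothesis V0ge : forall x, exists y, v0 y + A0 (x - y) <= V0 x.
Hypothesis V1le : forall x y, V1 x <= v0 y + A1 (x - y).
Hypothesis V1ge : forall x, exists y, v0 y + A1 (x - y) <= V1 x.

Lemma telescope_le n (f : nat -> R) : \sum_(i < n) (f i.+1 - f i) = f n - f 0%N.
Proof. by rewrite -(big_mkord xpredT (fun i => f i.+1 - f i)) telescope_sumr. Qed.

(* Move from A0 to A1 in N steps: one step changes the infimal convolution at x by (A1 - A0)(x - y) / N,
   with y a minimizer, up to an error O(1 / N) in total. *)
Lemma variation_step n (x : nat -> R) N : (0 < N)%N -> (forall i, (i < n)%N -> x i <= x i.+1) ->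
  0 <= x 0%N -> x n <= 1 ->
  \sum_(i < n) `|(V1 (x i.+1) - V0 (x i.+1)) - (V1 (x i) - V0 (x i))| <= 4 * h + n%:R * (4 * h / N%:R).
Proof.
move=> N0 xm x0 xn.
have h_ge0 := h0.
have Np : 0 < N%:R :> R by rewrite ltr0n.
have x01 i : (i <= n)%N -> 0 <= x i <= 1.
  have mono j k : (j <= k)%N -> (k <= n)%N -> x j <= x k.
    elim: k => [|k IH]; first by rewrite leqn0 => /eqP->.
    by rewrite leq_eqVlt => /predU1P[-> //|jk] kn; apply: le_trans (IH jk (ltnW kn)) (xm _ kn).
  move=> lin; rewrite (le_trans x0 (mono 0%N i _ lin)) //=.
  exact: le_trans (mono i n lin _) xn.
pose th k : R := k%:R / N%:R.
have th01 k : (k <= N)%N -> 0 <= th k <= 1.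
  by move=> kN; rewrite /th divr_ge0 ?ler0n //= ler_pdivrMr // mul1r ler_nat.
have [y Hy] : exists y : nat -> nat -> R, forall k, (k <= N)%N ->
    (forall i, (i <= n)%N -> candidate (x i) (y k i) /\ argmin (th k) (x i) (y k i)) /\
    (forall i, (i < n)%N -> y k i <= y k i.+1).
  have : forall k, exists yk : nat -> R, (k <= N)%N ->
    (forall i, (i <= n)%N -> candidate (x i) (yk i) /\ argmin (th k) (x i) (yk i)) /\
    (forall i, (i < n)%N -> yk i <= yk i.+1).
    move=> k; have [kN|kN] := leqP k N; last by exists (fun=> 0).
    have [yk Hk] := monotone_argmins (th01 k kN) xm; by exists yk.
  by move=> /choice[y Hy]; exists y.
pose b k i := B (x i - y k i).
pose V k i := v0 (y k i) + mixA (th k) (x i - y k i).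
have Bb k i : (k <= N)%N -> (i <= n)%N -> `|b k i| <= h.
  move=> kN lin; have [yc _] := Hy k kN; have [[yin|yE] _] := yc i lin; rewrite /b.
    have /andP[? ?] := x01 i lin; have /andP[? ?] := yin.
    have := BL (x i - y k i) 0; rewrite B0 !subr0 => /le_trans; apply.
    by rewrite -[leRHS]mulr1; apply: ler_wpM2l => //; rewrite ler_norml; apply/andP; split; lra.
  by rewrite yE (_ : x i - (x i - zs) = zs) /B ?zA0 ?zA1 ?subrr ?normr0 //; ring.
have mix_step k z : mixA (th k.+1) z = mixA (th k) z + B z / N%:R.
  by rewrite /mixA /th /B -natr1; field; rewrite gt_eqF.
(* Testing one minimum with the minimizer of the other encloses the increment from [k] to [k.+1]
   between [b k.+1 i / N] and [b k i / N]. *)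
have Vup k i : (k < N)%N -> (i <= n)%N -> V k.+1 i <= V k i + b k i / N%:R.
  move=> kN lin; have [yc _] := Hy k.+1 kN; have [_ my] := yc i lin.
  by apply: le_trans (my (y k i)) _; rewrite mix_step addrA.
have Vlo k i : (k < N)%N -> (i <= n)%N -> V k i + b k.+1 i / N%:R <= V k.+1 i.
  move=> kN lin; have [yc _] := Hy k (ltnW kN); have [_ my] := yc i lin.
  by rewrite /V mix_step /b; have := my (y k.+1 i); lra.
have VE0 i : (i <= n)%N -> V 0%N i = V0 (x i).
  move=> lin; have [yc _] := Hy 0%N (leq0n _); have [_ my] := yc i lin.
  have E z : mixA (th 0%N) z = A0 z by rewrite /mixA /th mul0r subr0 mul1r mul0r addr0.
  apply/le_anti/andP; split; last by rewrite /V E; exact: V0le.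
  have [z hz] := V0ge (x i); apply: le_trans hz; rewrite -E; exact: my.
have VE1 i : (i <= n)%N -> V N i = V1 (x i).
  move=> lin; have [yc _] := Hy N (leqnn _); have [_ my] := yc i lin.
  have E z : mixA (th N) z = A1 z by rewrite /mixA /th divff ?gt_eqF // subrr mul0r mul1r add0r.
  apply/le_anti/andP; split; last by rewrite /V E; exact: V1le.
  have [z hz] := V1ge (x i); apply: le_trans hz; rewrite -E; exact: my.
pose S i := \sum_(k < N) b k i / N%:R.
(* The error of the Riemann sum. The two enclosures give [0 <= E i], and after telescoping in [k] at
   most [(b 0 i - b N i) / N]. *)
pose E i := S i - (V1 (x i) - V0 (x i)).
have E0 i : (i <= n)%N -> 0 <= E i.
  move=> lin; rewrite /E subr_ge0 -VE0 // -VE1 // -(telescope_le N (fun k => V k i)).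
  by apply: ler_sum => k _; rewrite lerBlDl; exact: Vup.
have E1 i : (i <= n)%N -> E i <= 2 * h / N%:R.
  move=> lin; rewrite /E.
  have : \sum_(k < N) b k.+1 i / N%:R <= V1 (x i) - V0 (x i).
    rewrite -VE0 // -VE1 // -(telescope_le N (fun k => V k i)).
    by apply: ler_sum => k _; rewrite lerBrDl; exact: Vlo.
  have : S i - \sum_(k < N) b k.+1 i / N%:R = (b 0%N i - b N i) / N%:R.
    transitivity (\sum_(k < N) (b k i - b k.+1 i) / N%:R).
      by rewrite /S -sumrB; apply: eq_bigr => k _; ring.
    rewrite -mulr_suml; congr (_ / _); rewrite -[RHS]opprB -(telescope_le N (fun k => b k i)) -sumrN.
    by apply: eq_bigr => k _; ring.
  have : (b 0%N i - b N i) / N%:R <= 2 * h / N%:R.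
    apply: ler_wpM2r; first by rewrite invr_ge0 ltW.
    have := Bb 0%N i (leq0n _) lin; have := Bb N i (leqnn _) lin.
    by rewrite !ler_norml => /andP[? ?] /andP[? ?]; lra.
  by lra.
apply: (@le_trans _ _ (\sum_(i < n) (`|S i.+1 - S i| + 4 * h / N%:R))).
  apply: ler_sum => i _.
  rewrite (_ : _ - _ - _ = (S i.+1 - S i) - (E i.+1 - E i)); last by rewrite /E; ring.
  apply: le_trans (ler_normB _ _) _; rewrite lerD2l.
  have := E0 i (ltnW (ltn_ord i)); have := E1 i (ltnW (ltn_ord i)).
  have := E0 i.+1 (ltn_ord i); have := E1 i.+1 (ltn_ord i).
  by rewrite ler_norml => *; apply/andP; split; lra.
rewrite big_split /= sumr_const card_ord -[_ *+ n]mulr_natl lerD2r.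
apply: (@le_trans _ _ (\sum_(i < n) \sum_(k < N) `|b k i.+1 - b k i| / N%:R)).
  apply: ler_sum => i _; rewrite /S -sumrB; apply: le_trans (ler_norm_sum _ _ _) _.
  by apply: ler_sum => k _; rewrite -mulrBl normrM [X in _ * X]gtr0_norm ?invr_gt0.
rewrite exchange_big /=.
apply: (@le_trans _ _ (\sum_(k < N) 4 * h / N%:R)); last first.
  by rewrite sumr_const card_ord -[_ *+ N]mulr_natl mulrC divfK ?gt_eqF.
apply: ler_sum => k _; rewrite -mulr_suml; apply: ler_wpM2r; first by rewrite invr_ge0 ltW.
have [yc ym] := Hy k (ltnW (ltn_ord k)).
(* At a fixed interpolation step, monotone minimizers make the right-hand sides of [B_step]
   telescope in [i]. *)
apply: (@le_trans _ _ (\sum_(i < n) h * ((x i.+1 + clamp01 (y k i.+1)) - (x i + clamp01 (y k i))))).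
  apply: ler_sum => i _; have lin := ltn_ord i.
  have /andP[xi0 xi1] := x01 i (ltnW lin); have /andP[xi0' xi1'] := x01 i.+1 lin.
  apply: B_step => //; [exact: xm | exact: ym | exact: (yc i (ltnW lin)).1 | exact: (yc i.+1 lin).1].
rewrite -mulr_sumr (telescope_le n (fun i => x i + clamp01 (y k i))) mulrC.
apply: ler_wpM2r => //.
have cl r : 0 <= clamp01 r <= 3 by rewrite /clamp01; case: (ltrP r 0) => ?; [|case: (lerP r 1) => ?]; apply/andP; split; lra.
have := cl (y k n); have := cl (y k 0%N) => /andP[? ?] /andP[? ?]; lra.
Qed.

Lemma infconv_variation n (x : nat -> R) : (forall i, (i < n)%N -> x i <= x i.+1) ->
  0 <= x 0%N -> x n <= 1 ->
  \sum_(i < n) `|(V1 (x i.+1) - V0 (x i.+1)) - (V1 (x i) - V0 (x i))| <= 4 * h.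
Proof.
move=> xm x0 xn; apply/ler_addgt0Pr => e e0.
have h_ge0 := h0.
have q0 : 0 <= n%:R * (4 * h) / e by rewrite divr_ge0 ?(ltW e0) // !mulr_ge0 ?ler0n.
(* The partition is fixed while the number of interpolation steps grows, so the second term of
   [variation_step] falls below [e]. *)
pose N := (Num.truncn (n%:R * (4 * h) / e)).+1.
have Np : 0 < N%:R :> R by rewrite ltr0n.
apply: le_trans (variation_step (N := N) _ xm x0 xn) _ => //.
rewrite lerD2l mulrA ler_pdivrMr // -ler_pdivrMl // mulrC.
exact/ltW/truncnS_gt.
Qed.
End InfConvolutionStability.

(** * The L^1 norm of a step function as the variation of its primitive *)

Section StepFunctionVariation.
Variable R : realType.
Local Notation mu := (@lebesgue_measure R).

(** On a partition that contains all the discontinuities, the function is constant on each cell, and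
    its integral over a cell is an increment of the primitive. So a single partition realizes the
    norm. *)
Lemma L1_step_function m (c l : nat -> R) (C : R) :
  (forall n (x : nat -> R), (forall i, (i < n)%N -> x i <= x i.+1) -> 0 <= x 0%N -> x n <= 1 ->
     \sum_(i < n) `|\sum_(j < m) c j * pos_part (x i.+1 - l j) -
                    \sum_(j < m) c j * pos_part (x i - l j)| <= C) ->
  (\int[mu]_(x in `]0%R, 1%R[) `|\sum_(j < m) c j * heav (l j) x|%:E <= C%:E)%E.
Proof.
move=> HC.
pose cl (r : R) := Num.max 0 (Num.min r 1).
pose pts := sort <=%R (0 :: 1 :: [seq cl (l j) | j <- iota 0 m]).
(* The default 1 is the largest element of [pts], so [x] is monotone on all indices and stays in the
   unit interval. *)
pose x i := nth 1 pts i.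
have spts : sorted <=%R pts by apply: sort_sorted; exact: le_total.
have mem_pts r : (r \in pts) = (r \in 0 :: 1 :: [seq cl (l j) | j <- iota 0 m]) by rewrite mem_sort.
have cl01 r : 0 <= cl r <= 1 by rewrite /cl le_max lexx /= ge_max ler01 ge_min lexx orbT.
have pts01 r : r \in pts -> 0 <= r <= 1.
  rewrite mem_pts !inE => /or3P[/eqP->|/eqP->|/mapP[j _ ->]] //; rewrite ?lexx ?ler01 //.
have x01 i : 0 <= x i <= 1.
  have [ip|ip] := ltnP i (size pts); first by apply: pts01; exact: mem_nth.
  by rewrite /x nth_default // ler01 lexx.
have xm i : x i <= x i.+1.
  have [ip|ip] := ltnP i.+1 (size pts); last by rewrite [leRHS]/x nth_default //; have /andP[] := x01 i.
  by apply: (sorted_leq_nth le_trans lexx) => //; rewrite inE // ltnW.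
pose n := size pts.
pose g y := \sum_(j < m) c j * heav (l j) y.
pose f y := if 0 <= y < 1 then g y else 0.
have sep j i : (j < m)%N -> l j <= x i \/ x i.+1 <= l j.
  move=> jm.
  have inp : cl (l j) \in pts.
    by rewrite mem_pts !inE; apply/orP; right; apply/orP; right; apply/mapP; exists j => //; rewrite mem_iota.
  have /nthP - /(_ 1)[k ks Ek] := inp.
  have [ki|ik] := leqP k i.
    have h : cl (l j) <= x i.
      rewrite -Ek /x; have [ip|ip] := ltnP i (size pts); last first.
        by rewrite [leRHS]nth_default // Ek; have /andP[] := cl01 (l j).
      by apply: (sorted_leq_nth le_trans lexx) => //; rewrite inE.
    have [l1|l1] := lerP (l j) 1.
      by left; apply: le_trans h; rewrite /cl le_max; apply/orP; right; rewrite le_min lexx.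
    right; apply: le_trans (ltW l1); by have /andP[] := x01 i.+1.
  have h : x i.+1 <= cl (l j).
    rewrite -Ek /x; apply: (sorted_leq_nth le_trans lexx) => //; rewrite inE //.
    exact: leq_ltn_trans ks.
  have [l0|l0] := lerP 0 (l j).
    by right; apply: le_trans h _; rewrite /cl ge_max l0 ge_min lexx.
  left; apply: le_trans (ltW l0) _; by have /andP[] := x01 i.
have gx i y : x i <= y < x i.+1 -> g y = g (x i).
  move=> /andP[y1 y2]; apply: eq_bigr => j _; congr (_ * _); rewrite /heav.
  by have [h|h] := sep j i (ltn_ord j); 
    [rewrite h (le_trans h y1) | rewrite !leNgt (lt_le_trans y2 h) (lt_le_trans (le_lt_trans y1 y2) h)].
have Dg i : \sum_(j < m) c j * pos_part (x i.+1 - l j) - \sum_(j < m) c j * pos_part (x i - l j) =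
   (x i.+1 - x i) * g (x i).
  rewrite /g mulr_sumr -sumrB; apply: eq_bigr => j _; rewrite -mulrBr mulrCA; congr (_ * _).
  have xx := xm i; rewrite !pos_partE /heav; have [h|h] := sep j i (ltn_ord j).
    have -> : 0 <= x i.+1 - l j by lra.
    have -> : 0 <= x i - l j by lra.
    by rewrite h mulr1; ring.
  have [e|ne] := eqVneq (x i) (x i.+1); first by rewrite e !subrr mul0r.
  have lt : x i < l j by apply: lt_le_trans h; rewrite lt_neqAle ne.
  rewrite (_ : (l j <= x i) = false); last by rewrite leNgt lt.
  rewrite mulr0 (_ : (0 <= x i - l j) = false); last by apply/negbTE; rewrite -ltNge; lra.
  by case: ifP => h'; lra.
have mg : measurable_fun setT g.
  by apply: measurable_sum => j; apply: measurable_funM; [exact: measurable_cst | exact: measurable_heav].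
have fE : f = fun y => g y * (heav 0 y - heav 1 y).
  apply/funext => y; rewrite /f /heav; have [y0|y0] := lerP 0 y; have [y1|y1] := ltrP y 1 => /=;
    by [rewrite ?subr0 ?mulr1 | rewrite ?subrr ?mulr0 | lra].
have mf : measurable_fun setT f.
  by rewrite fE; apply: measurable_funM => //; apply: measurable_funB; exact: measurable_heav.
apply: (@le_trans _ _ (L1 f)).
  rewrite /L1 integral_mkcond; apply: ge0_le_integral => //.
  - by move=> y _; rewrite patchE; case: ifP => _ //; rewrite lee_fin.
  - apply/(measurable_restrictT _ _).1 => //; apply/measurable_EFinP.
    by apply: measurableT_comp => //; exact: measurable_funTS.
  - by apply/measurable_EFinP; apply: measurableT_comp.
  move=> y _; rewrite patchE; case: ifPn => [|_]; last by rewrite lee_fin.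
  by rewrite inE /= in_itv /= => /andP[y0 y1]; rewrite /f (ltW y0) y1.
apply: (@le_trans _ _ (\sum_(i < n) `|g (x i)| * (x i.+1 - x i))%R%:E); last first.
  rewrite lee_fin; apply: le_trans (HC n x _ _ _).
  - by apply: ler_sum => i _; rewrite Dg normrM mulrC (ger0_norm (x := _ - _)) // subr_ge0.
  - by move=> i _; exact: xm.
  - by have /andP[] := x01 0%N.
  - by have /andP[] := x01 n.
apply: (@le_L1_sum _ n f (fun i y => `|g (x i)| * (heav (x i) y - heav (x i.+1) y))
   (fun i => `|g (x i)| * (x i.+1 - x i))) => //.
- by move=> i; apply: measurable_funM; [exact: measurable_cst | apply: measurable_funB; exact: measurable_heav].
- move=> y.
  have [yin|yout] := boolP (0 <= y < 1); last first.
    by rewrite /f (negPf yout) normr0; apply: sumr_ge0.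
  (* The cell containing [y] ends at the first partition point beyond [y]. *)
  pose Q := (fun p => y < p)%R.
  have hh : has Q pts.
    by apply/hasP; exists 1; [rewrite mem_pts !inE eqxx orbT | case/andP: yin].
  have fs : (find Q pts < n)%N by rewrite -has_find.
  have yf : y < x (find Q pts) by exact: (nth_find 1 hh).
  have fpos : (0 < find Q pts)%N.
    rewrite lt0n; apply/negP => /eqP E; rewrite E in yf.
    have z0 : x 0%N <= 0.
      have in0 : 0 \in pts by rewrite mem_pts inE eqxx.
      have /nthP - /(_ 1)[k ks Ek] := in0; rewrite -Ek /x.
      by apply: (sorted_leq_nth le_trans lexx) => //; rewrite inE // (leq_ltn_trans _ ks).
    by case/andP: yin => y0 _; move: (le_lt_trans y0 (lt_le_trans yf z0)); rewrite ltxx.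
  pose i := (find Q pts).-1.
  have iE : i.+1 = find Q pts by rewrite /i prednK.
  have ltn_i : (i < n)%N by rewrite (leq_ltn_trans _ fs) // -iE.
  have xiy : x i <= y.
    rewrite leNgt; apply/negP => h.
    have := @before_find _ 1 Q pts i; rewrite -/(x i) /Q h -iE ltnSn => /(_ isT).
    by [].
  have yi : y < x i.+1 by rewrite iE.
  rewrite (bigD1 (Ordinal ltn_i)) //= normrM normr_id /f yin (gx i y) ?xiy ?yi //.
  rewrite /heav xiy (lt_geF yi) subr0 normr1 mulr1 lerDl; exact: sumr_ge0.
- move=> i _; rewrite L1Z; last by apply: measurable_funB; exact: measurable_heav.
  rewrite normr_id EFinM; apply: lee_wpmul2l; first by rewrite lee_fin.
  by rewrite -[X in X%:E](ger0_norm (x := x i.+1 - x i)) ?subr_ge0 //; exact: L1_heavB.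
Qed.

End StepFunctionVariation.

(** * Comparison of two grids *)

Lemma continuous_sum_ord (R : realType) n (f : nat -> R -> R) :
  (forall i, continuous (f i)) -> continuous (fun x => \sum_(i < n) f i x).
Proof.
move=> cf; elim: n => [|n IH] x.
  by rewrite (_ : (fun _ => _) = cst 0); [exact: cvg_cst | apply/funext => y; rewrite big_ord0].
rewrite (_ : (fun _ => _) = (fun x => \sum_(i < n) f i x + f n x)).
  by apply: cvgD; [exact: IH | exact: cf].
by apply/funext => y; rewrite big_ord_recr.
Qed.

Section LegendreFacts.
Variables (R : realType) (F dF : R -> R).

Lemma convexf_legendre (Gr : seq R) t : convexf (legendre F Gr t).
Proof.
move=> l x y /andP[l0 l1].
have h := legendre_subadd F Gr ((1 - l) * t) (l * t) ((1 - l) * x) (l * y).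
rewrite (_ : (1 - l) * t + l * t = t) in h; last by ring.
apply: le_trans h _; apply: lerD; apply: legendre_scale => //; by rewrite subr_ge0.
Qed.

Lemma continuous_legendre (Gr : seq R) t : continuous (legendre F Gr t).
Proof.
rewrite /legendre; elim: Gr => [|p Gr IH] z.
  rewrite (_ : (fun z => _) = cst 0); first exact: cvg_cst.
  by apply/funext => y; rewrite big_nil.
rewrite (_ : (fun z => _) = (fun z : R => z * p - t * (F p - F 0)) \max
    (fun z => \big[Num.max/0]_(q <- Gr) (z * q - t * (F q - F 0)))); last first.
  by apply/funext => y; rewrite big_cons.
apply: continuous_max; last exact: IH.
apply: cvgB; last exact: cvg_cst.
by apply: cvgM; [exact: cvg_id | exact: cvg_cst].
Qed.

Lemma legendre_max (Gr : seq R) t z : 0 \in Gr ->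
  exists2 p, p \in Gr & legendre F Gr t z = z * p - t * (F p - F 0).
Proof.
move=> G0.
have [|[p pG E]] : legendre F Gr t z = 0 \/ exists2 p, p \in Gr & legendre F Gr t z = z * p - t * (F p - F 0).
- rewrite /legendre big_seq.
  apply: (big_ind (fun v => v = 0 \/ exists2 p, p \in Gr & v = z * p - t * (F p - F 0))).
  + by left.
  + by move=> a b ha hb; rewrite maxEle; case: ifP.
  + by move=> p pG; right; exists p.
- by move=> ->; exists 0 => //; rewrite mulr0 subrr mulr0 subrr.
- by exists p.
Qed.

Variables (Gr Gr' : seq R) (h : R).
Hypothesis sconv : strictly_convex F.
Hypothesis sub : {subset Gr <= Gr'}.
Hypothesis G0 : 0 \in Gr.
Hypothesis h0 : 0 <= h.
(* within the range of the finer grid, the coarse grid has no gap longer than h *)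
Hypothesis gaps : forall p p', p \in Gr -> p' \in Gr' -> h < `|p - p'| ->
  exists2 r, r \in Gr & (p < r < p') || (p' < r < p).

(** Otherwise a coarse point [r] lies strictly between the two. By strict convexity its value
    exceeds the mean of those at [p] and [p']; the value at [p'] is at least that at [p], since [p]
    also belongs to the fine grid. Then [r] would beat [p] in the coarse grid. *)
Lemma maximizers_near t z p p' : 0 < t -> p \in Gr -> p' \in Gr' ->
  legendre F Gr t z = z * p - t * (F p - F 0) ->
  legendre F Gr' t z = z * p' - t * (F p' - F 0) -> `|p - p'| <= h.
Proof.
move=> t0 pG p'G E E'; rewrite leNgt; apply/negP => /(gaps pG p'G)[r rG hr].
have pp' : p != p' by apply/eqP => e; move: hr; rewrite e orbb => /andP[h1 h2]; move: (lt_trans h1 h2); rewrite ltxx.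
pose l := (r - p') / (p - p').
have d0 : p - p' != 0 by rewrite subr_eq0.
have l01 : 0 < l < 1.
  case/orP: hr => /andP[h1 h2].
    have dn : 0 < p' - p by lra.
    rewrite /l -mulrNN -invrN !opprB ltr_pdivrMr // divr_gt0 //=; lra.
  have dn : 0 < p - p' by lra.
  by rewrite /l ltr_pdivrMr // divr_gt0 //=; lra.
have Er : r = l * p + (1 - l) * p' by have : l * (p - p') = r - p' by [rewrite divfK]; lra.
have := sconv pp' l01; rewrite -Er => hF.
have := legendre_ge F t z rG; rewrite E => hr1.
have := legendre_ge F t z (sub pG); rewrite E' => hp.
have /andP[l0 l1] := l01.
have : t * F r < t * (l * F p + (1 - l) * F p') by rewrite ltr_pM2l.
have : 0 <= (1 - l) * ((z * p' - t * (F p' - F 0)) - (z * p - t * (F p - F 0))) by apply: mulr_ge0; lra.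
move: hr1; rewrite {1}Er.
by lra.
Qed.

(** Formally the slope of the difference is [q' - q], at most [h] in size. Without derivatives, one
    step gives the extra slope [q b - q a]; over [N] equal steps these increments telescope, so the
    excess is [c / N] in total and disappears. *)
Lemma legendre_diff_lip t z z' : 0 < t ->
  `|(legendre F Gr' t z - legendre F Gr t z) - (legendre F Gr' t z' - legendre F Gr t z')| <= h * `|z - z'|.
Proof.
move=> t0.
pose B z := legendre F Gr' t z - legendre F Gr t z.
have G0' : 0 \in Gr' by exact: sub.
have /choice[q Hq] : forall z, exists p, p \in Gr /\ legendre F Gr t z = z * p - t * (F p - F 0).
  by move=> y; have [p pG E] := legendre_max t y G0; exists p.
have /choice[q' Hq'] : forall z, exists p, p \in Gr' /\ legendre F Gr' t z = z * p - t * (F p - F 0).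
  by move=> y; have [p pG E] := legendre_max t y G0'; exists p.
have near y : `|q y - q' y| <= h.
  by have [g1 e1] := Hq y; have [g2 e2] := Hq' y; exact: (maximizers_near t0 g1 g2 e1 e2).
have q_mono a b : a <= b -> 0 <= (q b - q a) * (b - a).
  move=> ab; have [qa Ea] := Hq a; have [qb Eb] := Hq b.
  have := legendre_ge F t a qb; have := legendre_ge F t b qa; rewrite Ea Eb; lra.
have step a b : a <= b -> `|B b - B a| <= (h + (q b - q a)) * (b - a).
  move=> ab; have [qa Ea] := Hq a; have [qb Eb] := Hq b.
  have [qa' Ea'] := Hq' a; have [qb' Eb'] := Hq' b.
  have u1 := legendre_ge F t a qb; have u2 := legendre_ge F t b qa.
  have u3 := legendre_ge F t a qb'; have u4 := legendre_ge F t b qa'.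
  have := near a; have := near b; rewrite !ler_norml => /andP[n1 n2] /andP[n3 n4].
  have m1 : 0 <= (h + (q b - q' b)) * (b - a) by apply: mulr_ge0; lra.
  have m2 : 0 <= (h - (q a - q' a)) * (b - a) by apply: mulr_ge0; lra.
  have m3 : 0 <= (h - (q b - q' b)) * (b - a) by apply: mulr_ge0; lra.
  have m4 : 0 <= (h + (q a - q' a)) * (b - a) by apply: mulr_ge0; lra.
  rewrite Ea in u1; rewrite Eb in u2; rewrite Ea' in u3; rewrite Eb' in u4.
  rewrite /B Ea Eb Ea' Eb'; apply/andP; split; lra.
wlog zz : z z' / z <= z'.
  move=> H; have [/H//|/ltW/H] := leP z z'.
  by rewrite distrC (distrC z).
rewrite -/(B z) -/(B z') distrC (distrC z) (ger0_norm (x := z' - z)) ?subr_ge0 //.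
apply/ler_addgt0Pr => e e0.
pose c := (q z' - q z) * (z' - z).
have c0 : 0 <= c := q_mono _ _ zz.
have ce : 0 <= c / e by rewrite divr_ge0 // ltW.
pose N := (Num.truncn (c / e)).+1.
have Np : 0 < N%:R :> R by rewrite ltr0n.
have cN : c / N%:R <= e.
  by rewrite ler_pdivrMr // -ler_pdivrMl // mulrC; exact/ltW/truncnS_gt.
pose y i : R := z + (z' - z) * (i%:R / N%:R).
have yS i : y i.+1 - y i = (z' - z) / N%:R by rewrite /y -natr1; ring.
have ym i : y i <= y i.+1 by rewrite -subr_ge0 yS divr_ge0 ?subr_ge0 // ltW.
have y0 : y 0%N = z by rewrite /y mul0r mulr0 addr0.
have yN : y N = z' by rewrite /y divff ?gt_eqF // mulr1 addrC subrK.
have -> : B z' - B z = \sum_(i < N) (B (y i.+1) - B (y i)).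
  by rewrite (telescope_le N (fun i => B (y i))) y0 yN.
apply: le_trans (ler_norm_sum _ _ _) _.
apply: (@le_trans _ _ (\sum_(i < N) (h + (q (y i.+1) - q (y i))) * ((z' - z) / N%:R))).
  by apply: ler_sum => i _; rewrite -(yS i); apply: step; exact: ym.
rewrite -mulr_suml big_split /= sumr_const card_ord (telescope_le N (fun i => q (y i))) y0 yN.
rewrite mulrDl -[_ *+ N]mulr_natl.
have -> : N%:R * h * ((z' - z) / N%:R) = h * (z' - z) by field; rewrite gt_eqF.
by rewrite lerD2l mulrA.
Qed.

End LegendreFacts.

Section CoarseFine.
Variables (R : realType) (F dF : R -> R) (Gr Gr' : seq R) (h pmin : R).
Local Notation mu := (@lebesgue_measure R).
Hypothesis sconv : strictly_convex F.
Hypothesis tang : forall a b, F a + dF a * (b - a) <= F b.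
Hypothesis sub : {subset Gr <= Gr'}.
Hypothesis G0 : 0 \in Gr.
Hypothesis h0 : 0 <= h.
Hypothesis gaps : forall p p', p \in Gr -> p' \in Gr' -> h < `|p - p'| ->
  exists2 r, r \in Gr & (p < r < p') || (p' < r < p).
Hypothesis pminG : pmin \in Gr.
Hypothesis pmin_le : forall p, p \in Gr' -> F pmin <= F p.

(** [t * dF 0] is the displacement of the characteristic of the value 0, and the tangent to [F] at 0
    makes every term of the maximum nonpositive. *)
Lemma legendre_zs G t : 0 <= t -> legendre F G t (t * dF 0) = 0.
Proof.
move=> t0; apply/le_anti; rewrite legendre_ge0 andbT; apply: legendre_le => // p _.
have := tang 0 p; rewrite subr0 => hp.
have : t * (F 0 + dF 0 * p) <= t * F p by exact: ler_wpM2l.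
by lra.
Qed.

Lemma legendre_at0 G t : 0 <= t -> pmin \in G -> {subset G <= Gr'} ->
  legendre F G t 0 = - t * (F pmin - F 0).
Proof.
move=> t0 pG sG; apply/le_anti/andP; split.
  apply: legendre_le.
    have : t * (F pmin - F 0) <= t * 0 by apply: ler_wpM2l => //; rewrite subr_le0 pmin_le ?sub.
    by lra.
  move=> p pG'; have : t * F pmin <= t * F p by apply: ler_wpM2l => //; exact/pmin_le/sG.
  by lra.
by have := legendre_ge F t 0 pG; lra.
Qed.

Lemma fpot_right (st : fstate R) x : (forall i, (i < fn st)%N -> fy st i <= 1) -> fk st 0%N = 0 -> fk st (fn st) = 0 ->
  1 <= x -> fpot st x = fpot st 1.
Proof.
move=> y1 k0 kn x1; apply/eqP; rewrite -subr_eq0 /fpot -sumrB; apply/eqP.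
rewrite (eq_bigr (fun i : 'I_(fn st) => (fk st i.+1 - fk st i) * (x - 1))).
  by rewrite -mulr_suml (telescope_le (fn st) (fk st)) k0 kn subrr mul0r.
move=> i _; rewrite -mulrBr; congr (_ * _); have := y1 i (ltn_ord i) => hy.
rewrite !pos_partE; have -> : 0 <= x - fy st i by lra.
have -> : 0 <= 1 - fy st i by lra.
by ring.
Qed.

Lemma coarse_fine st st' t w w' : 0 < t ->
  evo F dF Gr st t w -> evo F dF Gr' st' t w' ->
  (forall i, (i < fn st)%N -> 0 <= fy st i <= 1) ->
  (forall x, fpot st x = fpot st' x) ->
  (\int[mu]_(x in `]0%R, 1%R[) `|fprofile w' x - fprofile w x|%:E <= (4 * h)%:E)%E.
Proof.
move=> t0 ev ev' y01 Epot.
have G0' : 0 \in Gr' by exact: sub.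
have t0' := ltW t0.
have [[k0 kn _ _] _] := evo_valid ev.
(* The fronts of both profiles are concatenated, the second ones with opposite sign, so that the
   difference is a single step function and its primitive the difference of the potentials. *)
pose m := (fn w' + fn w)%N.
pose c i := if (i < fn w')%N then fk w' i.+1 - fk w' i else - (fk w (i - fn w').+1 - fk w (i - fn w')).
pose l i := if (i < fn w')%N then fy w' i else fy w (i - fn w').
have comb (f : R -> R) : \sum_(j < m) c j * f (l j) =
   \sum_(j < fn w') (fk w' j.+1 - fk w' j) * f (fy w' j) - \sum_(j < fn w) (fk w j.+1 - fk w j) * f (fy w j).
  rewrite big_split_ord /=; congr (_ + _).
    by apply: eq_bigr => i _; rewrite /c /l /= ltn_ord.
  rewrite -sumrN; apply: eq_bigr => i _.
  by rewrite /c /l /= ltnNge leq_addr /= addKn mulNr.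
have -> : (\int[mu]_(x in `]0%R, 1%R[) `|fprofile w' x - fprofile w x|%:E =
    \int[mu]_(x in `]0%R, 1%R[) `|\sum_(j < m) c j * heav (l j) x|%:E)%E.
  by apply: eq_integral => x _; rewrite (comb (fun r => heav r x)).
apply: L1_step_function => n x xm x0 xn.
under eq_bigr do rewrite (comb (fun r => pos_part (_ - r))) (comb (fun r => pos_part (_ - r))).
have cpot : continuous (fpot st).
  apply: (@continuous_sum_ord _ _ (fun i y => (fk st i.+1 - fk st i) * pos_part (y - fy st i))) => i y.
  apply: cvgM; first exact: cvg_cst.
  apply: (@continuous_comp _ _ _ (fun y : R => y - fy st i) (@pos_part R)).
    by apply: cvgB; [exact: cvg_id | exact: cvg_cst].
  exact: continuous_pos_part.
apply: (@infconv_variation _ (legendre F Gr t) (legendre F Gr' t) (fpot st) h (t * dF 0) (fpot st 1)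
  _ _ cpot _ _ _ _ _ _ h0 _ _ _ _ (fpot w) (fpot w') _ _ _ _ n x xm x0 xn).
- exact: continuous_legendre.
- exact: continuous_legendre.
- exact: convexf_legendre.
- exact: convexf_legendre.
- by move=> z; exact: legendre_ge0.
- by move=> z; exact: legendre_ge0.
- exact: legendre_zs.
- exact: legendre_zs.
- by move=> z z'; exact: legendre_diff_lip.
- rewrite !legendre_at0 ?subrr //; exact: sub.
- move=> y yn; rewrite /fpot big1 // => i _; rewrite pos_partE.
  have /andP[y0 _] := y01 i (ltn_ord i).
  case: ifP => hy; rewrite ?mulr0 // (_ : y - fy st i = 0) ?mulr0 //; lra.
- move=> y y1; apply: fpot_right => // i lin; by have /andP[] := y01 i lin.
- by move=> y z; apply: evo_fpot_le ev.
- by move=> y; exact: (evo_fpot_ge tang G0 y ev).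
- by move=> y z; rewrite Epot; apply: evo_fpot_le ev'.
- by move=> y; have [z hz] := evo_fpot_ge tang G0' y ev'; exists z; rewrite Epot.
Qed.
End CoarseFine.

(** * Existence of the front tracking evolution *)

Section Existence.
Variables (R : realType) (F dF : R -> R) (Gr : seq R).
Hypothesis tang : forall a b, F a + dF a * (b - a) <= F b.

(* a jump of height [dj] that leaves the line of slope [ds] through ([dx0], [dtau]) at
   time [dtau] in order to follow the line of slope [ds'] *)
Record dipole := Dipole { dj : R; dtau : R; dx0 : R; ds : R; ds' : R }.

Definition dip (d : dipole) (t x : R) : R :=
  dj d * ((dtau d <= t)%R%:R * (heav (dx0 d + ds' d * (t - dtau d)) x - heav (dx0 d + ds d * (t - dtau d)) x)).

Definition dshift (r : R) (d : dipole) := Dipole (dj d) (r + dtau d) (dx0 d) (ds d) (ds' d).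

Lemma dip_shift r d t x : dip (dshift r d) t x = dip d (t - r) x.
Proof. by rewrite /dip /= lerBrDl opprD addrA. Qed.

(** A collision always produces a shock: if [a < c], monotone slopes would make the left front no
    faster than the right one. *)
Lemma merge_admissible a b c : slope F dF b c < slope F dF a b -> admissible_front Gr a c.
Proof.
move=> h; left; rewrite leNgt; apply/negP => ac; move: h.
by rewrite (slopeC F dF a b) ltNge (slope_monor tang) // ltW.
Qed.

Lemma ex_min_nat n (P : nat -> bool) (f : nat -> R) : (exists2 i, (i < n)%N & P i) ->
  exists j, [/\ (j < n)%N, P j & forall i, (i < n)%N -> P i -> f j <= f i].
Proof.
elim: n => [[] //|n IH] [i0 i0n Pi0].
have [ex|nex] := pselect (exists2 i, (i < n)%N & P i).
  have [j [jn Pj jmin]] := IH ex.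
  have [/andP[Pn lt]|nlt] := boolP (P n && (f n < f j)).
    exists n; split => // i; rewrite ltnS leq_eqVlt => /predU1P[-> //|lin] Pi.
    by apply: le_trans (ltW lt) _; exact: jmin.
  exists j; split => //; first exact: ltnW.
  move=> i; rewrite ltnS leq_eqVlt => /predU1P[-> Pn|]; last exact: jmin.
  by move: nlt; rewrite Pn /= -leNgt.
have i0E : i0 = n.
  by move: i0n; rewrite ltnS leq_eqVlt => /predU1P[//|lt]; case: nex; exists i0.
exists n; rewrite -i0E; split => // i; rewrite i0E ltnS leq_eqVlt => /predU1P[-> //|lt Pi].
by case: nex; exists i.
Qed.

Lemma bump_neq j i : i != j -> bump j i = bump j.+1 i.
Proof. by move=> ij; rewrite /bump [in RHS]ltn_neqAle eq_sym ij. Qed.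

Lemma drop_valid st j : fvalid Gr st -> (j.+1 < fn st)%N ->
  fspeed F dF st j.+1 < fspeed F dF st j -> fvalid Gr (fdrop st j).
Proof.
case: st => [n y k] [/= k0 kn inGr adm] jn sp.
have [m En] : exists m, n = m.+1 by exists n.-1; rewrite prednK // (leq_ltn_trans _ jn).
rewrite En in kn inGr adm jn *; split => /=.
- by rewrite /bump.
- by have jm : (j < m)%N by []; rewrite /bump jm.
- move=> i im; apply: inGr; rewrite /bump; case: (j.+1 <= i)%N => //=; exact: leqW.
- move=> i im; have [->|ij] := eqVneq i j.
    have -> : bump j.+1 j = j by rewrite /bump ltnn.
    rewrite /bump leqnn /= add1n; apply: merge_admissible sp.
  rewrite bumpS (bump_neq ij); apply: adm.
  by rewrite /bump; case: (j.+1 <= i)%N => //=; exact: leqW.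
Qed.

Lemma drop_sorted (st : fstate R) j : (j.+1 < fn st)%N -> fsorted st -> fsorted (fdrop st j).
Proof.
case: st => [[//|m] y k] /= jm sst i /= im.
have [E|ij] := eqVneq i j.
  have -> : bump j.+1 i = i by rewrite /bump E ltnn.
  rewrite E /bump leqnn /= add1n; rewrite E in im.
  by apply: le_trans (sst j _) (sst j.+1 _) => //=; exact: ltnW.
rewrite bumpS (bump_neq ij); apply: sst => /=.
by rewrite /bump; case: (j.+1 <= i)%N => //=; exact: ltnW.
Qed.

(** The unmerged profile is continued along its old lines past the collision, and the merged one is
    obtained by moving each of the two jumps from its old line to the new one. A collision thus only
    adds terms and alters none. *)
Lemma profile_drop_free st j x r : (j.+1 < fn st)%N -> fy st j = fy st j.+1 ->
  let snew := slope F dF (fk st j) (fk st j.+2) in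
  fprofile (fadv F dF (fdrop st j) r) x = fprofile (fadv F dF st r) x
   + (fk st j.+1 - fk st j) * (heav (fy st j + snew * r) x - heav (fy st j + fspeed F dF st j * r) x)
   + (fk st j.+2 - fk st j.+1) * (heav (fy st j + snew * r) x - heav (fy st j + fspeed F dF st j.+1 * r) x).
Proof.
case: st => [[//|m] y k] /= jm yj; rewrite /fprofile /pwc /=.
set g := fun i => (k i.+1 - k i) * heav (y i + fspeed F dF (FState m.+1 y k) i * r) x.
rewrite [in RHS](bigD1_ord (Ordinal (jm : j.+1 < m.+1)%N)) //=.
have jm' : (j < m)%N by [].
rewrite (bigD1 (Ordinal jm')) //= [in RHS](bigD1 (Ordinal jm')) //=.
have -> : bump j.+1 j = j by rewrite /bump ltnn.
have Ej1 : bump j.+1 j.+1 = j.+2 by rewrite /bump leqnn.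
rewrite /fspeed /= Ej1 -yj.
have -> : bump j.+1 j = j by rewrite /bump ltnn.
rewrite [X in _ + X = _](_ : _ = \sum_(i < m | i != Ordinal jm')
  (k (bump j.+1 i).+1 - k (bump j.+1 i)) *
     heav (y (bump j.+1 i) + slope F dF (k (bump j.+1 i)) (k (bump j.+1 i).+1) * r) x); last first.
  by apply: eq_bigr => i ij; rewrite bumpS bump_neq //.
by ring.
Qed.

Lemma dip_before d t x : t < dtau d -> dip d t x = 0.
Proof. by move=> h; rewrite /dip leNgt h /= mul0r mulr0. Qed.

(** Induction on the number of fronts up to the first collision, which removes one front and adds
    two dipoles. The later dipoles are shifted by the collision time, so all are silent before
    it. *)
Lemma ex_evolution st : fvalid Gr st -> fsorted st ->
  exists S : R -> fstate R, exists D : seq dipole,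
    [/\ forall t : R, 0 <= t -> evo F dF Gr st t (S t),
        forall t x : R, 0 <= t -> fprofile (S t) x = fprofile (fadv F dF st t) x + \sum_(d <- D) dip d t x,
        (size D <= 2 * fn st)%N & forall d, List.In d D -> 0 <= dtau d].
Proof.
have [n] := ubnP (fn st); elim: n st => // n IH st stn vst sst.
have [[i0 i0n conv0]|noconv] := pselect (exists2 i, (i < fn st)%N &
   (i.+1 < fn st)%N && (fspeed F dF st i.+1 < fspeed F dF st i)); last first.
  exists (fun t => fadv F dF st t), [::]; split => //; last first.
    by move=> t x t0; rewrite big_nil addr0.
  move=> t t0; apply: evo_free => // i lin /=.
  apply: lerD; first exact: sst.
  apply: ler_wpM2r => //; rewrite leNgt; apply/negP => h; apply: noconv.
  by exists i; [exact: ltnW | rewrite lin h].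
(* The meeting time of neighbouring fronts of which the left one is faster; the smallest of these is
   the first collision. *)
pose tc i := (fy st i.+1 - fy st i) / (fspeed F dF st i - fspeed F dF st i.+1).
have [|j [_ /andP[jn sj] jmin]] := @ex_min_nat (fn st)
  (fun i => (i.+1 < fn st)%N && (fspeed F dF st i.+1 < fspeed F dF st i)) tc; first by exists i0.
have sj' : 0 < fspeed F dF st j - fspeed F dF st j.+1 by rewrite subr_gt0.
have tau0 : 0 <= tc j by apply: divr_ge0; [rewrite subr_ge0; exact: sst | exact: ltW].
have sorted_until (t : R) : 0 <= t -> t <= tc j -> fsorted (fadv F dF st t).
  move=> t0 tt i lin /=.
  have [h|h] := ltrP (fspeed F dF st i.+1) (fspeed F dF st i).
    have ti : t <= tc i by apply: le_trans tt (jmin i _ _); [exact: ltnW | rewrite lin h].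
    rewrite ler_pdivlMr ?subr_gt0 // in ti.
    by lra.
  by apply: lerD; [exact: sst | exact: ler_wpM2r].
have coll : fy (fadv F dF st (tc j)) j = fy (fadv F dF st (tc j)) j.+1.
  rewrite /=; have : tc j * (fspeed F dF st j - fspeed F dF st j.+1) = fy st j.+1 - fy st j.
    by rewrite divfK // gt_eqF.
  by lra.
pose sta := fadv F dF st (tc j).
have vsta : fvalid Gr sta by case: vst.
have ssta : fsorted sta := sorted_until _ tau0 (lexx _).
have v1 : fvalid Gr (fdrop sta j) by apply: drop_valid.
have s1 : fsorted (fdrop sta j) by apply: drop_sorted.
have n1 : (fn (fdrop sta j) < n)%N.
  by move: stn jn; rewrite /=; case: (fn st) => [//|m] /=; rewrite ltnS => *.
have [S1 [D1 [ev1 pr1 sz1 ge1]]] := IH _ n1 v1 s1.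
pose snew := slope F dF (fk st j) (fk st j.+2).
pose d1 := Dipole (fk st j.+1 - fk st j) (tc j) (fy sta j) (fspeed F dF st j) snew.
pose d2 := Dipole (fk st j.+2 - fk st j.+1) (tc j) (fy sta j) (fspeed F dF st j.+1) snew.
exists (fun t => if t < tc j then fadv F dF st t else S1 (t - tc j)),
   (d1 :: d2 :: [seq dshift (tc j) d | d <- D1]); split.
- move=> t t0; case: ltrP => tt; first by apply: evo_free => //; apply: sorted_until => //; exact: ltW.
  have r0 : 0 <= t - tc j by rewrite subr_ge0.
  have := evo_merge tau0 vst sst ssta jn coll (ev1 _ r0).
  by rewrite addrC subrK.
- move=> t x t0; rewrite !big_cons big_map; case: ltrP => tt.
    rewrite (@dip_before d1) // (@dip_before d2) // !add0r.
    rewrite (_ : \sum_(d <- D1) _ = 0) ?addr0 //.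
    elim: (D1) ge1 => [|d D' IHD] ge; first by rewrite big_nil.
    rewrite big_cons IHD ?addr0; last by move=> d' d'D; apply: ge; right.
    rewrite dip_before //=; have := ge d (or_introl erefl); lra.
  rewrite pr1 ?subr_ge0 // (@profile_drop_free sta j _ _ jn coll).
  under [X in _ + X = _]eq_bigr do rewrite -dip_shift.
  rewrite !addrA; congr (_ + _).
  have -> : fprofile (fadv F dF sta (t - tc j)) x = fprofile (fadv F dF st t) x.
    rewrite /fprofile /pwc; apply: eq_bigr => i _ /=; congr (_ * heav _ _); rewrite -[fspeed F dF sta i]/(fspeed F dF st i).
    by ring.
  by rewrite /dip /= tt !mul1r.
- rewrite /= size_map; move: sz1 jn; rewrite /=; case: (fn st) => [//|m] /=; lia.
- move=> d /= [<- //|[<- //|]]; rewrite List.in_map_iff => -[d' [<- /ge1 h]] /=.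
  exact: addr_ge0.
Qed.
End Existence.

(** * Quantization of the initial value *)

Section FrontLists.
Variable R : realType.
Implicit Types (L : seq (R * R)) (Gr s : seq R) (a b x : R).

Definition steps Gr a b : seq R :=
  if b <= a then [:: b] else sort <=%O (undup [seq p <- Gr | a < p <= b]).

(* [L] lists the jumps as (position, value on the right) *)
Fixpoint fronts Gr a L : seq (R * R) :=
  if L is (x, b) :: L' then [seq (x, v) | v <- steps Gr a b] ++ fronts Gr b L' else [::].

Definition fstate_of L : fstate R :=
  FState (size L) (fun i => (nth (0, 0) L i).1) (fun i => nth 0 (0 :: [seq q.2 | q <- L]) i).

(** Sums over the fronts as a recursion on the list, with [a] the value on the left, so that
    statements on [fstate_of] are proved by induction on the jumps. *)
Fixpoint jump_sum (f : R -> R -> R -> R) a L : R :=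
  if L is (x, b) :: L' then f a b x + jump_sum f b L' else 0.

Lemma jump_sumE f L a :
  \sum_(i < size L) f (nth 0 (a :: [seq q.2 | q <- L]) i) (nth 0 (a :: [seq q.2 | q <- L]) i.+1)
     (nth (0, 0) L i).1 = jump_sum f a L.
Proof.
elim: L a => [|[x b] L IH] a; first by rewrite big_ord0.
by rewrite big_ord_recl /= -IH.
Qed.

Lemma jump_sum_cat f a L1 L2 :
  jump_sum f a (L1 ++ L2) = jump_sum f a L1 + jump_sum f (last a [seq q.2 | q <- L1]) L2.
Proof.
elim: L1 a => [|[x b] L1 IH] a /=; first by rewrite add0r.
by rewrite IH addrA.
Qed.

Lemma steps_up Gr a b : a < b -> [/\ path <%O a (steps Gr a b),
  forall p, (p \in steps Gr a b) = (p \in Gr) && (a < p <= b) & (b \in Gr -> last a (steps Gr a b) = b)].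
Proof.
move=> ab; rewrite /steps leNgt ab /=; set s := sort _ _.
have memE p : (p \in s) = (p \in Gr) && (a < p <= b).
  by rewrite mem_sort mem_undup mem_filter andbC.
have ss : sorted <%O s by rewrite lt_sorted_uniq_le sort_le_sorted sort_uniq undup_uniq.
have ps : path <%O a s.
  rewrite path_sortedE; last exact: lt_trans.
  by rewrite ss andbT; apply/allP => p; rewrite memE => /and3P[].
split => // bGr.
have bs : b \in s by rewrite memE bGr ab lexx.
move: ps memE; clear ss; clearbody s; case/splitPr: bs => s1 s2.
rewrite cat_path => /andP[_ /= /andP[_ pb]] memE; rewrite last_cat /=.
have: last b s2 \in b :: s2 by exact: mem_last.
rewrite inE => /predU1P[//|ls].
have : (last b s2) \in s1 ++ b :: s2 by rewrite mem_cat inE ls !orbT.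
rewrite memE => /and3P[_ _ lb].
move: pb; rewrite path_sortedE; last exact: lt_trans.
by move=> /andP[/allP /(_ _ ls)]; rewrite ltNge lb.
Qed.

Lemma last_steps Gr a b : b \in Gr -> last a (steps Gr a b) = b.
Proof.
move=> bG; have [ba|ab] := lerP b a; first by rewrite /steps ba.
by have [_ _ ->] := steps_up Gr ab.
Qed.

Lemma jump_sum_steps Gr a b x (g : R -> R) : b \in Gr ->
  jump_sum (fun a b x => (b - a) * g x) a [seq (x, v) | v <- steps Gr a b] = (b - a) * g x.
Proof.
move=> bG; rewrite -[in RHS](last_steps a bG).
move: (steps Gr a b) {bG} => s; elim: s a => [|v s IH] a /=; first by rewrite subrr mul0r.
by rewrite IH -mulrDl; congr (_ * _); rewrite addrC addrA subrK.
Qed.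

Lemma jump_norm_steps Gr a b x : b \in Gr ->
  jump_sum (fun a b _ => `|b - a|) a [seq (x, v) | v <- steps Gr a b] = `|b - a|.
Proof.
move=> bG; have [ba|ab] := leP b a; first by rewrite /steps ba /= addr0.
have [+ _ lE] := steps_up Gr ab.
move=> ps.
have H : forall s a0, path <%O a0 s ->
    jump_sum (fun a b _ => `|b - a|) a0 [seq (x, v) | v <- s] = last a0 s - a0.
  elim=> [|v s IH] a0 /=; first by rewrite subrr.
  move=> /andP[av /IH ->]; rewrite gtr0_norm ?subr_gt0 //; ring.
by rewrite H // lE // gtr0_norm // subr_gt0.
Qed.

Lemma jump_sum_fronts Gr a L (g : R -> R) : {subset [seq q.2 | q <- L] <= Gr} ->
  jump_sum (fun a b x => (b - a) * g x) a (fronts Gr a L) =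
  jump_sum (fun a b x => (b - a) * g x) a L.
Proof.
elim: L a => [|[x b] L IH] a //= sub; have bG : b \in Gr by apply: sub; rewrite inE eqxx.
rewrite jump_sum_cat jump_sum_steps // -map_comp (map_id (steps Gr a b)) last_steps // IH //.
by move=> p pL; apply: sub; rewrite inE pL orbT.
Qed.

Lemma jump_norm_fronts Gr a L : {subset [seq q.2 | q <- L] <= Gr} ->
  jump_sum (fun a b _ => `|b - a|) a (fronts Gr a L) = jump_sum (fun a b _ => `|b - a|) a L.
Proof.
elim: L a => [|[x b] L IH] a //= sub; have bG : b \in Gr by apply: sub; rewrite inE eqxx.
rewrite jump_sum_cat jump_norm_steps // -map_comp (map_id (steps Gr a b)) last_steps // IH //.
by move=> p pL; apply: sub; rewrite inE pL orbT.
Qed.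

Lemma last_fronts Gr a L : {subset [seq q.2 | q <- L] <= Gr} ->
  last a [seq q.2 | q <- fronts Gr a L] = last a [seq q.2 | q <- L].
Proof.
elim: L a => [|[x b] L IH] a //= sub; have bG : b \in Gr by apply: sub; rewrite inE eqxx.
rewrite map_cat last_cat -map_comp (map_id (steps Gr a b)) last_steps // IH //.
by move=> p pL; apply: sub; rewrite inE pL orbT.
Qed.

Lemma fronts_values Gr a L : {subset [seq q.2 | q <- L] <= Gr} ->
  {subset [seq q.2 | q <- fronts Gr a L] <= Gr}.
Proof.
elim: L a => [|[x b] L IH] a //= sub; have bG : b \in Gr by apply: sub; rewrite inE eqxx.
move=> p; rewrite map_cat mem_cat -map_comp (map_id (steps Gr a b)) => /orP[|]; last first.
  by apply: IH => q qL; apply: sub; rewrite inE qL orbT.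
have [ba|ab] := leP b a; first by rewrite /steps ba inE => /eqP ->.
by have [_ -> _] := steps_up Gr ab => /andP[].
Qed.

Lemma fronts_positions Gr a L q : q \in fronts Gr a L -> q.1 \in [seq q.1 | q <- L].
Proof.
elim: L a => [|[x b] L IH] a //=; rewrite mem_cat => /orP[/mapP[v _ ->]|/IH h].
  by rewrite inE eqxx.
by rewrite inE h orbT.
Qed.

Lemma fronts_sorted Gr a L x0 : path <=%O x0 [seq q.1 | q <- L] ->
  path <=%O x0 [seq q.1 | q <- fronts Gr a L].
Proof.
elim: L a x0 => [|[x b] L IH] a x0 //= /andP[x0x /(IH b) px].
rewrite map_cat cat_path -map_comp.
elim: (steps Gr a b) x0 x0x => [|v s IHs] x0 x0x /=; last by rewrite x0x IHs.
by apply: path_le px; [exact: le_trans|].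
Qed.

Lemma fronts_admissible Gr a L i : {subset [seq q.2 | q <- L] <= Gr} ->
  (i < size (fronts Gr a L))%N ->
  admissible_front Gr (nth 0 (a :: [seq q.2 | q <- fronts Gr a L]) i)
    (nth 0 (a :: [seq q.2 | q <- fronts Gr a L]) i.+1).
Proof.
elim: L a i => [|[x b] L IH] a i //= sub; have bG : b \in Gr by apply: sub; rewrite inE eqxx.
have {}IH := IH b _ (fun p pL => sub p (mem_behead (s := b :: _) pL)).
have tail i' : (i' < size (fronts Gr b L))%N ->
   forall s a', last a' s = b ->
  admissible_front Gr (nth 0 (a' :: s ++ [seq q.2 | q <- fronts Gr b L]) (size s + i'))
    (nth 0 (s ++ [seq q.2 | q <- fronts Gr b L]) (size s + i')).
  move=> /IH + s; elim: s => [|v s IHs] h a' /=; first by move=> ->.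
  by move=> E; exact: IHs.
rewrite size_cat size_map map_cat -map_comp (map_id (steps Gr a b)) => isz.
have [ltis|leis] := ltnP i (size (steps Gr a b)); last first.
  rewrite -(subnKC leis); apply: tail; last exact: last_steps.
  by rewrite ltn_subLR.
rewrite -cat_cons !nth_cat /= ltnS (ltnW ltis) ltis {isz tail IH}.
have [ba|ab] := leP b a.
  by move: ltis; rewrite /steps ba /=; case: i => //= _; left.
have [+ + _] := steps_up Gr ab.
move: (steps Gr a b) ltis => s.
elim: s a ab i => [//|v s IHs] a ab i /= il /andP[av ps] memE.
have vb : v <= b by have := memE v; rewrite inE eqxx => /esym/and3P[].
have ordv p : p \in s -> v < p.
  by move: ps; rewrite path_sortedE; [move=> /andP[/allP h _] /h | exact: lt_trans].
case: i il => [_|i il] /=.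
  right; split => // p pG; apply/negP => /andP[ap pv].
  have := memE p; rewrite pG ap (ltW (lt_le_trans pv vb)) inE => /predU1P[pE|/ordv].
    by rewrite pE ltxx in pv.
  by rewrite ltNge (ltW pv).
have [bv|vltb] := leP b v.
  case: s il ordv memE {ps IHs} => // w s _ ordv memE.
  have := memE w; rewrite !inE eqxx orbT => /esym/and3P[_ _ wb].
  by have := ordv w; rewrite inE eqxx => /(_ isT); rewrite ltNge (le_trans wb bv).
apply: IHs => // p; apply/idP/idP => [ps'|/and3P[pG vp pb]].
  have := memE p; rewrite inE ps' orbT => /esym/and3P[-> _ ->].
  by rewrite ordv.
have := memE p; rewrite pG pb (lt_trans av vp) inE => /predU1P[pE|//].
by rewrite pE ltxx in vp.
Qed.

Lemma size_fronts Gr a L :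
  (size (fronts Gr a L))%:R = jump_sum (fun a b _ => (size (steps Gr a b))%:R) a L.
Proof. by elim: L a => [|[x b] L IH] a //=; rewrite size_cat size_map natrD IH. Qed.

Lemma fstate_of_valid Gr L : 0 \in Gr -> {subset [seq q.2 | q <- L] <= Gr} ->
  last 0 [seq q.2 | q <- L] = 0 -> fvalid Gr (fstate_of (fronts Gr 0 L)).
Proof.
move=> G0 sub l0; split => //=.
- by rewrite -(size_map snd) -[size _]/(size (0 :: map _ _)).-1 nth_last /= last_fronts.
- move=> i; rewrite -(size_map snd) -ltnS -[(size _).+1]/(size (0 :: _)) => /(mem_nth 0).
  by rewrite inE => /predU1P[-> //|]; exact: fronts_values.
- by move=> i il; exact: fronts_admissible.
Qed.

Lemma fstate_of_sorted Gr a L : sorted <=%O [seq q.1 | q <- L] -> fsorted (fstate_of (fronts Gr a L)).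
Proof.
case: L => [_ [] //|[x b] L] px.
have : path <=%O x [seq q.1 | q <- fronts Gr a ((x, b) :: L)] by apply: fronts_sorted; rewrite /= lexx.
move: (fronts Gr a _) => L' /(pathP x) h i /= iL.
have := h i.+1; rewrite size_map => /(_ iL); rewrite /= (nth_map (0, 0)) //; last exact: ltnW.
by rewrite (nth_map (0, 0)).
Qed.

End FrontLists.

(** [N x] is the total variation over the interval from 0 to [x]. All later uses of bounded
    variation go through this increasing majorant. *)
Lemma variation_primitive (R : realType) (f : R -> R) : bounded_variation 0 1 f ->
  exists N : R -> R, [/\ N 0 = 0, N 1 = TV01 f &
    forall x y, 0 <= x -> x <= y -> y <= 1 -> `|f y - f x| <= N y - N x].
Proof.
move=> /(bounded_variationP _ (ler01 : (0 : R) <= 1)) fin.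
exists (fun x => fine (total_variation 0 x f)); split => //; first by rewrite total_variationxx.
move=> x y x0 xy y1.
have y0 := le_trans x0 xy.
have finy : total_variation 0 y f \is a fin_num.
  move: fin; rewrite (total_variationD f y0 y1) fin_numD => /andP[] //.
have := finy; rewrite (total_variationD f x0 xy) fin_numD => /andP[finx finxy].
rewrite fineD // addrAC subrr add0r -lee_fin fineK //; exact: total_variation_ge.
Qed.

Lemma jump_sum_iota (R : realType) (f : R -> R -> R -> R) (y v : nat -> R) i0 n :
  jump_sum f (v i0) [seq (y i, v i) | i <- iota i0.+1 n] =
  \sum_(i < n) f (v (i0 + i)%N) (v (i0 + i).+1) (y (i0 + i).+1).
Proof.
elim: n i0 => [|n IH] i0; first by rewrite big_ord0.
rewrite /= IH big_ord_recl addn0; congr (_ + _); apply: eq_bigr => i _.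
by rewrite /= /bump /= add1n addnS addSn.
Qed.

Section Quantization.
Variables (R : realType) (K : nat) (V : R) (u0 N : R -> R).
Hypothesis K0 : (0 < K)%N.
Hypothesis V0 : 0 < V.
Hypothesis N0 : N 0 = 0.
Hypothesis N1 : N 1 = V.
Hypothesis NV : forall x y, 0 <= x -> x <= y -> y <= 1 -> `|u0 y - u0 x| <= N y - N x.
Hypothesis uz : forall x, x <= 0 \/ 1 <= x -> u0 x = 0.

Let h := V / K%:R.
Let KR : 0 < K%:R :> R. Proof. by rewrite ltr0n. Qed.
Let h0 : 0 < h. Proof. exact: divr_gt0. Qed.
Let hK : K%:R * h = V. Proof. by rewrite /h mulrC divfK // gt_eqF. Qed.

Definition qnode (i : nat) : R := i%:R / K%:R.
(* The shift by K makes the quantization level a natural number. *)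
Definition qlevel (i : nat) : nat := Num.truncn (u0 (qnode i) / h + K%:R).
Definition qval (i : nat) : R := ((qlevel i)%:R - K%:R) * h.

Lemma qnode_itv i : (i <= K)%N -> 0 <= qnode i <= 1.
Proof. by move=> iK; rewrite divr_ge0 //= ler_pdivrMr // mul1r ler_nat. Qed.

Lemma qnode_le i j : (i <= j)%N -> qnode i <= qnode j.
Proof. by move=> ij; rewrite ler_wpM2r ?invr_ge0 ?ler_nat // ltW. Qed.

Lemma norm_le_variation x : `|u0 x| <= V.
Proof.
have [x0|x0] := leP x 0; first by rewrite (uz (or_introl x0)) normr0 ltW.
have [x1|x1] := leP 1 x; first by rewrite (uz (or_intror x1)) normr0 ltW.
have l := NV (lexx 0) (ltW x0) (ltW x1); have := NV (ltW x0) (ltW x1) (lexx 1).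
rewrite N1 => l1; have := normr_ge0 (u0 1 - u0 x).
by move: l; rewrite (uz (or_introl (lexx 0))) N0 !subr0; lra.
Qed.

Lemma qval_near i : u0 (qnode i) - h < qval i <= u0 (qnode i).
Proof.
have nn : 0 <= u0 (qnode i) / h + K%:R.
  have := norm_le_variation (qnode i); rewrite ler_norml => /andP[+ _].
  by rewrite -hK -mulNr -ler_pdivlMr // -subr_ge0 opprK.
have /andP[l1 l2] := truncn_itv nn.
rewrite /qval /qlevel; set n := Num.truncn _ in l1 l2 *; apply/andP; split.
  move: l2; rewrite -ltrBrDr ltr_pdivrMr // -natr1; lra.
by move: l1; rewrite -lerBlDr ler_pdivlMr.
Qed.

Lemma qval_zero i : u0 (qnode i) = 0 -> qval i = 0.
Proof. by move=> ui; rewrite /qval /qlevel ui mul0r add0r natrK subrr mul0r. Qed.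

Lemma qval0 : qval 0 = 0.
Proof. by apply: qval_zero; apply: uz; left; rewrite /qnode mul0r. Qed.

Lemma qvalK : qval K = 0.
Proof. by apply: qval_zero; apply: uz; right; rewrite /qnode divff // gt_eqF. Qed.

Lemma qlevel_le i : (qlevel i <= 2 * K)%N.
Proof.
have /andP[_ l] := qval_near i; have := norm_le_variation (qnode i); rewrite ler_norml => /andP[_ l2].
have := le_trans l l2; rewrite /qval -hK ler_pM2r // lerBlDr -natrD ler_nat; lia.
Qed.

Lemma qval_variation i : (i < K)%N ->
  `|qval i.+1 - qval i| <= N (qnode i.+1) - N (qnode i) + h.
Proof.
move=> iK; have /andP[i0 _] := qnode_itv (ltnW iK); have /andP[_ i1] := qnode_itv iK.
have := NV i0 (qnode_le (leqnSn i)) i1; rewrite !ler_norml => /andP[a1 a2].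
have /andP[b1 b2] := qval_near i; have /andP[c1 c2] := qval_near i.+1.
by apply/andP; split; lra.
Qed.

Lemma sum_variation : \sum_(i < K) (N (qnode i.+1) - N (qnode i) + h) = 2 * V.
Proof.
rewrite big_split /= (telescope_le K (fun i => N (qnode i))) sumr_const card_ord -[h *+ K]mulr_natl hK.
by rewrite /qnode divff ?gt_eqF // N1 mul0r N0; ring.
Qed.

Lemma sum_qval_variation : \sum_(i < K) `|qval i.+1 - qval i| <= 2 * V.
Proof. by rewrite -sum_variation; apply: ler_sum => i _; exact: qval_variation. Qed.

Definition qjumps : seq (R * R) := [seq (qnode i, qval i) | i <- iota 1 K].

Lemma jump_sum_qjumps (f : R -> R -> R -> R) :
  jump_sum f 0 qjumps = \sum_(i < K) f (qval i) (qval i.+1) (qnode i.+1).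
Proof. by rewrite -{1}qval0 /qjumps jump_sum_iota. Qed.

Lemma last_qjumps : last 0 [seq q.2 | q <- qjumps] = 0.
Proof.
rewrite -map_comp (eq_map (g := qval)) // -(nth_last 0) size_map size_iota.
rewrite (nth_map 0%N) ?size_iota ?prednK // nth_iota ?prednK // add1n prednK //; exact: qvalK.
Qed.

Lemma sorted_qjumps : sorted <=%O [seq q.1 | q <- qjumps].
Proof.
rewrite -map_comp (eq_map (g := qnode)) //; apply: (homo_sorted (e := leq)); first exact: qnode_le.
by rewrite (sub_sorted (e := ltn)) ?iota_ltn_sorted // => i j /ltnW.
Qed.

(* [pm] will be a minimum point of F on [-V, V], so that the two Legendre transforms agree at 0. *)
Definition qgrid (pm : R) : seq R := pm :: [seq (j%:R - K%:R) * h | j <- iota 0 (2 * K).+1].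

Definition qfine (m : nat) (pm : R) : seq R :=
  qgrid pm ++ [seq (j%:R / m%:R - K%:R) * h | j <- iota 0 (2 * K * m).+1].

Lemma qval_grid pm i : qval i \in qgrid pm.
Proof.
rewrite inE; apply/orP; right; apply/mapP; exists (qlevel i) => //.
by rewrite mem_iota /= add0n ltnS qlevel_le.
Qed.

Lemma qjumps_grid pm : {subset [seq q.2 | q <- qjumps] <= qgrid pm}.
Proof. by move=> p; rewrite -map_comp => /mapP[i _ ->]; exact: qval_grid. Qed.

Lemma qgrid0 pm : 0 \in qgrid pm.
Proof. by rewrite -qval0 qval_grid. Qed.

Lemma qgrid_fine m pm : {subset qgrid pm <= qfine m pm}.
Proof. by move=> p pG; rewrite mem_cat pG. Qed.

Lemma qfine_itv m pm p : (0 < m)%N -> `|pm| <= V -> p \in qfine m pm -> `|p| <= V.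
Proof.
move=> m0 pmV; have mR : 0 < m%:R :> R by rewrite ltr0n.
have aux (r : R) : 0 <= r <= (2 * K)%:R -> `|(r - K%:R) * h| <= V.
  rewrite natrM => /andP[r0 r1]; rewrite -hK normrM (gtr0_norm h0) ler_pM2r // ler_norml.
  by apply/andP; split; lra.
rewrite mem_cat inE => /orP[/predU1P[-> //|/mapP[j + ->]]|/mapP[j + ->]].
  by rewrite mem_iota add0n ltnS /= => jK; apply: aux; rewrite ler0n ler_nat.
rewrite mem_iota add0n ltnS /= => jK; apply: aux.
by rewrite divr_ge0 //= ler_pdivrMr // -natrM ler_nat.
Qed.

Lemma next_node m p : (0 < m)%N -> `|p| <= V ->
  exists j, p < (j%:R / m%:R - K%:R) * h <= p + h / m%:R.
Proof.
move=> m0 pV; have mR : 0 < m%:R :> R by rewrite ltr0n.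
have nn : 0 <= (p / h + K%:R) * m%:R.
  apply: mulr_ge0 => //; move: pV; rewrite ler_norml => /andP[+ _].
  by rewrite -hK -mulNr -ler_pdivlMr // -subr_ge0 opprK.
have /andP[l1 l2] := truncn_itv nn; exists (Num.truncn ((p / h + K%:R) * m%:R)).+1.
move: l1 l2; set n := Num.truncn _; rewrite -ler_pdivrMr // -ltr_pdivlMr // => l1 l2.
apply/andP; split.
  by rewrite -ltr_pdivrMr // ltrBrDr.
have -> : p + h / m%:R = (p / h + K%:R + m%:R^-1 - K%:R) * h by field; rewrite !gt_eqF.
by rewrite ler_pM2r // lerBlDr subrK -natr1 mulrDl mul1r lerD2r.
Qed.

Lemma node_lt m j (r : R) : (0 < m)%N -> r <= V -> (j%:R / m%:R - K%:R) * h < r -> (j < (2 * K * m).+1)%N.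
Proof.
move=> m0 rV /lt_le_trans /(_ rV); have mR : 0 < m%:R :> R by rewrite ltr0n.
rewrite -hK ltr_pM2r // ltrBlDr ltr_pdivrMr // -natrD -natrM ltr_nat; lia.
Qed.

Lemma qgrid_gaps m pm p p' : (0 < m)%N -> `|pm| <= V -> p \in qgrid pm -> p' \in qfine m pm ->
  h < `|p - p'| -> exists2 r, r \in qgrid pm & (p < r < p') || (p' < r < p).
Proof.
move=> m0 pmV /(qgrid_fine m)/(qfine_itv m0 pmV) pV /(qfine_itv m0 pmV) pV'.
have aux a b : `|a| <= V -> `|b| <= V -> h < b - a -> exists2 r, r \in qgrid pm & a < r < b.
  move=> aV bV ab; have [j] := next_node (isT : (0 < 1)%N) aV.
  rewrite !divr1 => /andP[j1 j2]; exists ((j%:R - K%:R) * h); last first.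
    by apply/andP; split => //; lra.
  rewrite inE; apply/orP; right; apply/mapP; exists j => //; rewrite mem_iota add0n /=.
  have := @node_lt 1 j b isT; rewrite divr1 muln1; apply; last lra.
  by move: bV; rewrite ler_norml => /andP[].
have [pp|pp] := leP p p'.
  rewrite ler0_norm ?subr_le0 // opprB => /(aux _ _ pV pV')[r rG rp].
  by exists r => //; rewrite rp.
rewrite gtr0_norm ?subr_gt0 // => /(aux _ _ pV' pV)[r rG rp].
by exists r => //; rewrite rp orbT.
Qed.

Lemma qfine_gap m pm a b : (0 < m)%N -> `|pm| <= V -> a \in qfine m pm -> b \in qfine m pm ->
  a < b -> (forall p, p \in qfine m pm -> ~~ (a < p < b)) -> b - a <= h / m%:R.
Proof.
move=> m0 pmV /(qfine_itv m0 pmV) aV /(qfine_itv m0 pmV) bV ab gap.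
have [j /andP[j1 j2]] := next_node m0 aV.
suff : b <= (j%:R / m%:R - K%:R) * h by lra.
rewrite leNgt; apply/negP => lt; have bV' : b <= V by move: bV; rewrite ler_norml => /andP[].
have := gap ((j%:R / m%:R - K%:R) * h); rewrite j1 lt => /(_ _)/negP; apply => //.
rewrite mem_cat; apply/orP; right; apply/mapP; exists j => //.
by rewrite mem_iota add0n /=; apply: node_lt lt.
Qed.

(** An upward jump passes one multiple of [h] per level, and possibly [pm]; a downward one is a
    single front. *)
Lemma size_steps pm i j : (size (steps (qgrid pm) (qval i) (qval j)))%:R <= 2 + `|qval j - qval i| / h.
Proof.
have nn : 0 <= `|qval j - qval i| / h by rewrite divr_ge0 // ltW.
have [ba|ab] := leP (qval j) (qval i); first by rewrite /steps ba /=; lra.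
rewrite gtr0_norm ?subr_gt0 //.
have lij : (qlevel i < qlevel j)%N by move: ab; rewrite /qval ltr_pM2r // ltrD2r ltr_nat.
have -> : (qval j - qval i) / h = (qlevel j - qlevel i)%:R.
  by rewrite natrB ?(ltnW lij) // /qval; field; rewrite gt_eqF.
rewrite -(natrD R 2) ler_nat /steps (leNgt (qval j)) ab -[if ~~ true then _ else _]/(sort _ _) size_sort.
apply: leq_trans (size_undup _) _; set P := fun p => _ < p <= _; rewrite /qgrid.
set s := [seq (j%:R - K%:R) * h | j <- iota 0 (2 * K).+1].
suff H : (size [seq p <- s | P p] <= qlevel j - qlevel i)%N.
  rewrite -cat1s filter_cat size_cat; apply: leq_add H.
  by rewrite size_filter; apply: leq_trans (count_size _ _) _.
rewrite /s filter_map size_map.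
rewrite -[leqRHS](size_iota (qlevel i).+1); apply: uniq_leq_size.
  by rewrite filter_uniq // iota_uniq.
move=> l; rewrite mem_filter /= /P /qval ltr_pM2r // ltrD2r ltr_nat ler_pM2r // lerD2r ler_nat.
by rewrite !mem_iota => /andP[/andP[l1 l2] _]; lia.
Qed.

(** [2 * K] comes from the constant in [size_steps], and another [2 * K] from the variation [2 * V]
    divided by [h]. *)
Lemma size_qfronts pm : (size (fronts (qgrid pm) 0 qjumps) <= 4 * K)%N.
Proof.
rewrite -(ler_nat R) size_fronts jump_sum_qjumps.
apply: (@le_trans _ _ (\sum_(i < K) (2 + `|qval i.+1 - qval i| / h))).
  by apply: ler_sum => i _; exact: size_steps.
rewrite big_split /= sumr_const card_ord -mulr_suml -[2 *+ K]mulr_natr.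
have : (\sum_(i < K) `|qval i.+1 - qval i|) / h <= 2 * K%:R.
  by rewrite ler_pdivrMr // -mulrA hK sum_qval_variation.
rewrite natrM; lra.
Qed.

Section Profile.
Variable Gr : seq R.
Hypothesis sub : {subset [seq q.2 | q <- qjumps] <= Gr}.

Lemma sum_qfronts (g : R -> R) (st := fstate_of (fronts Gr 0 qjumps)) :
  \sum_(i < fn st) (fk st i.+1 - fk st i) * g (fy st i) =
  \sum_(i < K) (qval i.+1 - qval i) * g (qnode i.+1).
Proof.
rewrite -(jump_sum_qjumps (fun a b x => (b - a) * g x)) -(jump_sum_fronts _ _ sub).
exact: (jump_sumE (fun a b x => (b - a) * g x)).
Qed.

Lemma total_jump_qfronts (st := fstate_of (fronts Gr 0 qjumps)) :
  total_jump (fn st) (fk st) <= 2 * V.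
Proof.
apply: le_trans sum_qval_variation; rewrite -(jump_sum_qjumps (fun a b x => `|b - a|)).
rewrite -(jump_norm_fronts _ sub).
by rewrite -(jump_sumE (fun a b x => `|b - a|)).
Qed.

Lemma qfronts_itv i (st := fstate_of (fronts Gr 0 qjumps)) : (i < fn st)%N -> 0 <= fy st i <= 1.
Proof.
move=> /= il; have := fronts_positions (mem_nth (0, 0) il).
rewrite -map_comp => /mapP[j]; rewrite mem_iota add1n ltnS => /andP[_ jK] ->.
exact: qnode_itv.
Qed.

(** In the cell of [x] the error is at most the variation of [u0] over the cell plus the rounding
    [h]. The right-hand side is this bound as a step function; integrating over cells of width
    [1 / K] gives [2 * V / K]. *)
Lemma qfronts_near x : `|u0 x - fprofile (fstate_of (fronts Gr 0 qjumps)) x| <=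
  \sum_(i < K) `|(N (qnode i.+1) - N (qnode i) + h) * (heav (qnode i) x - heav (qnode i.+1) x)|.
Proof.
rewrite [fprofile _ x](sum_qfronts (fun y => heav y x)).
have [x0|x0] := ltP x 0.
  rewrite (uz (or_introl (ltW x0))).
  rewrite big1 ?subrr ?normr0 ?sumr_ge0 // => i _.
  have /andP[q0 _] := qnode_itv (ltn_ord i).
  by rewrite /heav leNgt (lt_le_trans x0 q0) mulr0.
have [x1|x1] := leP 1 x.
  rewrite (uz (or_intror x1)).
  rewrite (eq_bigr (fun i : 'I_K => qval i.+1 - qval i)).
    by rewrite (telescope_le K qval) qval0 qvalK !subrr normr0 sumr_ge0.
  move=> i _; have /andP[_ q1] := qnode_itv (ltn_ord i).
  by rewrite /heav (le_trans q1 x1) mulr1.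
have /andP[j1 j2] := truncn_itv (mulr_ge0 x0 (ler0n R K)).
set j := Num.truncn _ in j1 j2.
have jK : (j < K)%N.
  by rewrite -(ltr_nat R); apply: le_lt_trans j1 _; rewrite gtr_pMl.
have qj i : (qnode i <= x) = (i <= j)%N.
  rewrite /qnode ler_pdivrMr //; apply/idP/idP => [ix|ij].
    by rewrite -ltnS -(ltr_nat R); exact: le_lt_trans j2.
  by apply: le_trans j1; rewrite ler_nat.
have -> : \sum_(i < K) (qval i.+1 - qval i) * heav (qnode i.+1) x = qval j.
  rewrite (eq_bigr (fun i : 'I_K => if (i < j)%N then qval i.+1 - qval i else 0)); last first.
    by move=> i _; rewrite /heav qj; case: ifP => _; rewrite ?mulr1 ?mulr0.
  rewrite -big_mkcond /= -(big_ord_widen K (fun i => qval i.+1 - qval i) (ltnW jK)).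
  by rewrite (telescope_le j qval) qval0 subr0.
rewrite (bigD1 (Ordinal jK)) //= /heav !qj leqnn ltnn subr0 mulr1.
apply: ler_wpDr; first by rewrite sumr_ge0.
have /andP[q0 _] := qnode_itv (ltnW jK); have /andP[_ q1] := qnode_itv jK.
have jx : qnode j <= x by rewrite qj.
have xj : x <= qnode j.+1 by rewrite ltW // ltNge qj ltnn.
have l1 := NV q0 jx (ltW x1); have l2 := NV x0 xj q1.
have /andP[l3 l4] := qval_near j.
have := normr_ge0 (u0 (qnode j.+1) - u0 x) => l5.
apply: le_trans (ler_norm _).
by move: l1; rewrite !ler_norml => /andP[l6 l7]; apply/andP; split; lra.
Qed.

Lemma L1_qfronts : measurable_fun setT u0 ->
  (L1 (fun x => (u0 x - fprofile (fstate_of (fronts Gr 0 qjumps)) x)%R) <= (2 * (V / K%:R))%:E)%E.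
Proof.
move=> mu0.
have -> : 2 * (V / K%:R) = \sum_(i < K) (N (qnode i.+1) - N (qnode i) + h) / K%:R.
  by rewrite -mulr_suml sum_variation mulrA.
have c0 i : (i < K)%N -> 0 <= N (qnode i.+1) - N (qnode i) + h.
  by move=> iK; apply: le_trans (qval_variation iK).
apply: (@le_L1_sum _ _ _ (fun i x => (N (qnode i.+1) - N (qnode i) + h) * (heav (qnode i) x - heav (qnode i.+1) x))
  (fun i => (N (qnode i.+1) - N (qnode i) + h) / K%:R)).
- by apply: measurable_funB => //; exact: measurable_pwc.
- move=> i; apply: measurable_funM; first exact: measurable_cst.
  by apply: measurable_funB; exact: measurable_heav.
- exact: qfronts_near.
move=> i iK; rewrite L1Z; last by apply: measurable_funB; exact: measurable_heav.
rewrite ger0_norm ?c0 // EFinM; apply: lee_wpmul2l; first by rewrite lee_fin c0.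
apply: le_trans (L1_heavB _ _) _; rewrite lee_fin -mulrBl -natrB // subSnn mul1r.
by rewrite ger0_norm // invr_ge0 ltW.
Qed.

End Profile.
End Quantization.

(** * Jumps as network units *)

Section RampUnits.
Variable R : realType.
Local Notation mu := (@lebesgue_measure R).

Definition ramp (z : R) : R := pos_part z - pos_part (z - 1).

Lemma ramp_le0 z : z <= 0 -> ramp z = 0.
Proof. by move=> h; rewrite /ramp !pos_partE; case: (leP 0 z) => ?; case: (leP 0 (z - 1)) => ?; lra. Qed.

Lemma ramp_ge1 z : 1 <= z -> ramp z = 1.
Proof. by move=> h; rewrite /ramp !pos_partE; case: (leP 0 z) => ?; case: (leP 0 (z - 1)) => ?; lra. Qed.

Lemma ramp_itv z : 0 <= ramp z <= 1.
Proof.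
rewrite /ramp !pos_partE; case: (leP 0 z) => ?; case: (leP 0 (z - 1)) => ?; apply/andP; split; lra.
Qed.

Lemma ramp_heav (p e x : R) : 0 < e ->
  `|heav p x - ramp ((x - p) / e)| <= `|heav p x - heav (p + e) x|.
Proof.
move=> e0; have /andP[r0 r1] := ramp_itv ((x - p) / e); rewrite /heav.
have [px|xp] := leP p x; last first.
  rewrite ramp_le0 ?subrr ?normr0 //.
  by rewrite ler_pdivrMr // mul0r subr_le0 ltW.
have [px'|xp'] := leP (p + e) x.
  by rewrite ramp_ge1 ?subrr ?normr0 // ler_pdivlMr // mul1r; lra.
by rewrite /= mulr1n subr0 normr1 ger0_norm ?subr_ge0 //; lra.
Qed.

Lemma measurable_ramp (p e : R) : measurable_fun setT (fun x : R => ramp ((x - p) / e)).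
Proof.
apply: continuous_measurableT => x; rewrite /ramp.
have cl : {for x, continuous (fun x : R => (x - p) / e)}.
  by apply: cvgM; [apply: cvgB; [exact: cvg_id | exact: cvg_cst] | exact: cvg_cst].
apply: cvgB; first by apply: (continuous_comp cl); exact: continuous_pos_part.
apply: (@continuous_comp _ _ _ (fun x => (x - p) / e - 1)); last exact: continuous_pos_part.
by apply: cvgB; [exact: cl | exact: cvg_cst].
Qed.

(* a jump of height [ja] along the line of slope [js] through [(jp, 0)], present from time [jt] on *)
Record junit := JUnit { ja : R; jp : R; js : R; jt : R }.

(** [pos_part (r + c - 1)] acts as a conjunction of ramps: it is 0 when the switch [c] is 0 and [r]
    when [c] is 1. This lets a ReLU network multiply by an indicator in time. *)
Definition jeval (e : R) (U : seq junit) (t x : R) : R :=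
  \sum_(q <- U) ja q * pos_part (ramp ((x - (jp q + js q * t)) / e) + ramp ((t - jt q) / e) - 1).

(** [n] counts network units. The bound [B] does not depend on the time, so one ramp width serves
    all [t]. *)
Definition jumps_approx (w : R -> R -> R) (n : nat) :=
  (forall t, measurable_fun setT (w t)) /\
  exists U B, [/\ size U = n, 0 <= B & forall e t, 0 < e -> e <= 1 -> 0 < t ->
    (L1 (fun x => (w t x - jeval e U t x)%R) <= (e * B)%:E)%E].

Lemma measurable_jeval e U t : measurable_fun setT (jeval e U t).
Proof.
elim: U => [|q U IH].
  by rewrite (_ : jeval _ _ _ = cst 0) //; apply/funext => x; rewrite /jeval big_nil.
rewrite (_ : jeval _ _ _ = fun x =>
  ja q * pos_part (ramp ((x - (jp q + js q * t)) / e) + ramp ((t - jt q) / e) - 1) + jeval e U t x); last by apply/funext => x; rewrite /jeval big_cons.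
apply: measurable_funD => //; apply: measurable_funM; first exact: measurable_cst.
apply: (measurableT_comp (continuous_measurableT (@continuous_pos_part R))).
apply: measurable_funB; last exact: measurable_cst.
by apply: measurable_funD; [exact: measurable_ramp | exact: measurable_cst].
Qed.

Lemma jumps_approxD w1 w2 n1 n2 : jumps_approx w1 n1 -> jumps_approx w2 n2 ->
  jumps_approx (fun t x => w1 t x + w2 t x) (n1 + n2).
Proof.
move=> [m1 [U1 [B1 [s1 b1 h1]]]] [m2 [U2 [B2 [s2 b2 h2]]]].
split; first by move=> t; exact: measurable_funD.
exists (U1 ++ U2), (B1 + B2); split; [by rewrite size_cat s1 s2 | exact: addr_ge0 |].
move=> e t e0 e1 t0; rewrite mulrDr EFinD.
apply: le_trans (leeD (h1 e t e0 e1 t0) (h2 e t e0 e1 t0)).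
have mj := measurable_jeval e.
apply: le_L1D; try by apply: measurable_funB => //; exact: measurable_funD.
move=> x; rewrite /jeval big_cat /= -/(jeval _ _ _ _) -/(jeval _ _ _ _).
apply: le_trans (ler_normD _ _); rewrite le_eqVlt; apply/orP; left; apply/eqP; congr (`|_|); ring.
Qed.

Lemma jumps_approx0 : jumps_approx (fun _ _ => 0) 0.
Proof.
split; first by move=> t; exact: measurable_cst.
exists [::], 0; split => // e t _ _ _; rewrite mulr0 /L1.
by rewrite integral0_eq // => x _; rewrite /jeval big_nil subr0 normr0.
Qed.

(* Switched on at time -1, the second ramp equals 1 for all t > 0. *)
Lemma jumps_approx_front (a p s : R) : jumps_approx (fun t x => a * heav (p + s * t) x) 1.
Proof.
split; first by move=> t; apply: measurable_funM; [exact: measurable_cst | exact: measurable_heav].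
exists [:: JUnit a p s (-1)], `|a|; split => // e t e0 e1 t0.
have E x : a * heav (p + s * t) x - jeval e [:: JUnit a p s (-1)] t x =
    a * (heav (p + s * t) x - ramp ((x - (p + s * t)) / e)).
  rewrite /jeval big_seq1 /= (@ramp_ge1 ((t - -1) / e)); last by rewrite ler_pdivlMr //; lra.
  rewrite addrK pos_partE; have /andP[-> _] := ramp_itv ((x - (p + s * t)) / e); by ring.
under [X in L1 X]eq_fun do rewrite E.
have m1 := @measurable_heav R; have m2 := measurable_ramp (p + s * t) e.
rewrite L1Z; last exact: measurable_funB.
rewrite (mulrC e `|a|) EFinM; apply: lee_wpmul2l; first by rewrite lee_fin.
apply: (@le_trans _ _ (L1 (fun x => (heav (p + s * t) x - heav (p + s * t + e) x)%R))).
  by apply: le_L1; try exact: measurable_funB; move=> x; exact: ramp_heav.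
apply: le_trans (L1_heavB _ _) _; rewrite lee_fin addrAC subrr add0r gtr0_norm //.
Qed.

(** The switch is incomplete only for a time [e] after [dtau], and then the two lines are at most
    [|s' - s| * e] apart. So the dipole and its approximation are both small in L^1, whatever the
    state of the switch. *)
Lemma jumps_approx_dip (d : dipole R) : 0 <= dtau d -> jumps_approx (dip d) 2.
Proof.
move=> tau0; case: d tau0 => a tau p s s' /= tau0.
have m1 := @measurable_heav R.
split.
  move=> t; rewrite /dip /=; apply: measurable_funM; first exact: measurable_cst.
  by apply: measurable_funM; [exact: measurable_cst | exact: measurable_funB].
exists [:: JUnit a (p - s' * tau) s' tau; JUnit (- a) (p - s * tau) s tau], (`|a| * (2 + 2 * `|s' - s|)).
split => //.
move=> e t e0 e1 t0.
pose l' := p + s' * (t - tau); pose l := p + s * (t - tau).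
pose r' x := ramp ((x - l') / e); pose r x := ramp ((x - l) / e); pose c := ramp ((t - tau) / e).
have E x : dip (Dipole a tau p s s') t x -
    jeval e [:: JUnit a (p - s' * tau) s' tau; JUnit (- a) (p - s * tau) s tau] t x =
    a * ((tau <= t)%R%:R * (heav l' x - heav l x) - (pos_part (r' x + c - 1) - pos_part (r x + c - 1))).
  rewrite /dip /jeval big_cons big_seq1 /= -/l -/l'.
  have -> : p - s' * tau + s' * t = l' by rewrite /l'; ring.
  have -> : p - s * tau + s * t = l by rewrite /l; ring.
  rewrite -/(r x) -/(r' x) -/c; by ring.
under [X in L1 X]eq_fun do rewrite E.
have m2 q := measurable_ramp q e.
have mp q : measurable_fun setT (fun x : R => pos_part (ramp ((x - q) / e) + c - 1)).
  apply: (measurableT_comp (continuous_measurableT (@continuous_pos_part R))).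
  by apply: measurable_funB; [apply: measurable_funD|]; try exact: measurable_cst.
have mg : measurable_fun setT (fun x : R => (tau <= t)%R%:R * (heav l' x - heav l x) -
    (pos_part (r' x + c - 1) - pos_part (r x + c - 1))).
  apply: measurable_funB; last by apply: measurable_funB; exact: mp.
  by apply: measurable_funM; [exact: measurable_cst | exact: measurable_funB].
rewrite L1Z // mulrCA EFinM; apply: lee_wpmul2l; first by rewrite lee_fin.
(* [k] marks the switching interval. The error is bounded by the two ramp errors plus, while
   switching, twice the dipole: once for itself and once for its approximation. *)
pose k : R := ((tau <= t) && (t < tau + e))%R%:R.
pose g i x := nth 0 [:: heav l' x - heav (l' + e) x; heav l x - heav (l + e) x; k * (2 * (heav l' x - heav l x))] i.
pose b i := nth 0 [:: e; e; 2 * `|s' - s| * e] i.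
have -> : e * (2 + 2 * `|s' - s|) = \sum_(i < 3) b i by rewrite !big_ord_recr big_ord0 /b /=; ring.
apply: (@le_L1_sum _ 3 _ g b) => //.
- case=> [|[|[|[|i]]]] /=; rewrite /g /=; try exact: measurable_cst; try exact: measurable_funB.
  apply: measurable_funM; first exact: measurable_cst.
  by apply: measurable_funM; [exact: measurable_cst | exact: measurable_funB].
- move=> x; rewrite !big_ord_recr big_ord0 /g /= add0r.
  have /andP[c0 c1] := ramp_itv ((t - tau) / e); rewrite -/c in c0 c1.
  have /andP[a0 a1] := ramp_itv ((x - l) / e); rewrite -/(r x) in a0 a1.
  have /andP[b0 b1] := ramp_itv ((x - l') / e); rewrite -/(r' x) in b0 b1.
  have := ramp_heav l' x e0; have := ramp_heav l x e0; rewrite -/(r x) -/(r' x).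
  set A := `|heav l x - heav (l + e) x|; set B := `|heav l' x - heav (l' + e) x|.
  move: A B (heav l x) (heav l' x) => A B H H' hA hB.
  move: (r x) (r' x) a0 a1 b0 b1 hA hB => z z' a0 a1 b0 b1 hA hB.
  have [lt|lt] := leP tau t; last first.
    have -> : c = 0 by rewrite /c ramp_le0 // ler_pdivrMr // mul0r subr_le0 ltW.
    have pz y : y <= 1 -> pos_part (y + 0 - 1) = 0.
      by move=> y1; rewrite pos_partE; case: ifP => // ?; lra.
    rewrite !pz // mul0r !subrr normr0 addr_ge0 // addr_ge0 //.
      exact: le_trans hB.
    exact: le_trans hA.
  have tri : `|H' - H - (z' - z)| <= `|H' - z'| + `|H - z|.
    by rewrite (_ : H' - H - (z' - z) = (H' - z') - (H - z)) ?ler_normB //; ring.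
  have [lt'|lt'] := ltP t (tau + e); last first.
    have -> : c = 1 by rewrite /c ramp_ge1 // ler_pdivlMr // mul1r; lra.
    rewrite /k lt ltNge lt' /= mul1r mul0r normr0 addr0 !addrK !pos_partE a0 b0.
    by apply: le_trans tri _; lra.
  have -> : k = 1 by rewrite /k lt lt'.
  rewrite !mul1r normrM (ger0_norm (_ : 0 <= 2)) //.
  have lip : `|pos_part (z' + c - 1) - pos_part (z + c - 1)| <= `|z' - z|.
    rewrite !pos_partE; have := ler_norm (z' - z); have := ler_norm (- (z' - z)); rewrite normrN => *.
    by rewrite ler_norml; case: (leP 0 (z' + c - 1)) => ?; case: (leP 0 (z + c - 1)) => ?; apply/andP; split; lra.
  have := ler_normB (H' - H) (pos_part (z' + c - 1) - pos_part (z + c - 1)).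
  have := ler_normB (H' - H) (H' - H - (z' - z)).
  rewrite (_ : H' - H - (H' - H - (z' - z)) = z' - z); last by ring.
  by move=> *; lra.
- move=> i.
  have hh (q : R) : (L1 (fun x => (heav q x - heav (q + e) x)%R) <= e%:E)%E.
    by apply: le_trans (L1_heavB _ _) _; rewrite lee_fin addrAC subrr add0r gtr0_norm.
  case: i => [|[|[|//]]] _; rewrite /g /b /=; [exact: hh | exact: hh |].
  have mH : measurable_fun setT (fun x : R => heav l' x - heav l x) by exact: measurable_funB.
  rewrite L1Z; last by apply: measurable_funM => //; exact: measurable_cst.
  rewrite L1Z //.
  have [kz|] := boolP ((tau <= t) && (t < tau + e)); last first.
    move=> /negPf kz; rewrite /k kz normr0 mul0e lee_fin !mulr_ge0 //; exact: ltW.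
  rewrite /k kz normr1 mul1e (ger0_norm (_ : 0 <= 2)) // -mulrA EFinM.
  apply: lee_wpmul2l => //; apply: le_trans (L1_heavB _ _) _; rewrite lee_fin.
  rewrite distrC (_ : l' - l = (s' - s) * (t - tau)); last by rewrite /l /l'; ring.
  move: kz => /andP[k1 k2]; rewrite normrM; apply: ler_wpM2l => //.
  by rewrite ger0_norm ?subr_ge0 // lerBlDl ltW.
Qed.

Lemma jumps_approx_sum (f : nat -> R -> R -> R) n :
  (forall i, (i < n)%N -> jumps_approx (f i) 1) -> jumps_approx (fun t x => \sum_(i < n) f i t x) n.
Proof.
elim: n => [|n IH] h.
  rewrite (_ : (fun t x => _) = fun _ _ => 0); first exact: jumps_approx0.
  by apply/funext => t; apply/funext => x; rewrite big_ord0.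
rewrite (_ : (fun t x => _) = fun t x => \sum_(i < n) f i t x + f n t x); last first.
  by apply/funext => t; apply/funext => x; rewrite big_ord_recr.
by rewrite -addn1; apply: jumps_approxD; [apply: IH => i /ltnW/h | exact: h].
Qed.

Lemma jumps_approx_dips (D : seq (dipole R)) : (forall d, List.In d D -> 0 <= dtau d) ->
  jumps_approx (fun t x => \sum_(d <- D) dip d t x) (2 * size D).
Proof.
elim: D => [|d D IH] h.
  rewrite (_ : (fun t x => _) = fun _ _ => 0); first exact: jumps_approx0.
  by apply/funext => t; apply/funext => x; rewrite big_nil.
rewrite (_ : (fun t x => _) = fun t x => dip d t x + \sum_(d <- D) dip d t x); last first.
  by apply/funext => t; apply/funext => x; rewrite big_cons.
rewrite /= mulnS; apply: jumps_approxD; first by apply: jumps_approx_dip; apply: h; left.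
by apply: IH => d' d'D; apply: h; right.
Qed.

End RampUnits.

(** * The network *)

Section Network.
Variables (R : realType) (e : R) (U : seq (junit R)).
Let m := size U.
Let q (j : nat) : junit R := nth (JUnit 0 0 0 0) U j.

Definition colv n (f : nat -> R) := VFac n 1 f.
Definition rowv n (f : nat -> R) := VFac 1 n f.

(* the four first-layer neurons of unit [j] compute X, X - 1, A, A - 1 where
   X = (x - p - s t) / e and A = (t - tau) / e *)
Definition win (j : nat) : R := nth 0 [:: e^-1; e^-1; 0; 0] (j %% 4).
Definition bin0 (j : nat) : R := let: JUnit _ p _ tau := q (j %/ 4) in
  nth 0 [:: - p / e; - p / e - 1; - tau / e; - tau / e - 1] (j %% 4).
Definition bin1 (j : nat) : R := let: JUnit _ _ s _ := q (j %/ 4) in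
  nth 0 [:: - s / e; - s / e; e^-1; e^-1] (j %% 4).

Definition net_wid (l : nat) : nat := nth 1%N [:: 1; m * 4; m; m; m]%N l.

(** Entry 0 is a dummy. A Kronecker product with a diagonal factor on the left is block diagonal, so
    layer 2 forms each unit from its own four neurons at the cost of [m + 4] parameters. Layers 3
    and 4 are identities that fill up the depth; layer 5 sums with the jump heights. *)
Definition net_weight (l : nat) : Defs.factor R :=
  let one := rowv 1 (fun _ => 1) in
  nth (Factor PDKron (colv m (fun _ => 1)) one)
    [:: Factor PKron one one; Factor PKron (colv (m * 4) win) one;
        Factor PDKron (colv m (fun _ => 1)) (rowv 4 (nth 0 [:: 1; -1; 1; -1]));
        Factor PDKron (colv m (fun _ => 1)) one; Factor PDKron (colv m (fun _ => 1)) one;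
        Factor PKron one (rowv m (fun j => ja (q j)))] l.

(** Time acts only through the first bias, whose constant part and coefficient of [t] are the two
    factors; this is where rank 2 comes from. The other layers hold a column of ones to be
    scaled. *)
Definition net_bias (l i : nat) : Defs.factor R :=
  Factor PKron (colv (net_wid l) (if l == 1%N then if i == 0%N then bin0 else bin1 else fun _ => 1))
    (rowv 1 (fun _ => 1)).

Definition net : lrnr R := LRNR 5 net_wid 2 (fun l _ => net_weight l) net_bias.

Lemma net_wf : lrnr_wf net.
Proof.
split => //; split => // l i /= /andP[l0 l5] i2.
case: l l0 l5 => [//|[|[|[|[|[|//]]]]]] _ _; rewrite /is_vector /vlen /net_wid /= ?muln1 ?mul1n;
  repeat split; auto; by rewrite /vlen /= muln1.
Qed.

Lemma net_dof : (dof net = 30 * m + 28)%N.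
Proof.
rewrite /dof /= big_nat_recl // big_nat_recl // big_nat_recl // big_nat_recl // big_nat1.
by rewrite !big_ord_recr !big_ord0 /= /vlen /net_wid /=; lia.
Qed.

Lemma net_width : (width net <= 4 * m + 1)%N.
Proof.
apply/bigmax_leqP => i _ /=; case: i => [[|[|[|[|[|[|//]]]]]] /= il]; rewrite /net_wid /=; lia.
Qed.

(** The two weight factors of a layer coincide, so the second gets coefficient 0. In [net_th0], the
    -1 of layer 2 is the constant of the conjunction in [jeval]. *)
Definition net_gam0 (l i : nat) : R := (i == 0%N)%:R.
Definition net_th0 (l i : nat) : R :=
  if i == 0%N then if l == 1%N then 1 else if l == 2 then -1 else 0 else 0.
Definition net_th1 (l i : nat) : R := ((l == 1%N) && (i == 1%N))%:R.

Lemma sum_quarters n (f : nat -> R) :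
  \sum_(k < n * 4) f k = \sum_(j < n) (f (j * 4 + 0)%N + f (j * 4 + 1)%N + f (j * 4 + 2)%N + f (j * 4 + 3)%N).
Proof.
elim: n => [|n IH]; first by rewrite !big_ord0.
by rewrite [in RHS]big_ord_recr /= -IH mulSnr addn4 !big_ord_recr /= !addrA addn0 addn1 addn2 addn3.
Qed.

Section Eval.
Variables (t x : R).
Let gam l i := net_gam0 l i + 0 * t.
Let th l i := net_th0 l i + net_th1 l i * t.
Let lay := layer net gam th x.

Lemma lay1 j k : (k < 4)%N -> lay 1 (j * 4 + k)%N = 
  nth 0 [:: (x - (jp (q j) + js (q j) * t)) / e; (x - (jp (q j) + js (q j) * t)) / e - 1;
            (t - jt (q j)) / e; (t - jt (q j)) / e - 1] k.
Proof.
move=> k4; rewrite /lay /= /affine /= big_ord1 !big_ord_recr !big_ord0 /=.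
rewrite /gam /th /net_gam0 /net_th0 /net_th1 /= ?divn1 ?modn1 ?addn0 /win /bin0 /bin1.
rewrite modnMDl modn_small // divnMDl // divn_small // addn0.
case: (q j) => a p s tau /=.
by case: k k4 => [|[|[|[|//]]]] _ /=; ring.
Qed.

Lemma lay_affine l j : lay l.+2 j =
  \sum_(k < net_wid l.+1) ne (factor_mat (net_weight l.+2)) j k * relu (lay l.+1) k + th l.+2 0.
Proof.
rewrite /lay /= -/(lay l.+1) /affine /=; congr (_ + _).
  apply: eq_bigr => k _; rewrite !big_ord_recr big_ord0 /= /gam /net_gam0 /=; congr (_ * _); ring.
rewrite !big_ord_recr big_ord0 /= /th /net_th0 /net_th1 /= ?andbF /=; ring.
Qed.

Lemma lay2 j : (j < m)%N -> lay 2 j =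
  ramp ((x - (jp (q j) + js (q j) * t)) / e) + ramp ((t - jt (q j)) / e) - 1.
Proof.
move=> jm; rewrite lay_affine -[net_wid 1]/(m * 4)%N.
rewrite (sum_quarters m (fun k => ne (factor_mat (net_weight 2)) j k * relu (lay 1) k)).
rewrite (bigD1 (Ordinal jm)) //= big1 => [|i ij].
  rewrite !modnMDl !divnMDl // !divn1 !modn1 !divn_small // addn0 eqxx /relu !lay1 //=.
  by rewrite /th /net_th0 /net_th1 /= /ramp /pos_part; ring.
rewrite !modnMDl !divnMDl // !divn1 !divn_small // addn0.
by have /negPf := ij; rewrite -val_eqE eq_sym /= => ->; ring.
Qed.

Lemma lay_id l j : (2 <= l <= 3)%N -> (j < m)%N -> lay l.+1 j = Num.max (lay l j) 0.
Proof.
case: l => [//|[//|l]] lE jm; have {lE}: (l == 0)%N || (l == 1)%N by case: l lE => [|[|]].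
move=> lE; rewrite lay_affine.
have -> : net_wid l.+2 = m by case/orP: lE => /eqP ->.
have -> : th l.+3 0 = 0 by case/orP: lE => /eqP ->; rewrite /th /net_th0 /net_th1 /=; ring.
have -> : net_weight l.+3 = Factor PDKron (colv m (fun=> 1)) (rowv 1 (fun=> 1)).
  by case/orP: lE => /eqP ->.
rewrite (bigD1 (Ordinal jm)) //= big1 => [|i ij].
  by rewrite !divn1 eqxx /relu; ring.
by rewrite !divn1; have /negPf := ij; rewrite -val_eqE eq_sym /= => ->; ring.
Qed.

Lemma net_eval : lrnr_eval net gam th x = jeval e U t x.
Proof.
rewrite /lrnr_eval -[depth net]/5%N -/(lay 5 0) lay_affine -[net_wid 4]/m /=.
rewrite /th /net_th0 /net_th1 /= mul0r !addr0 /jeval (big_nth (JUnit 0 0 0 0)) big_mkord.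
apply: eq_bigr => j _; rewrite mod0n add0n modn_small ?ltn_ord // mul1r; congr (_ * _).
(* The activations after layers 2, 3 and 4 are the same positive part taken three times. *)
rewrite /relu (@lay_id 3) // (@lay_id 2) // lay2 // /pos_part; move: (_ - 1) => z.
by rewrite -!maxA !maxxx.
Qed.

End Eval.
End Network.

(** * Smooth strictly convex fluxes *)

Section Flux.
Variables (R : realType) (F : R -> R).
Hypothesis smF : smooth F.

Lemma smooth_continuous n : continuous (derive1n n F).
Proof.
by move=> x; apply: differentiable_continuous; apply/derivable1_diffP; exact: smF.
Qed.

Lemma smooth_is_derive n (x : R) : is_derive x 1 (derive1n n F) (derive1n n.+1 F x).
Proof.
rewrite -[derive1n n.+1 F]/((derive1n n F)^`())%classic derive1E; apply: DeriveDef => //; exact: smF.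
Qed.

Lemma continuous_bounded (f : R -> R) (M : R) : continuous f -> 0 <= M ->
  exists2 B, 0 <= B & forall v, `|v| <= M -> `|f v| <= B.
Proof.
move=> cf M0; have MM : - M <= M by lra.
have cn : continuous (fun x => `|f x|).
  by move=> x; apply: (continuous_comp (cf x)); exact: norm_continuous.
have [c _ hc] := EVT_max MM (continuous_subspaceT cn).
by exists `|f c| => // v; rewrite ler_norml => vM; apply: hc; rewrite in_itv.
Qed.

Lemma derive_lipschitz (M : R) : 0 <= M ->
  exists2 L, 0 <= L & forall a b, `|a| <= M -> `|b| <= M -> a <= b ->
    derive1n 1 F b - derive1n 1 F a <= L * (b - a).
Proof.
move=> M0; have [L L0 hL] := continuous_bounded (@smooth_continuous 2) M0.
exists L => // a b; rewrite !ler_norml => /andP[a1 a2] /andP[b1 b2] ab.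
have [c] := MVT_segment ab (fun x _ => smooth_is_derive 1 x) (continuous_subspaceT (@smooth_continuous 1)).
rewrite in_itv /= => /andP[c1 c2] ->; apply: ler_wpM2r; first by rewrite subr_ge0.
apply: le_trans (ler_norm _) _; apply: hL; rewrite ler_norml; apply/andP; split; lra.
Qed.

(** Convexity bounds every difference quotient at [a] in the direction of [b] by the chord, and the
    quotients tend to the derivative. *)
Lemma strictly_convex_tangent : strictly_convex F ->
  forall a b, F a + derive1n 1 F a * (b - a) <= F b.
Proof.
move=> sc a b; have [->|ab] := eqVneq b a; first by rewrite subrr mulr0 addr0.
apply/ler_addgt0Pr => e e0.
have d0 : 0 < `|b - a| by rewrite normr_gt0 subr_eq0.
have e1 : 0 < e / `|b - a| by exact: divr_gt0.
have /cvgrPdist_le/(_ _ e1) := @smF 0%N a; rewrite -/(derive _ _ _) -derive1E /= => /nbhs_ballP[d /= dp hd].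
(* The first bound keeps [l] inside the open unit interval, the second keeps the increment
   [l * (b - a)] inside the neighbourhood of radius [d]. *)
pose l := Num.min (1 / 2) (d / (2 * `|b - a|)).
have l0 : 0 < l by rewrite lt_min; apply/andP; split; [lra | rewrite divr_gt0 ?mulr_gt0].
have l1 : l <= 1 / 2 by rewrite ge_min lexx.
have l2 : l <= d / (2 * `|b - a|) by rewrite ge_min lexx orbT.
have t0 : l * (b - a) != 0 by apply: mulf_neq0; [rewrite gt_eqF | rewrite subr_eq0].
have := hd (l * (b - a)); rewrite /ball /= sub0r normrN normrM (gtr0_norm l0) => /(_ _ t0).
have -> : l * `|b - a| < d.
  by move: l2; rewrite ler_pdivlMr ?mulr_gt0 // => l2; lra.
move=> /(_ isT); rewrite [_ *: 1]mulr1 -[_ *: (_ - _)]/(_ * _).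
have -> : l * (b - a) + a = l * b + (1 - l) * a by ring.
set q := _^-1 * _ => hq.
have lt : F (l * b + (1 - l) * a) < l * F b + (1 - l) * F a.
  by apply: sc => //; apply/andP; split; lra.
have qE : q * (b - a) * l = F (l * b + (1 - l) * a) - F a.
  by rewrite /q; field; rewrite (gt_eqF l0) subr_eq0 ab.
have : q * (b - a) <= F b - F a by rewrite -(ler_pM2r l0) qE; lra.
have : (F^`())%classic a * (b - a) <= q * (b - a) + e.
  rewrite -lerBlDl -mulrBl; apply: le_trans (ler_norm _) _; rewrite normrM.
  by rewrite -ler_pdivlMr.
by rewrite /=; lra.
Qed.

End Flux.

(** * Assembly of the estimates and choice of the parameters *)

Section Approximation.
Variables (R : realType) (T : R) (F u0 : R -> R) (u : R -> R -> R) (K : nat).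
Local Notation mu := (@lebesgue_measure R).
Local Notation dF := (derive1n 1 F).
Local Notation V := (TV01 u0).
Hypothesis T0 : 0 < T.
Hypothesis smF : smooth F.
Hypothesis sc : strictly_convex F.
Hypothesis u0U : in_U u0.
Hypothesis sol : entropy_solution T F u0 u.
Hypothesis uz : forall x t, 0 <= t < T -> (x <= 0 \/ 1 <= x) -> u x t = 0.
Hypothesis K0 : (0 < K)%N.

Let tang := strictly_convex_tangent smF sc.

Lemma solution_stability (Gr : seq R) (om t : R) (st st' : fstate R) :
  (forall a b, a \in Gr -> b \in Gr -> a < b -> (forall p, p \in Gr -> ~~ (a < p < b)) ->
     2 * (dF b - dF a) <= om) -> 0 <= om -> t < T -> evo F dF Gr st t st' ->
  (L1 (fun x => (u x t - fprofile st' x)%R) <=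
   L1 (fun x => (u0 x - fprofile st x)%R) + (om * t * total_jump (fn st) (fk st))%:E)%E.
Proof.
move=> fine om0 tT ev; have [mu_ [[M uM] [kru [ui uc]]]] := sol.
have uM' x s : 0 <= s < T -> `|u x s| <= Num.max M 0.
  by move=> sT; rewrite le_max uM.
have M0 : 0 <= Num.max M 0 by rewrite le_max lexx orbT.
have [MF _ FM] := continuous_bounded (@smooth_continuous _ _ smF 0) M0.
have := evo_stability tang fine om0 mu_ (@smooth_continuous _ _ smF 0) uM' FM uz kru uc ev (lexx 0).
rewrite add0r => /(_ tT); under [X in (_ <= L1 X + _)%E]eq_fun do rewrite ui.
exact.
Qed.

Lemma solution_measurable t : measurable_fun setT (u ^~ t).
Proof. by have [mu_ _] := sol; exact: measurable_slice. Qed.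

Lemma initial_measurable : measurable_fun setT u0.
Proof.
have [_ [_ [_ [ui _]]]] := sol; rewrite (_ : u0 = u ^~ 0); first exact: solution_measurable.
by apply/funext => x; rewrite ui.
Qed.

Lemma initial_zero x : x <= 0 \/ 1 <= x -> u0 x = 0.
Proof.
have [_ [_ [_ [ui _]]]] := sol; rewrite -ui; apply: uz; by rewrite lexx.
Qed.

Lemma integral_le_L1 (f : R -> R) : measurable_fun setT f ->
  (\int[mu]_(x in `]0%R, 1%R[) `|f x|%:E <= L1 f)%E.
Proof.
move=> mf; apply: ge0_subset_integral => //.
by apply/measurable_EFinP; exact: measurableT_comp.
Qed.

Lemma integral_triangle (f g h : R -> R) : measurable_fun setT f -> measurable_fun setT g ->
  measurable_fun setT h ->
  (\int[mu]_(x in `]0%R, 1%R[) `|f x - h x|%:E <=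
   \int[mu]_(x in `]0%R, 1%R[) `|f x - g x|%:E + \int[mu]_(x in `]0%R, 1%R[) `|g x - h x|%:E)%E.
Proof.
move=> mf mg mh; have mI := @measurable_itv R `]0%R, 1%R[.
have mE (k : R -> R) : measurable_fun setT k -> measurable_fun (`]0%R, 1%R[%classic : set R) (fun x => `|k x|%:E).
  by move=> mk; apply: measurable_funTS; apply/measurable_EFinP; exact: measurableT_comp.
have m1 := mE _ (measurable_funB mf mg); have m2 := mE _ (measurable_funB mg mh).
have m3 := mE _ (measurable_funB mf mh).
rewrite -ge0_integralD //; apply: ge0_le_integral => //; first exact: emeasurable_funD.
move=> x _; rewrite -EFinD lee_fin.
by rewrite (_ : f x - h x = (f x - g x) + (g x - h x)) ?ler_normD //; ring.
Qed.

Lemma solution_jumps : 0 < V -> exists w n, [/\ jumps_approx w n, (n <= 20 * K)%N &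
  forall t, 0 < t -> t < T ->
    (\int[mu]_(x in `]0%R, 1%R[) `|u x t - w t x|%:E <= (7 * (V / K%:R))%:E)%E].
Proof.
move=> V0; have [N [N0 N1 NV]] := variation_primitive u0U.2.
have KR : 0 < K%:R :> R by rewrite ltr0n.
pose h := V / K%:R; have h0 : 0 < h by exact: divr_gt0.
have VV : - V <= V by lra.
have [pm pmI pmin] := EVT_min VV (continuous_subspaceT (@smooth_continuous _ _ smF 0)).
have pmV : `|pm| <= V by rewrite ler_norml; move: pmI; rewrite in_itv.
have [L L0 Lip] := derive_lipschitz smF (ltW V0).
(* With mesh [h / m] the derivative of [F] varies by at most [L * h / m] over a gap, and the total
   jump is at most [2 * V]; the rarefaction error is then at most [4 * L * T * V * h / m], hence at
   most [h]. *)
pose m := (Num.truncn (4 * L * T * V)).+1.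
have m0 : (0 < m)%N by [].
have mR : 0 < m%:R :> R by rewrite ltr0n.
have mL : 4 * L * T * V <= m%:R by apply/ltW/truncnS_gt.
pose Gr := qgrid K V pm; pose Gr' := qfine K V m pm.
pose Q := qjumps K V u0.
have sub : {subset [seq q.2 | q <- Q] <= Gr} by exact: (qjumps_grid K0 V0 N0 N1 NV initial_zero).
have sG : {subset Gr <= Gr'} by exact: qgrid_fine.
have sub' : {subset [seq q.2 | q <- Q] <= Gr'} by move=> p /sub /sG.
have G0 : 0 \in Gr by exact: (qgrid0 K0 V0 N0 N1 NV initial_zero).
have lQ : last 0 [seq q.2 | q <- Q] = 0 by exact: last_qjumps initial_zero.
have sQ : sorted <=%O [seq q.1 | q <- Q] by exact: sorted_qjumps.
pose st := fstate_of (fronts Gr 0 Q); pose st' := fstate_of (fronts Gr' 0 Q).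
have vst : fvalid Gr st by exact: fstate_of_valid.
have vst' : fvalid Gr' st' by apply: fstate_of_valid => //; exact: sG.
have [S [D [evS prS szD tauD]]] := ex_evolution tang vst (@fstate_of_sorted _ Gr 0 Q sQ).
have [S' [D' [evS' _ _ _]]] := ex_evolution tang vst' (@fstate_of_sorted _ Gr' 0 Q sQ).
pose w t x := fprofile (fadv F dF st t) x + \sum_(d <- D) dip d t x.
have aw : jumps_approx w (fn st + 2 * size D).
  apply: jumps_approxD; last exact: jumps_approx_dips.
  apply: (jumps_approx_sum (f := fun i t x => (fk st i.+1 - fk st i) * heav (fy st i + fspeed F dF st i * t) x)).
  by move=> i _; exact: jumps_approx_front.
exists w, (fn st + 2 * size D)%N; split => //.
  (* Each front is one unit and each of the at most [2 * fn st] dipoles two, which makes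
     [5 * fn st]. *)
  have szst : (fn st <= 4 * K)%N by exact: (size_qfronts K0 V0 N0 N1 NV initial_zero pm).
  by lia.
move=> t t0 tT.
have mw := aw.1 t; have mS' := measurable_pwc.
have wE : w t = fprofile (S t) by apply/funext => x; rewrite prS // ltW.
have om0 : 0 <= 2 * (L * (h / m%:R)) by do 2 apply: mulr_ge0 => //; rewrite divr_ge0 // ltW.
have step1 : (L1 (fun x => (u x t - fprofile (S' t) x)%R) <= (3 * h)%:E)%E.
  apply: le_trans (solution_stability (om := 2 * (L * (h / m%:R))) _ om0 tT (evS' t (ltW t0))) _.
    move=> a b aG bG ab gap; apply: ler_wpM2l => //.
    have aV := qfine_itv K0 V0 m0 pmV aG; have bV := qfine_itv K0 V0 m0 pmV bG.
    apply: le_trans (Lip a b aV bV (ltW ab)) _; apply: ler_wpM2l => //.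
    exact: (qfine_gap K0 V0 m0 pmV aG bG ab gap).
  have -> : 3 * h = 2 * h + h by ring.
  rewrite EFinD; apply: leeD; first exact: (L1_qfronts K0 V0 N0 N1 NV initial_zero sub' initial_measurable).
  rewrite lee_fin; apply: le_trans (ler_wpM2l _ (total_jump_qfronts K0 V0 N0 N1 NV initial_zero sub')) _.
    by rewrite mulr_ge0 // ltW.
  have -> : 2 * (L * (h / m%:R)) * t * (2 * V) = 4 * L * t * V * h / m%:R by ring.
  rewrite ler_pdivrMr // mulrC ler_pM2l //; apply: le_trans mL.
  by rewrite ler_pM2r //; apply: ler_wpM2l; [rewrite mulr_ge0 | exact: ltW].
have pm_le p : p \in Gr' -> F pm <= F p.
  by move=> /(qfine_itv K0 V0 m0 pmV); rewrite ler_norml => pI; apply: pmin; rewrite in_itv.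
have pmG : pm \in Gr by rewrite inE eqxx.
(* The grids split the upward jumps differently, but all the pieces of a jump start at the same
   node, so the initial potentials agree. *)
have pot x : fpot st x = fpot st' x.
  rewrite /fpot (sum_qfronts initial_zero sub (fun y => pos_part (x - y))).
  by rewrite (sum_qfronts initial_zero sub' (fun y => pos_part (x - y))).
have step2 := coarse_fine sc tang sG G0 (ltW h0)
  (fun p p' pG pG' => qgrid_gaps K0 V0 m0 pmV pG pG') pmG pm_le t0 (evS t (ltW t0)) (evS' t (ltW t0))
  (fun i => @qfronts_itv _ K V u0 K0 Gr i) pot.
apply: le_trans (integral_triangle (solution_measurable t) (measurable_pwc _ _ _ : measurable_fun _ (fprofile (S' t))) mw) _.
have -> : 7 * (V / K%:R) = 3 * h + 4 * h by rewrite /h; ring.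
rewrite EFinD; apply: leeD.
  apply: le_trans (integral_le_L1 _) step1.
  by apply: measurable_funB; [exact: solution_measurable | exact: measurable_pwc].
by rewrite wE.
Qed.
End Approximation.

Section Conclusion.
Variables (R : realType) (T : R) (F u0 : R -> R) (u : R -> R -> R) (K : nat).
Local Notation mu := (@lebesgue_measure R).
Local Notation dF := (derive1n 1 F).
Local Notation V := (TV01 u0).
Hypothesis T0 : 0 < T.
Hypothesis smF : smooth F.
Hypothesis sc : strictly_convex F.
Hypothesis u0U : in_U u0.
Hypothesis sol : entropy_solution T F u0 u.
Hypothesis uz : forall x t, 0 <= t < T -> (x <= 0 \/ 1 <= x) -> u x t = 0.
Hypothesis K0 : (0 < K)%N.

Lemma TV01_ge0 : 0 <= V.
Proof.
have [N [N0 <- NV]] := variation_primitive u0U.2.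
by have := NV 0 1 (lexx 0) ler01 (lexx 1); rewrite N0 subr0; exact: le_trans.
Qed.

(** The case in which [h] would be 0. The state without fronts on the grid reduced to 0 is an
    evolution, and stability shows that [u] remains equal to it. *)
Lemma solution_zero t : V = 0 -> 0 <= t -> t < T -> L1 (fun x => u x t) = 0%E.
Proof.
move=> V0 t0 tT; have iz := initial_zero T0 sol uz.
have u00 x : u0 x = 0.
  have [x0|x0] := leP x 0; first by rewrite iz //; left.
  have [x1|x1] := leP 1 x; first by rewrite iz //; right.
  have [N [N0 N1 NV]] := variation_primitive u0U.2.
  have := NV 0 x (lexx 0) (ltW x0) (ltW x1); have := NV x 1 (ltW x0) (ltW x1) (lexx 1).
  rewrite N0 N1 V0 (iz 0) ?(iz 1); [|by right|by left].
  rewrite !subr0 sub0r normrN => h1 h2.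
  by apply/eqP; rewrite -normr_le0; lra.
pose st := FState 0 (fun _ => 0 : R) (fun _ => 0).
have vst : fvalid [:: 0] st by split => // i _; rewrite inE eqxx.
have ev : evo F dF [:: 0] st t (fadv F dF st t) by exact: (evo_free t0 vst).
have := solution_stability smF sc sol uz _ (lexx 0) tT ev.
have pr x s : fprofile (FState 0 s (fun=> 0 : R)) x = 0 by rewrite /fprofile /pwc big_ord0.
under eq_fun do rewrite pr subr0.
under [X in (_ <= L1 X + _)%E]eq_fun do rewrite pr subr0 u00.
rewrite !mul0r adde0 => h; apply/eqP; rewrite eq_le L1_ge0 andbT; apply: le_trans (h _) _.
  move=> a b; rewrite !inE => /eqP -> /eqP ->; by rewrite ltxx.
by rewrite /L1 integral0_eq // => x _; rewrite normr0.
Qed.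

Lemma solution_units : exists e (U : seq (junit R)), (size U <= 20 * K)%N /\
  forall t, 0 < t -> t < T ->
    (\int[mu]_(x in `]0%R, 1%R[) `|u x t - jeval e U t x|%:E <= (8 * (V / K%:R))%:E)%E.
Proof.
have KR : 0 < K%:R :> R by rewrite ltr0n.
have := TV01_ge0; rewrite le_eqVlt => /predU1P[V0|V0].
  exists 1, [::]; split => // t t0 tT.
  under eq_integral do rewrite /jeval big_nil subr0.
  apply: le_trans (integral_le_L1 (solution_measurable sol t)) _.
  by rewrite (solution_zero (esym V0) (ltW t0) tT) -V0 mul0r mulr0.
have [w [n [[mw [U [B [sU B0 hU]]]] nK wE]]] := solution_jumps T0 smF sc u0U sol uz K0 V0.
have h0 : 0 < V / K%:R by exact: divr_gt0.
have B1 : 0 < B + 1 by lra.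
(* Makes the ramp error [e * B] at most [V / K], uniformly in time; the summand 1 avoids a division
   by 0. *)
pose e := Num.min 1 (V / K%:R / (B + 1)).
have e0 : 0 < e by rewrite lt_min ltr01 divr_gt0.
have e1 : e <= 1 by rewrite ge_min lexx.
have eB : e * B <= V / K%:R.
  have : e <= V / K%:R / (B + 1) by rewrite ge_min lexx orbT.
  rewrite ler_pdivlMr // mulrDr; lra.
exists e, U; split; first by rewrite sU.
move=> t t0 tT; have mj := measurable_jeval e U t.
apply: le_trans (integral_triangle (solution_measurable sol t) (mw t) mj) _.
have -> : 8 * (V / K%:R) = 7 * (V / K%:R) + V / K%:R by ring.
rewrite EFinD; apply: leeD; first exact: wE.
apply: le_trans (integral_le_L1 (measurable_funB (mw t) mj)) _.
by apply: le_trans (hU e t e0 e1 t0) _; rewrite lee_fin.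
Qed.

Lemma supF2_ge0 : 0 <= supF2 F u0.
Proof.
rewrite /supF2; set A := [set _ | _ in _].
(* If the set has no supremum, [sup] takes its default value 0. *)
have [sA|nA] := pselect (has_sup A); last by rewrite sup_out.
have [[a Aa] ubA] := sA; apply: le_trans (ub_le_sup ubA Aa).
by case: Aa => x _ <-.
Qed.

End Conclusion.

Theorem theorem5p4 (R : realType) :
  exists C : R, 0 < C /\
  forall (T : R) (F u0 : R -> R) (u : R -> R -> R) (K : nat),
    0 < T -> smooth F -> strictly_convex F -> in_U u0 ->
    entropy_solution T F u0 u ->
    (* T small enough: the zero boundary conditions at x = 0, 1 hold *)
    (forall x t, 0 <= t < T -> (x <= 0 \/ 1 <= x) -> u x t = 0) ->
    (0 < K)%N ->
    exists N : lrnr R,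
      lrnr_wf N /\ depth N = 5%N /\ rank N = 2%N /\
      (dof N)%:R <= C * K%:R /\ (width N)%:R <= C * (K%:R) ^+ 2 /\
      exists a b c d : nat -> nat -> R,
        forall t : R, 0 < t < T ->
          (\int[@lebesgue_measure R]_(x in `]0%R, 1%R[)
             (`|u x t - lrnr_eval N (fun l i => a l i + b l i * t)
                                    (fun l i => c l i + d l i * t) x|)%:E
           <= (C / K%:R * TV01 u0 * (1 + TV01 u0) * (1 + T * supF2 F u0))%:E)%E.
Proof.
(* A common bound for the error constant 8, the [30 * 20 * K + 28] parameters and the width
   [4 * 20 * K + 1]. *)
exists 1000; split; first by lra.
move=> T F u0 u K T0 smF sc u0U sol uz K0.
have [e [U [sU hU]]] := solution_units T0 smF sc u0U sol uz K0.
have KR : 0 < K%:R :> R by rewrite ltr0n.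
have K1 : 1 <= K%:R :> R by rewrite ler1n.
have sUR : (size U)%:R <= 20 * K%:R :> R by rewrite -natrM ler_nat.
exists (net e U); split; first exact: net_wf.
split => //; split => //; split; first by rewrite net_dof natrD natrM; lra.
split.
  have : (width (net e U))%:R <= (4 * size U + 1)%:R :> R by rewrite ler_nat net_width.
  by rewrite natrD natrM => wU; nra.
(* The weight coefficients are constant in time, and only one bias coefficient, in the first layer,
   is equal to [t]. *)
exists (net_gam0 R), (fun _ _ => 0), (net_th0 R), (net_th1 R) => t /andP[t0 tT].
under eq_integral do rewrite net_eval.
apply: le_trans (hU t t0 tT) _; rewrite lee_fin.
have V0 := TV01_ge0 u0U; have S0 := mulr_ge0 (ltW T0) (supF2_ge0 F u0).
have h0 : 0 <= TV01 u0 / K%:R by rewrite divr_ge0 // ltW.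
have -> : 1000 / K%:R * TV01 u0 * (1 + TV01 u0) * (1 + T * supF2 F u0) =
  TV01 u0 / K%:R * (1000 * ((1 + TV01 u0) * (1 + T * supF2 F u0))) by ring.
rewrite mulrC; apply: ler_wpM2l => //.
have := mulr_ge0 V0 S0; move: (TV01 u0) (T * supF2 F u0) V0 S0 => v s; nra.
Qed.
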